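(* Let $n\ge 1$, let $V_{\mathbb R}$ be a real vector space of dimension $4n$, and set $V_{\mathbb C}=V_{\mathbb R}\otimes_{\mathbb R}\mathbb C$. Let $Compl\subset Gr(2n,V_{\mathbb C})$ be the period domain of complex tori and $\mathcal L_{\mathbb R}=Gr(2n,V_{\mathbb C})\setminus Compl$ its complement. Let $I,R\in \mathrm{End}\,V_{\mathbb R}$ satisfy $I^2=-Id$, $R^2=Id$, $IR+RI=0$, and put $S(I,R)=\{xI+yR+zIR\mid x,y,z\in\mathbb R,\ x^2-y^2-z^2=1\}\subset Compl$. Let $I,N\in \mathrm{End}\,V_{\mathbb R}$ satisfy $I^2=-Id$, $N^2=0$, $N\neq 0$, $IN+NI=0$, and put $S(I,N)=\{\pm I+yN+zIN\mid y,z\in\mathbb R\}\subset Compl$. Then: (1) Each of the two sets $S(I,R)=S(I,R)^+\cup S(I,R)^-$ and $S(I,N)=S(I,N)^+\cup S(I,N)^-$ consists of two connected components, and each of these components is a smooth complex $1$-dimensional submanifold of $Compl$, diffeomorphic to an open $2$-disk. The closures $\overline{S(I,R)}$ and $\overline{S(I,N)}$ in $Gr(2n,V_{\mathbb C})$ (in the analytic topology) are complex-analytic curves. (2) The curve $\overline{S(I,R)}$ is a $\mathbb P^1\subset Gr(2n,V_{\mathbb C})$ that intersects $\mathcal L_{\mathbb R}$ along a real-analytic circle $S^1=\overline{S(I,R)}\cap\mathcal L_{\mathbb R}$ contained in $\{U\in Gr(2n,V_{\mathbb C})\mid \dim_{\mathbb R}(U\cap V_{\mathbb R})=2n\}\subset\mathcal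 L_{\mathbb R}$, and for every $p\in S^1$ one has $T_p\overline{S(I,R)}\cap TC_p\mathcal L_{\mathbb R}=T_pS^1$. (3) The curve $\overline{S(I,N)}$ consists of two connected components $\overline{S(I,N)}^{\pm}=\overline{S(I,N)^{\pm}}$, each of which is a $\mathbb P^1\subset Gr(2n,V_{\mathbb C})$ with exactly one point $p_\pm$ in $\mathcal L_{\mathbb R}$, i.e. $\overline{S(I,N)}^{\pm}\cap\mathcal L_{\mathbb R}=\{p_\pm\}$. The points $p_\pm$ are singular points of $\mathcal L_{\mathbb R}$, and the tangent planes $T_{p_\pm}\overline{S(I,N)}$ intersect the respective tangent cones $TC_{p_\pm}\mathcal L_{\mathbb R}$ trivially (only in $0$).
   Context: $Compl$ is the set of complex structure operators $\{I\in \mathrm{End}\,V_{\mathbb R}\mid I^2=-Id\}$. It is embedded in the Grassmannian $Gr(2n,V_{\mathbb C})$ of $2n$-dimensional complex subspaces of $V_{\mathbb C}$ by $I\mapsto (Id-iI)V_{\mathbb R}$; the image is an open subset, through which $Compl$ is regarded as a complex manifold and identified with this open subset of $Gr(2n,V_{\mathbb C})$. The complement of $Compl$ is the real-analytic locus $\mathcal L_{\mathbb R}=\{U\in Gr(2n,V_{\mathbb C})\mid U\cap V_{\mathbb R}\neq\{0\}\}$, of real codimension $1$. Notation: $S^+$ denotes the connected component containing $I$ and $S^-$ the component containing $-I$ (for $S=S(I,R)$ or $S=S(I,N)$). $T_p$ denotes the (real) tangent space at a smooth point $p$, viewed inside $T_pGr(2n,V_{\mathbb C})\cong \mathrm{Hom}_{\mathbb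 C}(p,V_{\mathbb C}/p)$. $TC_pM\subset T_pGr(2n,V_{\mathbb C})$ denotes the tangent cone at $p$ of a possibly singular subset $M$, i.e. the set of tangent vectors at $p$ of differentiable curves in $M$ starting at $p$.
   Formalization: In (3), the two closures are proved to be the connected components only if dim Im N < 2n; if dim Im N = 2n (always so for n = 1) p_+ = p_- and the closure is connected, so that clause fails; for all N the two P^1's are shown to meet exactly in {p_+}∩{p_-}. *)

(* Defs.v *)
From HB Require Import structures.
From mathcomp Require Import all_boot all_order all_algebra.
From mathcomp Require Import complex ring.
From mathcomp Require Import all_classical all_reals all_analysis.

Set Implicit Arguments.
Unset Strict Implicit.
Unset Printing Implicit Defensive.

Import Order.TTheory GRing.Theory Num.Theory.
Import numFieldNormedType.Exports.

Local Open Scope classical_set_scope.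
Local Open Scope ring_scope.
Local Open Scope complex_scope.

Set Warnings "-redundant-canonical-projection".

(* The usual topology and norm on R[i], as a normed space over itself. *)
#[export, non_forgetful_inheritance]
HB.instance Definition _ (R : realType) := PseudoPointedMetric.copy R[i] R[i]^o.
#[export, non_forgetful_inheritance]
HB.instance Definition _ (R : realType) := NormedModule.copy R[i] R[i]^o.

(** * Complexification *)

(* (u, v) stands for u (x) 1 + v (x) i. *)
Definition complexification (R : realType) (V : vectType R) : Type :=
  (V * V)%type.

Section Complexification.
Context (R : realType) (V : vectType R).
Local Notation VC := (complexification V).
Import VectorInternalTheory.

HB.instance Definition _ := GRing.Zmodule.copy VC (V * V)%type.

Definition cscale (z : R[i]) (w : VC) : VC :=
  (complex.Re z *: w.1 - complex.Im z *: w.2,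
   complex.Re z *: w.2 + complex.Im z *: w.1).

Fact cscaleA a b w : cscale a (cscale b w) = cscale (a * b) w.
Proof.
case: a b w => [a a'] [b b'] [u v]; congr pair => /=;
  rewrite !(scalerBr, scalerDr, scalerBl, scalerDl) !scalerA ?opprD !addrA.
  by rewrite [LHS](ACl (1*4*2*3)).
by rewrite [LHS](ACl (1*4*2*3)).
Qed.

Fact cscale1 : left_id 1 cscale.
Proof. by case=> u v; rewrite /cscale /= !scale1r !scale0r subr0 addr0. Qed.

Fact cscaleDr : right_distributive cscale +%R.
Proof.
case=> a a' [u v] [u' v']; congr pair => /=; rewrite !scalerDr ?opprD.
  exact: addrACA.
exact: addrACA.
Qed.

Fact cscaleDl w : {morph cscale^~ w : a b / a + b}.
Proof.
case: w => u v [a a'] [b b']; congr pair => /=; rewrite !scalerDl ?opprD.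
  exact: addrACA.
exact: addrACA.
Qed.

HB.instance Definition _ := GRing.Zmodule_isLmodule.Build R[i] VC
  cscaleA cscale1 cscaleDr cscaleDl.

Fact complexification_vect_axiom : Vector.axiom (dim V) VC.
Proof.
pose f (w : VC) : 'rV[R[i]]_(dim V) := \row_j (v2r w.1 0 j +i* v2r w.2 0 j).
pose g (x : 'rV[R[i]]_(dim V)) : VC :=
  (r2v (\row_j complex.Re (x 0 j)), r2v (\row_j complex.Im (x 0 j))).
exists f.
  move=> [a a'] [u v] [u' v']; apply/rowP => j; rewrite !mxE /=.
  by rewrite !raddfD /= !raddfN /= !linearZ /= !mxE; simpc.
exists g => [[u v]|x]; rewrite /f /g /=.
  by congr pair; apply: (can_inj v2rK); rewrite r2vK;
    apply/rowP => j; rewrite !mxE.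
by apply/rowP => j; rewrite !mxE /= !r2vK !mxE; case: (x 0 j).
Qed.

HB.instance Definition _ :=
  Lmodule_hasFinDim.Build R[i] VC complexification_vect_axiom.

(* The inclusion of V_R in V_C and the C-linear extension of an operator. *)
Definition real_vec (v : V) : VC := (v, 0).

Definition complexify_fun (f : 'End(V)) (w : VC) : VC := (f w.1, f w.2).

Fact complexify_fun_linear f : linear (complexify_fun f).
Proof.
move=> [a a'] [u v] [u' v']; congr pair => /=;
  by rewrite !linearD /= ?linearN /= !linearZ.
Qed.

HB.instance Definition _ f :=
  GRing.isLinear.Build R[i] VC VC _ (complexify_fun f) (complexify_fun_linear f).

Definition complexify (f : 'End(V)) : 'End(VC) := linfun (complexify_fun f).

Lemma complexifyE f w : complexify f w = (f w.1, f w.2).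
Proof. by rewrite lfunE. Qed.

Lemma dim_complexification : \dim {:VC} = \dim {:V}.
Proof. by rewrite !dimvf. Qed.

End Complexification.

(** * Complex structures and their period points *)

Section Periods.
Context (R : realType) (V : vectType R).
Local Notation VC := (complexification V).

Record compl_structure := ComplStructure {
  cs_op :> 'End(V);
  cs_sqr : (cs_op \o cs_op)%VF = - \1%VF }.

(* The image of all of V_C under Id - iJ; since J^2 = -Id it is already the
   image of V_R, see mem_period_space. *)
Definition period_space (J : 'End(V)) : {vspace VC} :=
  limg (\1 - 'i%C *: complexify J)%VF.

Lemma cs_opK (J : compl_structure) v : J (J v) = - v.
Proof. by rewrite -comp_lfunE cs_sqr opp_lfunE id_lfunE. Qed.

Lemma mem_period_space (J : compl_structure) w :
  w \in period_space J <->
  exists v, w = real_vec v - 'i%C *: real_vec (J v).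
Proof.
have E v : real_vec v - 'i%C *: real_vec (J v) = (v, - J v) :> VC.
  by congr pair => /=; rewrite ?scale0r ?scale1r ?scaler0 ?subr0 ?addr0 ?add0r.
split=> [/memv_imgP[[u v] _ ->]|[v ->]].
  exists (u + J v); rewrite E add_lfunE opp_lfunE scale_lfunE id_lfunE complexifyE.
  congr pair => /=.
    by rewrite !scale0r !scale1r sub0r opprK.
  by rewrite !scale0r !scale1r add0r linearD /= cs_opK opprD opprK addrC.
apply/memv_imgP; exists (real_vec v); first exact: memvf.
by rewrite add_lfunE opp_lfunE scale_lfunE id_lfunE complexifyE /= linear0.
Qed.

Fact cs_opp_sqr (J : compl_structure) : ((- cs_op J) \o (- cs_op J))%VF = - \1%VF.
Proof.
apply/lfunP => v; rewrite comp_lfunE !opp_lfunE id_lfunE linearN /=.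
by rewrite opprK cs_opK.
Qed.

Definition cs_opp (J : compl_structure) := ComplStructure (cs_opp_sqr J).

Let cj (w : VC) : VC := (w.1, - w.2).

Let le_dim_period_opp (J : compl_structure) :
  (\dim (period_space J) <= \dim (period_space (cs_opp J)))%N.
Proof.
have cjZ a w : cj (a *: w) = conjc a *: cj w.
  case: a w => a b [u v]; congr pair => /=.
    by rewrite scaleNr scalerN opprK.
  by rewrite scaleNr scalerN opprD.
have cjD : {morph cj : u v / u + v}.
  by move=> [u v] [u' v']; congr pair => //=; rewrite opprD.
have cjK : involutive cj by move=> [u v]; congr pair => /=; rewrite opprK.
have cj0 : cj 0 = 0 by congr pair; rewrite oppr0.
have cjS I r (P : pred I) F : cj (\sum_(i <- r | P i) F i) = \sum_(i <- r | P i) cj (F i).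
  exact: (big_morph cj cjD cj0).
set X := vbasis (period_space J).
have /andP[_ frX] : basis_of (period_space J) X by exact: vbasisP.
have fr : free (map_tuple cj X).
  apply/freeP => k k0 i.
  have /freeP/(_ (fun i => conjc (k i))) := frX.
  move=> kc0; rewrite -[k i]conjcK kc0 ?rmorph0 //.
  apply: (can_inj cjK); rewrite cj0 cjS -[RHS]k0; apply: eq_bigr => j _.
  by rewrite cjZ conjcK (nth_map 0) ?size_tuple.
rewrite -[leqLHS](size_tuple (map_tuple cj X)) -(eqP fr).
apply: dimvS; apply/span_subvP => _ /mapP[w /vbasis_mem wJ ->].
have [v ->] := (mem_period_space J w).1 wJ.
apply/(mem_period_space (cs_opp J)); exists v; rewrite /= opp_lfunE.
by congr pair => /=; rewrite ?(scale0r, scale1r, scaler0, subr0, addr0, add0r, opprK, oppr0).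
Qed.

Lemma dim_period_space (J : compl_structure) :
  (\dim (period_space J) * 2 = \dim {:V})%N.
Proof.
have dimE : \dim (period_space J) = \dim (period_space (cs_opp J)).
  apply/eqP; rewrite eqn_leq le_dim_period_opp /=.
  have := le_dim_period_opp (cs_opp J).
  by rewrite [cs_op (cs_opp (cs_opp J))]opprK.
rewrite muln2 -addnn {1}dimE -dim_complexification.
rewrite -(limg_ker_dim (\1 - 'i%C *: complexify (cs_opp J))%VF {:VC}) capfv.
rewrite addnC; congr (_ + _)%N; congr (\dim _); apply/vspaceP => -[u v].
apply/idP/idP.
  move/(mem_period_space J) => [x ->].
  rewrite memv_ker add_lfunE opp_lfunE scale_lfunE id_lfunE complexifyE /=.
  apply/eqP; congr pair => /=;
    rewrite ?opp_lfunE ?linear0 ?(scale0r, scale1r, scaler0, subr0, addr0, add0r, opprK, oppr0, sub0r).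
    by rewrite linearN /= cs_opK opprK subrr.
  by rewrite addNr.
rewrite memv_ker add_lfunE opp_lfunE scale_lfunE id_lfunE complexifyE /=.
rewrite !opp_lfunE => /eqP[] /= e1 e2.
apply/(mem_period_space J); exists u.
congr pair => /=; rewrite ?(scale0r, scale1r, scaler0, subr0, addr0, add0r, opprK, oppr0, sub0r) //.
by move: e2; rewrite !scale0r scale1r add0r opprK => /eqP; rewrite addr_eq0 => /eqP.
Qed.

End Periods.

(** * Manifolds presented by parametrisations *)

(* A manifold over K modelled on E is presented by a set of parametrisations
   E -> T (inverse charts), each defined on the whole of E; a space of
   coordinates carries the single parametrisation id. *)
Definition id_atlas (E : Type) : set (E -> E) := [set idfun].
Arguments id_atlas E : clear implicits.

(* A regularity class: cls f x means that f is of the class near x. *)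
Definition regularity (K : numFieldType) :=
  forall E F : normedModType K, (E -> F) -> E -> Prop.

Definition holomorphic (R : realType) : regularity R[i] :=
  fun E F f x => \forall y \near x, differentiable f y.

Fixpoint Ck (K : numFieldType) (E F : normedModType K) (k : nat)
    (U : set E) (f : E -> F) : Prop :=
  match k with
  | 0 => forall x, U x -> {for x, continuous f}
  | k'.+1 => (forall x, U x -> differentiable f x) /\
             forall v, Ck k' U ('D_v f)
  end.

Definition smooth (R : realType) : regularity R :=
  fun E F f x => exists2 U : set E, open_nbhs x U & forall k, Ck k U f.

Definition multilinear (K : numFieldType) (E F : normedModType K) (k : nat)
    (L : ('I_k -> E) -> F) : Prop :=
  forall (i : 'I_k) (x : 'I_k -> E) (a : K) (u v : E),
    L (dfwith x i (a *: u + v)) = a *: L (dfwith x i u) + L (dfwith x i v).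

(* f (x + h) is the sum, for small h, of a series of homogeneous polynomials
   p_k (h, .., h) whose polarisations satisfy ||p_k|| <= M r^-k. *)
Definition real_analytic (R : realType) : regularity R :=
  fun E F f x => exists (p : forall k, ('I_k -> E) -> F) (r M : R),
    [/\ 0 < r, forall k, multilinear (@p k),
        forall k u, `|p k u| <= M / r ^+ k * \prod_(i < k) `|u i|
      & forall h, `|h| < r ->
          (fun m => \sum_(k < m) p k (fun=> h)) @ \oo --> f (x + h)].

Section Manifolds.
Context (K : numFieldType) (cls : regularity K).

(* g is of class cls on the arbitrary subset X: near every point of X it is,
   in charts, the restriction to X of a map of class cls. *)
Definition regular_on (T T' : Type) (E E' : normedModType K)
    (A : set (E -> T)) (A' : set (E' -> T')) (X : set T) (g : T -> T') :=
  forall p, X p -> exists (phi : E -> T) (psi : E' -> T') (x : E) (f : E -> E'),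
    [/\ A phi, A' psi, phi x = p, cls f x
      & \forall z \near x, X (phi z) -> g (phi z) = psi (f z)].

(* Diffeomorphism, in the class cls, of arbitrary subsets of manifolds. *)
Definition isomorphic (T T' : Type) (E E' : normedModType K)
    (A : set (E -> T)) (A' : set (E' -> T')) (X : set T) (Y : set T') :=
  exists (g : T -> T') (h : T' -> T),
    [/\ (forall p, X p -> Y (g p) /\ h (g p) = p),
        (forall q, Y q -> X (h q) /\ g (h q) = q),
        regular_on A A' X g & regular_on A' A Y h].

(* Near p, Z is isomorphic to an open subset of K^d; the inverse being locally
   the restriction of a map of class cls on the ambient manifold, this is an
   embedded submanifold of dimension d. *)
Definition submanifold_at (T : topologicalType) (E : normedModType K)
    (A : set (E -> T)) (d : nat) (Z : set T) (p : T) :=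
  Z p /\ exists (W : set T) (D : set 'rV[K]_d),
    [/\ open_nbhs p W, open D & isomorphic A (id_atlas 'rV[K]_d) (Z `&` W) D].

Definition submanifold (T : topologicalType) (E : normedModType K)
    (A : set (E -> T)) (d : nat) (Z : set T) :=
  forall p, Z p -> submanifold_at A d Z p.

End Manifolds.

Section ComplexCurves.
Context (R : realType) (T : topologicalType) (E : normedModType R[i]).
Context (A : set (E -> T)).

(* Locally the common zero set of finitely many holomorphic functions. *)
Definition analytic_subset (Z : set T) :=
  forall p, exists (phi : E -> T) (x : E) (r : nat) (f : E -> 'rV[R[i]]_r),
    [/\ A phi, phi x = p, holomorphic f x
      & \forall z \near x, Z (phi z) <-> f z = 0].

(* Pure of dimension 1: the points where Z is a submanifold of dimension 1 are
   dense in Z. *)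
Definition analytic_curve (Z : set T) :=
  analytic_subset Z /\
  Z `<=` closure [set p | submanifold_at (@holomorphic R) A 1 Z p].

End ComplexCurves.

Section Tangents.
Context (R : realType) (T : Type) (E : normedModType R).

(* Tangent vectors at phi x are written in the coordinates of phi (for a
   Grassmannian and the chart of a basis adapted to p = phi 0, the coordinates
   are the matrices of the elements of Hom(p, W/p)). The tangent space consists
   of the velocities of smooth curves in Z through phi x. *)
Definition tangent_space (phi : E -> T) (Z : set T) (x : E) : set E :=
  [set h | exists gamma : R -> E,
    [/\ smooth gamma 0, gamma 0 = x, (\forall t \near 0, Z (phi (gamma t)))
      & 'D_1 gamma 0 = h]].

(* Velocities at 0 of differentiable curves [0, e) -> Z starting at phi x. *)
Definition tangent_cone (phi : E -> T) (Z : set T) (x : E) : set E :=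
  [set h | exists (gamma : R -> E) (e : R),
    [/\ 0 < e, gamma 0 = x, (forall t, 0 <= t < e -> Z (phi (gamma t))),
        (forall t, 0 < t < e -> derivable gamma t 1)
      & (fun t => t^-1 *: (gamma t - gamma 0)) @ 0^'+ --> h]].

End Tangents.

(** * Grassmannians *)

Section Grassmannian.
Context (R : realType).

Record grassmannian (k : nat) (W : vectType R[i]) := Grassmannian {
  gr_space :> {vspace W};
  _ : \dim gr_space == k }.

Context (k : nat) (W : vectType R[i]).
Local Notation Gr := (grassmannian k W).
Local Notation coord_mx K := 'M[K]_(k, \dim {:W} - k).

HB.instance Definition _ := [isSub of Gr for @gr_space k W].
HB.instance Definition _ := [Choice of Gr by <:].

(* The affine chart of a basis e of W: the matrix X goes to the graph of the
   linear map with matrix X from <e_0, .., e_(k-1)> to <e_k, ..>. *)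
Definition graph_space (e : (\dim {:W}).-tuple W) (X : coord_mx R[i]) :
    {vspace W} :=
  <<[seq (e`_i + \sum_j X i j *: e`_(k + j))%R | i : 'I_k]>>%VS.

Definition gr_atlas : set (coord_mx R[i] -> Gr) :=
  [set phi | exists2 e : (\dim {:W}).-tuple W, basis_of fullv e
     & forall X, phi X = graph_space e X :> {vspace W}].

Definition gr_real_atlas : set (coord_mx R * coord_mx R -> Gr) :=
  [set phi | exists2 psi, gr_atlas psi
     & forall z : coord_mx R * coord_mx R,
         phi z = psi (\matrix_(i, j) (z.1 i j +i* z.2 i j))].

(* The topology of the manifold: the charts are open embeddings. *)
Definition gr_open : set_system Gr :=
  [set A | forall phi, gr_atlas phi -> open (phi @^-1` A)].

Fact gr_openT : gr_open setT.
Proof. by move=> phi _; rewrite preimage_setT; exact: openT. Qed.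

Fact gr_openI : setI_closed gr_open.
Proof.
move=> A B oA oB phi phiA; rewrite preimage_setI.
by apply: openI; [exact: oA|exact: oB].
Qed.

Fact gr_open_bigU (I : Type) (f : I -> set Gr) :
  (forall i, gr_open (f i)) -> gr_open (\bigcup_i f i).
Proof.
move=> of_ phi phiA; rewrite preimage_bigcup.
by apply: bigcup_open => i _; exact: of_.
Qed.

HB.instance Definition _ :=
  isOpenTopological.Build Gr gr_openT gr_openI gr_open_bigU.

End Grassmannian.

Arguments gr_atlas {R} k W.
Arguments gr_real_atlas {R} k W.

(** * The period domain and the curves S(I,R), S(I,N) *)

Section PeriodDomain.
Context (R : realType) (n : nat) (V : vectType R).
Context (dimV : \dim {:V} = (4 * n)%N).
Local Notation Gr := (grassmannian (2 * n) (complexification V)).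

Fact period_subproof (J : compl_structure V) :
  \dim (period_space J) == (2 * n)%N.
Proof. by rewrite -(eqn_pmul2r (isT : 0 < 2)%N) dim_period_space dimV mulnAC. Qed.

Definition period (J : compl_structure V) : Gr :=
  Grassmannian (period_subproof J).

Definition Compl : set Gr := range period.

Definition real_locus : set Gr := ~` Compl.

End PeriodDomain.

Section Curves.
Context (R : realType) (V : vectType R).

Definition IR_pair (I Q : 'End(V)) :=
  (Q \o Q)%VF = \1%VF /\ (I \o Q)%VF + (Q \o I)%VF = 0.

Definition IN_pair (I N : 'End(V)) :=
  [/\ (N \o N)%VF = 0, N != 0 & (I \o N)%VF + (N \o I)%VF = 0].

(* Ranging over complex structures J loses nothing: see IR_pair_sqr and
   IN_pair_sqr. *)
Definition S_IR (I Q : 'End(V)) : set (compl_structure V) :=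
  [set J | exists x y z : R, x ^+ 2 - y ^+ 2 - z ^+ 2 = 1 /\
     J = x *: I + y *: Q + z *: (I \o Q)%VF :> 'End(V)].

Definition S_IN (I N : 'End(V)) : set (compl_structure V) :=
  [set J | exists (b : bool) (y z : R),
     J = (-1) ^+ b *: I + y *: N + z *: (I \o N)%VF :> 'End(V)].

Import VectorInternalTheory.

Lemma IR_pair_sqr (I : compl_structure V) (Q : 'End(V)) (x y z : R) :
  IR_pair I Q -> x ^+ 2 - y ^+ 2 - z ^+ 2 = 1 ->
  let J := x *: cs_op I + y *: Q + z *: (I \o Q)%VF in
  (J \o J)%VF = - \1%VF.
Proof.
move=> [QQ IQ] xyz J; have QQv v : Q (Q v) = v by rewrite -comp_lfunE QQ id_lfunE.
have QIv v : Q (I v) = - I (Q v).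
  by apply/eqP; rewrite -addr_eq0 addrC -!comp_lfunE -add_lfunE IQ zero_lfunE.
apply/lfunP => v; rewrite comp_lfunE !(add_lfunE, scale_lfunE, comp_lfunE).
rewrite opp_lfunE id_lfunE -[in RHS](scale1r v) -xyz.
have ID w1 w2 : I (w1 + w2) = I w1 + I w2 by rewrite linearD.
have IZ c w : I (c *: w) = c *: I w by rewrite linearZ.
have QD w1 w2 : Q (w1 + w2) = Q w1 + Q w2 by rewrite linearD.
have QZ c w : Q (c *: w) = c *: Q w by rewrite linearZ.
have IN_ w : I (- w) = - I w by rewrite linearN.
rewrite !(ID, IZ, QD, QZ) !QIv !QQv !IN_ !cs_opK.
have vD (w1 w2 : V) : v2r (w1 + w2) = v2r w1 + v2r w2 by rewrite linearD.
have vN (w : V) : v2r (- w) = - v2r w by rewrite linearN.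
have vZ c (w : V) : v2r (c *: w) = c *: v2r w by rewrite linearZ.
by apply: v2r_inj; apply/rowP => j; rewrite !(vD, vN, vZ) !mxE; ring.
Qed.

Lemma IN_pair_sqr (I : compl_structure V) (N : 'End(V)) (b : bool) (y z : R) :
  IN_pair I N ->
  let J := (-1) ^+ b *: cs_op I + y *: N + z *: (I \o N)%VF in
  (J \o J)%VF = - \1%VF.
Proof.
move=> [NN _ IN] J; have NNv v : N (N v) = 0 by rewrite -comp_lfunE NN zero_lfunE.
have NIv v : N (I v) = - I (N v).
  by apply/eqP; rewrite -addr_eq0 addrC -!comp_lfunE -add_lfunE IN zero_lfunE.
apply/lfunP => v; rewrite comp_lfunE !(add_lfunE, scale_lfunE, comp_lfunE).
rewrite opp_lfunE id_lfunE -[in RHS](scale1r v) -[in RHS](sqrr_sign R b).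
move: ((-1) ^+ b : R) => s.
have ID w1 w2 : I (w1 + w2) = I w1 + I w2 by rewrite linearD.
have IZ c w : I (c *: w) = c *: I w by rewrite linearZ.
have ND w1 w2 : N (w1 + w2) = N w1 + N w2 by rewrite linearD.
have NZ c w : N (c *: w) = c *: N w by rewrite linearZ.
have IN_ w : I (- w) = - I w by rewrite linearN.
have I0 : I 0 = 0 by rewrite linear0.
rewrite !(ID, IZ, ND, NZ) !NIv !NNv !IN_ !I0 !cs_opK.
have vD (w1 w2 : V) : v2r (w1 + w2) = v2r w1 + v2r w2 by rewrite linearD.
have vN (w : V) : v2r (- w) = - v2r w by rewrite linearN.
have v0 : v2r (0 : V) = 0 by rewrite linear0.
have vZ c (w : V) : v2r (c *: w) = c *: v2r w by rewrite linearZ.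
by apply: v2r_inj; apply/rowP => j; rewrite !(vD, vN, vZ, v0) !mxE; ring.
Qed.

(* dim_R (U :&: V_R) = d *)
Definition real_dim (k d : nat) (U : grassmannian k (complexification V)) :=
  exists2 A : {vspace V}, \dim A = d
    & forall v, (v \in A) = (real_vec v \in gr_space U).

End Curves.

Definition open_disk (R : realType) : set 'rV[R]_2 :=
  [set x | x 0 0 ^+ 2 + x 0 1 ^+ 2 < 1].

Definition unit_circle (R : realType) : set 'rV[R]_2 :=
  [set x | x 0 0 ^+ 2 + x 0 1 ^+ 2 = 1].

(** * Properties of subsets of a Grassmannian *)

Section GrassmannianSubsets.
Context (R : realType) (k : nat) (W : vectType R[i]).
Local Notation Gr := (grassmannian k W).

Definition complex_curve_disk (Z : set Gr) :=
  submanifold (@holomorphic R) (gr_atlas k W) 1 Z /\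
  isomorphic (@smooth R) (gr_real_atlas k W) (id_atlas 'rV[R]_2)
    Z (@open_disk R).

Definition is_P1 (Z : set Gr) :=
  isomorphic (@holomorphic R) (gr_atlas 1 'rV[R[i]]_2) (gr_atlas k W) setT Z.

Definition is_analytic_circle (Z : set Gr) :=
  isomorphic (@real_analytic R) (id_atlas 'rV[R]_2) (gr_real_atlas k W)
    (@unit_circle R) Z.

Definition singular_point (Z : set Gr) (p : Gr) :=
  Z p /\ forall d, ~ submanifold_at (@smooth R) (gr_real_atlas k W) d Z p.

End GrassmannianSubsets.

Section Conclusions.
Context (R : realType) (n : nat) (V : vectType R).
Context (dimV : \dim {:V} = (4 * n)%N).
Local Notation Gr := (grassmannian (2 * n) (complexification V)).
Local Notation L := (real_locus dimV).

Definition two_complex_disks (I : compl_structure V) (S : set Gr) :=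
  let Sp := connected_component S (period dimV I) in
  let Sm := connected_component S (period dimV (cs_opp I)) in
  [/\ S `<=` Compl dimV, S = Sp `|` Sm, Sp `&` Sm = set0,
      complex_curve_disk Sp & complex_curve_disk Sm].

Definition touches_real_locus (Z C : set Gr) (p : Gr) :=
  [/\ is_P1 C, C `&` L = [set p], singular_point L p
    & forall phi x, gr_real_atlas _ _ phi -> phi x = p ->
        tangent_space phi Z x `&` tangent_cone phi L x = [set 0]].

End Conclusions.

(* Main.v *)
From HB Require Import structures.
Require Import Defs.
From mathcomp Require Import all_boot all_order all_algebra.
From mathcomp Require Import complex ring lra zify.
From mathcomp Require Import all_classical all_reals all_analysis.

Set Implicit Arguments.
Unset Strict Implicit.
Unset Printing Implicit Defensive.

Import Order.TTheory GRing.Theory Num.Theory.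
Import numFieldNormedType.Exports.

Local Open Scope classical_set_scope.
Local Open Scope ring_scope.
Local Open Scope complex_scope.

(** Both curves are made of lines of one kind. Given a basis e of V_C and r <= k,
    the line of e consists of the k-dimensional subspaces
      < s e_i + t e_(k+i) (i < r), e_j (r <= j < k) >,   [s : t] in P^1.
    A point of the line is characterised by the proportionality of the coordinates
    of its vectors ([lineP]); these quadratic equations hold in every chart, so a
    line is closed and analytic, and it is isomorphic to P^1 through [s : t]
    ([line_is_P1]). A complex structure is the same as a subspace without nonzero
    real vectors ([real_locusP]).

    If Q^2 = 1 and IQ = -QI, let w be a basis of the eigenspace of Q for 1; then
    (w, Iw) is a real basis, and the period of xI + yQ + zIQ is a point of its
    line with r = 2n. After a Cayley transform, which is a change of the
    homogeneous coordinates, S(I,Q) becomes |s| <> |t|, two disks, and the circle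
    |s| = |t| consists of the points of a real projective line ([IR_disks],
    [IR_circle]).

    If N^2 = 0 and IN = -NI, then N exchanges the two eigenspaces V' and V'' of I,
    and the period of I + yN + zIN is the image of V' under 1 + cN, for
    c = (y - iz) / 2i. With a basis of V' adapted to the kernel of N, these are
    the points [1 : c] of a line, on which the only real point is [0 : 1]
    ([affine_range], [nil_line_real]). The other component is the same
    construction for -I, and the two lines can only meet at their real points
    ([lines_meet]).

    For the tangency statements, a chart turns a tangent vector h into a map on
    the vectors of p with values modulo p. If h is in the tangent cone of the real
    locus, then h maps some nonzero real vector of p to a real vector modulo p:
    normalise real vectors of the points of the curve and pass to the limit along
    an ultrafilter ([tangent_cone_real]). If h is tangent to a line at the point
    [1 : 0], then h multiplies the coordinates by a constant: it maps e_j to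
    c e_(k+j) for j < r and the other e_j to 0 ([line_velocity]). For a real basis
    the two facts give c real, so that h is tangent to the circle
    ([real_line_tangent]). For the lines of S(I,N) they give c = 0
    ([nil_velocity]). Smooth curves with prescribed velocity are obtained by
    Cramer's rule ([affine_curve]).

    Finally, the point p of S(I,N) contains two independent real vectors. The
    directions keeping one of them in the subspace together span all the tangent
    space, but the direction of the line is not in the tangent cone; so the real
    locus has no tangent space at p ([real_locus_singular]). *)

(** * Limits of complex numbers and of matrices *)

Section ComplexTopology.
Context (R : realType).
Implicit Types (T : Type).

Lemma normc_le_ReIm (z : R[i]) :
  `|z| <= (`|complex.Re z| + `|complex.Im z|)%:C.
Proof.
rewrite {1}[z]complexE (le_trans (ler_normD _ _)) // normrM.
rewrite [X in _ + X * _](_ : _ = 1) ?mul1r; last first.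
  by rewrite normc_def /= expr0n expr1n add0r sqrtr1.
by rewrite !normc_def /= expr0n /= !addr0 !sqrtr_sqr -rmorphD.
Qed.

Lemma normc_ge_Im (z : R[i]) : `|complex.Im z|%:C <= `|z|.
Proof.
have := normc_ge_Re (z * - 'i); rewrite mulrN raddfN /= ReiNIm opprK.
rewrite normrN normrM [X in _ * X](_ : _ = 1) ?mulr1 //.
by rewrite normc_def /= expr0n expr1n add0r sqrtr1.
Qed.

Lemma gt0c_real (e : R[i]) : 0 < e -> e = (complex.Re e)%:C /\ 0 < complex.Re e.
Proof. by case: e => a b; rewrite ltcE /= => /andP[/eqP -> ->]. Qed.

Lemma continuous_Re : continuous (@complex.Re R : R[i] -> R).
Proof.
move=> z; apply/(@cvgrPdist_lt _ _ _ _ (nbhs_filter z)) => e e0.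
have : nbhs z (ball z e%:C) by apply: nbhsx_ballx; rewrite ltcR.
apply: filterS => w; rewrite /ball /= => zw.
by rewrite -ltcR (le_lt_trans _ zw) // -raddfB normc_ge_Re.
Qed.

Lemma continuous_Im : continuous (@complex.Im R : R[i] -> R).
Proof.
move=> z; apply/(@cvgrPdist_lt _ _ _ _ (nbhs_filter z)) => e e0.
have : nbhs z (ball z e%:C) by apply: nbhsx_ballx; rewrite ltcR.
apply: filterS => w; rewrite /ball /= => zw.
by rewrite -ltcR (le_lt_trans _ zw) // -raddfB normc_ge_Im.
Qed.

Lemma cvg_complex T (F : set_system T) (FF : Filter F) (f g : T -> R) (a b : R) :
  f @ F --> a -> g @ F --> b -> (fun t => f t +i* g t) @ F --> a +i* b.
Proof.
move=> fa gb; apply/cvgrPdist_lt => e /gt0c_real[-> e0].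
near=> t; rewrite (le_lt_trans (normc_le_ReIm _)) // ltcR /=.
rewrite (splitr (complex.Re e)) ltrD //.
  by near: t; apply: (cvgrPdist_lt _ _).1 => //; rewrite divr_gt0.
by near: t; apply: (cvgrPdist_lt _ _).1 => //; rewrite divr_gt0.
Unshelve. all: by end_near. Qed.

Lemma cvg_real_complex T (F : set_system T) (FF : Filter F) (f : T -> R) (a : R) :
  f @ F --> a -> (fun t => (f t)%:C) @ F --> a%:C.
Proof. by move=> fa; apply: cvg_complex => //; exact: cvg_cst. Qed.

Lemma cvg_mx_entries T (K : numFieldType) (U : normedModType K) m n (F : set_system T) (FF : Filter F)
    (M : T -> 'M[U]_(m, n)) (A : 'M[U]_(m, n)) :
  (forall i j, (fun t => M t i j) @ F --> A i j) -> M @ F --> A.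
Proof.
move=> MA B [P PA PB].
have : \forall t \near F, forall i j, P i j (M t i j).
  apply: filter_forall => i; apply: filter_forall => j.
  exact: (MA i j (P i j) (PA i j)).
by apply: filterS => t tP; apply: PB => i j; exact: tP.
Qed.

End ComplexTopology.

(** * Smooth functions built from elementary operations *)

Section Smoothness.

Lemma near_eq_differentiable (K : numFieldType) (V W : normedModType K)
    (f g : V -> W) (x : V) :
  (\forall y \near x, f y = g y) -> differentiable f x -> differentiable g x.
Proof.
move=> fg df.
pose z0 : {linear V -> W} := \0.
have z0c : continuous z0 by move=> y; exact: cvg_cst.
pose h y := g y - f y.
have hE : h \o shift x = cst (h x) + z0 +o_ 0 id.
  apply/eqaddoP => _/posnumP[e].
  have : \forall y \near 0, f (y + x) = g (y + x).
    by move: fg; rewrite (near_shift 0 x); apply: filterS => y /=; rewrite subr0.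
  apply: filterS => y fgy; rewrite !fctE /= /h fgy (nbhs_singleton fg) !subrr.
  by rewrite !addr0 subr0 normr0 mulr_ge0.
have dh : differentiable h x.
  by apply/diff_locallyP; rewrite (diff_unique z0c hE).
rewrite (_ : g = f + h); first exact: differentiableD.
by apply/funext => y; rewrite fctE /h addrC subrK.
Qed.

Context (R : realType) (E : normedModType R) (U : set E).

(** The point of this class is its stability under directional derivatives, which
    gives all the orders of differentiability at once. Denominators and radicands
    are only constrained on U. *)
Inductive elementary : (E -> R) -> Prop :=
| elementary_cst c : elementary (fun=> c)
| elementary_linear (f : {linear E -> R}) : continuous f -> elementary f
| elementaryD f g : elementary f -> elementary g ->
    elementary (fun x => f x + g x)
| elementaryM f g : elementary f -> elementary g ->
    elementary (fun x => f x * g x)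
| elementaryV f : elementary f -> (forall x, U x -> f x != 0) ->
    elementary (fun x => (f x)^-1)
| elementary_sqrt f : elementary f -> (forall x, U x -> 0 < f x) ->
    elementary (fun x => Num.sqrt (f x)).

Lemma elementaryN f : elementary f -> elementary (fun x => - f x).
Proof.
move=> ef; rewrite (_ : (fun _ => _) = (fun x => -1 * f x)).
  by apply: elementaryM => //; exact: elementary_cst.
by apply/funext => x; rewrite mulN1r.
Qed.

Lemma elementary_differentiable f x : elementary f -> U x -> differentiable f x.
Proof.
move=> + Ux; elim=> [c|g gc|g h _ dg _ dh|g h _ dg _ dh|g _ dg g0|g _ dg g0].
- exact: differentiable_cst.
- exact: linear_differentiable.
- exact: differentiableD.
- exact: differentiableM.
- by apply: differentiableV => //; exact: g0.
- apply: (differentiable_comp dg); apply/derivable1_diffP.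
  by have [] := is_derive1_sqrt (g0 x Ux).
Qed.

Lemma elementary_derive f v : elementary f ->
  exists2 g, elementary g & forall x, U x -> 'D_v f x = g x.
Proof.
elim=> [c|g gc|g h eg [g' eg' dg] eh [h' eh' dh]|
  g h eg [g' eg' dg] eh [h' eh' dh]|g eg [g' eg' dg] g0|g eg [g' eg' dg] g0].
- exists (fun=> 0); first exact: elementary_cst.
  by move=> x _; rewrite derive_cst.
- exists (fun=> g v); first exact: elementary_cst.
  move=> x _; rewrite deriveE ?diff_lin //.
  exact: linear_differentiable.
- exists (fun x => g' x + h' x); first exact: elementaryD.
  move=> x Ux; rewrite deriveD ?dg ?dh //.
    by apply: diff_derivable; exact: elementary_differentiable.
  by apply: diff_derivable; exact: elementary_differentiable.
- exists (fun x => g x * h' x + h x * g' x).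
    by apply: elementaryD; exact: elementaryM.
  move=> x Ux; rewrite deriveM ?dg ?dh //.
    by apply: diff_derivable; exact: elementary_differentiable.
  by apply: diff_derivable; exact: elementary_differentiable.
- exists (fun x => - (((g x)^-1 * (g x)^-1) * g' x)).
    by apply: elementaryN; do ![apply: elementaryM => //]; exact: elementaryV.
  move=> x Ux; rewrite deriveV ?g0 ?dg //.
    by rewrite expr2 invfM scaleNr.
  by apply: diff_derivable; exact: elementary_differentiable.
- exists (fun x => (2 * Num.sqrt (g x))^-1 * g' x).
    apply: elementaryM => //; apply: elementaryV.
      by apply: elementaryM; [exact: elementary_cst|exact: elementary_sqrt].
    by move=> x Ux; rewrite mulf_neq0 ?pnatr_eq0 // gt_eqF // sqrtr_gt0 g0.
  move=> x Ux; have gx := g0 x Ux.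
  have dgx := elementary_differentiable eg Ux.
  have ds : differentiable (Num.sqrt : R -> R) (g x).
    by apply/derivable1_diffP; have [] := is_derive1_sqrt gx.
  rewrite deriveE; last exact: (differentiable_comp dgx ds).
  have := diff_comp dgx ds; rewrite /comp => -> /=; rewrite -(deriveE v dgx) dg //.
  rewrite -[g' x]mulr1 -[in LHS]/(g' x *: 1) linearZ /= -deriveE // derive_sqrt //.
  by rewrite mulr1 [RHS]mulrC.
Qed.

Context (F : normedModType R).

(** Combining fixed vectors with elementary coefficients reduces the derivatives of
    a map to those of scalar functions. *)
Definition elementary_map (f : E -> F) := exists n (c : 'I_n -> E -> R) (w : 'I_n -> F),
  (forall i, elementary (c i)) /\ f = (fun x => \sum_i c i x *: w i).

Lemma eq_Ck k (f g : E -> F) : open U -> (forall x, U x -> f x = g x) ->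
  Ck k U f -> Ck k U g.
Proof.
move=> oU; have nearU x : U x -> \forall y \near x, U y
  by move=> Ux; apply: open_nbhs_nbhs; split.
elim: k f g => [|k IH] f g fg /=.
  move=> fc x Ux; rewrite /prop_for /continuous_at -(fg x Ux).
  apply: cvg_trans (fc x Ux); apply: near_eq_cvg.
  by apply: filterS (nearU x Ux) => y Uy; rewrite fg.
move=> [fd fk]; split=> [x Ux|v].
  apply: near_eq_differentiable (fd x Ux).
  by apply: filterS (nearU x Ux) => y Uy; rewrite fg.
apply: IH (fk v) => x Ux; apply: near_eq_derive.
by apply: filterS (nearU x Ux) => y Uy; rewrite fg.
Qed.

(** By induction on k, as a directional derivative of an elementary map agrees on U
    with an elementary map. *)
Lemma elementary_map_Ck k f : open U -> elementary_map f -> Ck k U f.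
Proof.
move=> oU; elim: k f => [|k IH] f [n [c [w [ec ->]]]] /=.
  move=> x Ux; apply: differentiable_continuous.
  rewrite (_ : (fun x => _) = \sum_i (fun x => c i x *: w i)); last first.
    by apply/funext => y; rewrite fct_sumE.
  apply: differentiable_sum => i; apply: differentiableZl.
  exact: elementary_differentiable.
rewrite (_ : (fun x => _) = \sum_i (fun x => c i x *: w i)); last first.
  by apply/funext => y; rewrite fct_sumE.
have dcw i x : U x -> differentiable (fun x => c i x *: w i) x.
  by move=> Ux; apply: differentiableZl; exact: elementary_differentiable.
split=> [x Ux|v].
  by apply: differentiable_sum => i; exact: dcw.
pose c' i := sval (cid2 (elementary_derive v (ec i))).
apply: (@eq_Ck _ (fun x => \sum_i c' i x *: w i)) => //; last first.
  apply: IH; exists n, c', w; split => // i.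
  by rewrite /c'; case: cid2.
move=> x Ux; rewrite derive_sum; last first.
  by move=> i; apply: diff_derivable; exact: dcw.
apply: eq_bigr => i _; rewrite deriveE; last exact: dcw.
rewrite diffZl; last exact: elementary_differentiable.
rewrite -deriveE; last exact: elementary_differentiable.
by rewrite /c'; case: cid2 => /= g _ ->.
Qed.

Lemma elementary_map_smooth f x : open U -> U x -> elementary_map f -> smooth f x.
Proof.
by move=> oU Ux ef; exists U => // k; exact: elementary_map_Ck.
Qed.

Lemma elementary_map0 : elementary_map (fun=> 0).
Proof.
exists 0, (fun _ _ => 0), (fun=> 0); split=> [i|]; first exact: elementary_cst.
by apply/funext => x; rewrite big_ord0.
Qed.

Lemma elementary_mapZ (c : E -> R) (w : F) : elementary c ->
  elementary_map (fun x => c x *: w).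
Proof.
move=> ec; exists 1, (fun=> c), (fun=> w); split => //.
by apply/funext => x; rewrite big_ord1.
Qed.

Lemma elementary_mapD f g : elementary_map f -> elementary_map g ->
  elementary_map (fun x => f x + g x).
Proof.
move=> [m [c [w [ec ->]]]] [n [d [v [ed ->]]]].
exists (m + n), (fun i => match fintype.split i with inl j => c j | inr j => d j end),
  (fun i => match fintype.split i with inl j => w j | inr j => v j end).
split=> [i|]; first by case: fintype.split.
apply/funext => x; rewrite big_split_ord /=; congr (_ + _);
  apply: eq_bigr => i _.
  by rewrite (unsplitK (inl i)).
by rewrite (unsplitK (inr i)).
Qed.

Lemma elementary_map_sum (I : finType) (f : I -> E -> F) :
  (forall i, elementary_map (f i)) -> elementary_map (fun x => \sum_i f i x).
Proof.
move=> ef; rewrite (_ : (fun x => _) = \sum_i f i); last first.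
  by apply/funext => x; rewrite fct_sumE.
apply: big_ind => [|g h eg eh|i _]; [exact: elementary_map0| |exact: ef].
exact: elementary_mapD.
Qed.

Lemma elementary_scalar (f : E -> R) :
  (forall a u v, f (a *: u + v) = a *: f u + f v) -> continuous f -> elementary f.
Proof.
move=> fl fc; pose fL := GRing.isLinear.Build _ _ _ *:%R f fl.
pose f' : {linear E -> R} := HB.pack f fL.
by rewrite (_ : f = f') //; exact: elementary_linear.
Qed.

Definition elementary_complex (f : E -> R[i]) :=
  elementary (fun x => complex.Re (f x)) /\ elementary (fun x => complex.Im (f x)).

Lemma elementary_complex_cst c : elementary_complex (fun=> c).
Proof. by split; exact: elementary_cst. Qed.

Lemma elementary_complexD f g : elementary_complex f -> elementary_complex g ->
  elementary_complex (fun x => f x + g x).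
Proof.
move=> [fr fi] [gr gi]; split.
  by under eq_fun do rewrite raddfD /=; exact: elementaryD.
by under eq_fun do rewrite raddfD /=; exact: elementaryD.
Qed.

Lemma elementary_complexM f g : elementary_complex f -> elementary_complex g ->
  elementary_complex (fun x => f x * g x).
Proof.
move=> [fr fi] [gr gi].
have ReM (a b : R[i]) : complex.Re (a * b) =
    complex.Re a * complex.Re b + - (complex.Im a * complex.Im b).
  by case: a b => [? ?] [? ?].
have ImM (a b : R[i]) : complex.Im (a * b) =
    complex.Re a * complex.Im b + complex.Im a * complex.Re b.
  by case: a b => [? ?] [? ?].
split.
  under eq_fun do rewrite ReM.
  by apply: elementaryD; [|apply: elementaryN]; exact: elementaryM.
by under eq_fun do rewrite ImM; apply: elementaryD; exact: elementaryM.
Qed.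

Lemma elementary_complexV f : elementary_complex f ->
  (forall x, U x -> f x != 0) -> elementary_complex (fun x => (f x)^-1).
Proof.
move=> [fr fi] f0.
pose q x := complex.Re (f x) * complex.Re (f x) + complex.Im (f x) * complex.Im (f x).
have eq : elementary q by apply: elementaryD; exact: elementaryM.
have q0 x : U x -> q x != 0.
  move=> /f0; apply: contra; rewrite paddr_eq0 -?expr2 ?sqr_ge0 // !sqrf_eq0.
  by case: (f x) => a b /= /andP[/eqP -> /eqP ->].
have ReV (a : R[i]) : complex.Re a^-1 =
    complex.Re a * (complex.Re a * complex.Re a + complex.Im a * complex.Im a)^-1.
  by case: a => a b; rewrite -!expr2.
have ImV (a : R[i]) : complex.Im a^-1 =
    - (complex.Im a * (complex.Re a * complex.Re a + complex.Im a * complex.Im a)^-1).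
  by case: a => a b; rewrite -!expr2.
split.
  under eq_fun do rewrite ReV.
  by apply: elementaryM => //; exact: elementaryV.
under eq_fun do rewrite ImV.
by apply: elementaryN; apply: elementaryM => //; exact: elementaryV.
Qed.

Lemma elementary_complex_sum (I : Type) (r : seq I) (P : pred I) (f : I -> E -> R[i]) :
  (forall i, elementary_complex (f i)) ->
  elementary_complex (fun x => \sum_(i <- r | P i) f i x).
Proof.
move=> ef; rewrite (_ : (fun x => _) = \sum_(i <- r | P i) f i); last first.
  by apply/funext => x; rewrite fct_sumE.
apply: big_ind => [|g h eg eh|i _ //]; first exact: elementary_complex_cst.
exact: elementary_complexD.
Qed.

Lemma elementary_complex_prod (I : Type) (r : seq I) (P : pred I) (f : I -> E -> R[i]) :
  (forall i, elementary_complex (f i)) ->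
  elementary_complex (fun x => \prod_(i <- r | P i) f i x).
Proof.
move=> ef; elim: r => [|i r IH].
  by under eq_fun do rewrite big_nil; exact: elementary_complex_cst.
under eq_fun do rewrite big_cons.
by case: (P i) => //; exact: elementary_complexM.
Qed.

Lemma elementary_complex_det n (A : E -> 'M[R[i]]_n) :
  (forall i j, elementary_complex (fun x => A x i j)) ->
  elementary_complex (fun x => \det (A x)).
Proof.
move=> eA; rewrite /determinant; apply: elementary_complex_sum => s.
apply: elementary_complexM; first exact: elementary_complex_cst.
exact: elementary_complex_prod.
Qed.

End Smoothness.

(** * Coordinates and charts of a Grassmannian *)

Lemma mem_span_image (K : fieldType) (W : vectType K) k (f : 'I_k -> W) w :
  reflect (exists a : 'I_k -> K, w = \sum_i a i *: f i)
    (w \in <<[seq f i | i : 'I_k]>>%VS).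
Proof.
apply: (iffP idP) => [|[a ->]]; last first.
  by apply: memv_suml => i _; apply: memvZ; apply: memv_span;
  apply/mapP; exists i; rewrite ?mem_enum.
have -> : [seq f i | i : 'I_k] = [tuple f i | i < k] by [].
move/coord_span => ->; exists (fun i => coord [tuple f i | i < k] i w).
by apply: eq_bigr => i _; rewrite -tnth_nth tnth_mktuple.
Qed.

Section Coordinates.
Context (R : realType) (W : vectType R[i]).
Local Notation d := (\dim {:W}).
Implicit Types (e : d.-tuple W) (w : W) (n : nat).

(** The coordinates are indexed by natural numbers, and vanish beyond the
    dimension, so that an index k + j does not need to be cast. *)
Definition crd e n w : R[i] := if insub n is Some i then coord e i w else 0.

Fact crd_is_linear e n : scalar (crd e n).
Proof.
rewrite /crd; case: insubP => [i _ _|_] a u v; first by rewrite linearP.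
by rewrite mulr0 addr0.
Qed.

HB.instance Definition _ e n :=
  GRing.isLinear.Build R[i] W R[i] *%R (crd e n) (crd_is_linear e n).

Lemma crdE e (i : 'I_d) w : crd e i w = coord e i w.
Proof. by rewrite /crd valK. Qed.

Lemma crd_basis e n p : basis_of fullv e -> (n < d)%N ->
  crd e n e`_p = (p == n)%:R.
Proof.
move=> eB nd; rewrite (crdE e (Ordinal nd)); have [pd|dp] := ltnP p d.
  by rewrite (coord_free (Ordinal pd) (Ordinal nd)) ?(basis_free eB).
rewrite nth_default ?size_tuple // linear0 gtn_eqF //; exact: leq_trans nd dp.
Qed.

Lemma basis_sum e w : basis_of fullv e -> w = \sum_(i < d) crd e i w *: e`_i.
Proof.
move=> eB; rewrite {1}(coord_basis eB (memvf w)).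
by apply: eq_bigr => i _; rewrite crdE.
Qed.

Lemma crd_inj e w w' : basis_of fullv e ->
  (forall n, (n < d)%N -> crd e n w = crd e n w') -> w = w'.
Proof.
move=> eB ww; rewrite (basis_sum w eB) (basis_sum w' eB).
by apply: eq_bigr => i _; rewrite ww.
Qed.

Lemma eq_on_basis e (f g : {scalar W}) : basis_of fullv e ->
  (forall n, (n < d)%N -> f e`_n = g e`_n) -> f =1 g.
Proof.
move=> eB fg w; rewrite (basis_sum w eB) !linear_sum.
by apply: eq_bigr => i _; rewrite !linearZ /= fg.
Qed.

End Coordinates.

Section Charts.
Context (R : realType) (W : vectType R[i]) (k : nat).
Local Notation d := (\dim {:W}).
Local Notation M := 'M[R[i]]_(k, d - k).
Implicit Types (e : d.-tuple W) (X : M).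

Definition frame e X (i : 'I_k) : W := e`_i + \sum_j X i j *: e`_(k + j).

Lemma crd_frame_low e X i n : (k <= d)%N -> basis_of fullv e -> (n < k)%N ->
  crd e n (frame e X i) = (i == n :> nat)%:R.
Proof.
move=> kd eB nk; have nd := leq_trans nk kd.
rewrite linearD linear_sum /= crd_basis // big1 ?addr0 // => j _.
by rewrite linearZ /= crd_basis // gtn_eqF ?mulr0 // ltn_addr.
Qed.

Lemma crd_frame_high e X i (j : 'I_(d - k)) : basis_of fullv e ->
  crd e (k + j) (frame e X i) = X i j.
Proof.
move=> eB; have jd : (k + j < d)%N by rewrite -ltn_subRL.
rewrite linearD linear_sum /= crd_basis // ltn_eqF ?ltn_addr // add0r.
rewrite (bigD1 j) //= linearZ /= crd_basis // eqxx mulr1 big1 ?addr0 // => l lj.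
by rewrite linearZ /= crd_basis // eqn_add2l (inj_eq val_inj) (negbTE lj) mulr0.
Qed.

Lemma graph_span e X w :
  reflect (exists a : 'I_k -> R[i], w = \sum_i a i *: frame e X i)
    (w \in graph_space e X).
Proof. exact: mem_span_image. Qed.

(** The first k coordinates of a vector of the graph are its components on the frame
    and determine the other ones. *)
Lemma mem_graph e X w : (k <= d)%N -> basis_of fullv e ->
  w \in graph_space e X <->
  forall j : 'I_(d - k), crd e (k + j) w = \sum_(i < k) crd e i w * X i j.
Proof.
move=> kd eB; split=> [/graph_span[a ->] j|wX].
  rewrite linear_sum; apply: eq_bigr => i _ /=.
  rewrite linearZ /= crd_frame_high // linear_sum /=; congr (_ * _).
  rewrite (bigD1 i) //= linearZ /= crd_frame_low // eqxx mulr1 big1 ?addr0 // => l li.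
  by rewrite linearZ /= crd_frame_low // (inj_eq val_inj) (negbTE li) mulr0.
apply/graph_span; exists (fun i => crd e i w).
apply: (crd_inj eB) => n nd; rewrite linear_sum /=; have [nk|kn] := ltnP n k.
  rewrite (bigD1 (Ordinal nk)) //= linearZ /= crd_frame_low // eqxx mulr1.
  rewrite big1 ?addr0 // => l li; rewrite linearZ /= crd_frame_low //.
  by rewrite -[n]/(val (Ordinal nk)) (inj_eq val_inj) (negbTE li) mulr0.
have jd : (n - k < d - k)%N by rewrite ltn_sub2r // (leq_ltn_trans kn).
rewrite -(subnKC kn) (wX (Ordinal jd)); apply: eq_bigr => i _.
by rewrite linearZ /= -[(n - k)%N]/(val (Ordinal jd)) crd_frame_high.
Qed.

Lemma frame_in_graph e X i : frame e X i \in graph_space e X.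
Proof.
apply/graph_span; exists (fun l => (l == i)%:R).
by rewrite (bigD1 i) //= eqxx scale1r big1 ?addr0 // => l /negbTE ->; rewrite scale0r.
Qed.

Lemma graph_inj e X X' : (k <= d)%N -> basis_of fullv e ->
  graph_space e X = graph_space e X' -> X = X'.
Proof.
move=> kd eB XX'; apply/matrixP => i j.
have := frame_in_graph e X i; rewrite XX' => /(mem_graph _ _ kd eB)/(_ j).
rewrite crd_frame_high // => ->; rewrite (bigD1 i) //= crd_frame_low // eqxx mul1r.
rewrite big1 ?addr0 // => l li.
by rewrite crd_frame_low // eq_sym (inj_eq val_inj) (negbTE li) mul0r.
Qed.

Lemma frame_free e X (a : 'I_k -> R[i]) : (k <= d)%N -> basis_of fullv e ->
  \sum_i a i *: frame e X i = 0 -> forall i, a i = 0.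
Proof.
move=> kd eB a0 i; have := congr1 (crd e i) a0; rewrite linear0 linear_sum /=.
rewrite (bigD1 i) //= linearZ /= crd_frame_low // eqxx mulr1 big1 ?addr0 // => l li.
by rewrite linearZ /= crd_frame_low // (inj_eq val_inj) (negbTE li) mulr0.
Qed.

Lemma dim_graph e X : (k <= d)%N -> basis_of fullv e ->
  \dim (graph_space e X) = k.
Proof.
move=> kd eB; rewrite /graph_space -[[seq _ | i : 'I_k]]/(val [tuple frame e X i | i < k]).
have fr : free [tuple frame e X i | i < k].
  apply/freeP => a a0 i; apply: (@frame_free e X a kd eB).
  by rewrite -[RHS]a0; apply: eq_bigr => l _; rewrite -tnth_nth tnth_mktuple.
by rewrite (eqP fr) size_tuple.
Qed.

Lemma gr_chart_subproof e X (kd : (k <= d)%N) (eB : basis_of fullv e) :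
  \dim (graph_space e X) == k.
Proof. by rewrite dim_graph. Qed.

Definition gr_chart e (kd : (k <= d)%N) (eB : basis_of fullv e) X : grassmannian k W :=
  Grassmannian (gr_chart_subproof X kd eB).

Lemma gr_chart_atlas e (kd : (k <= d)%N) (eB : basis_of fullv e) :
  gr_atlas k W (gr_chart kd eB).
Proof. by exists e. Qed.

Lemma gr_eq (A B : grassmannian k W) : gr_space A = gr_space B -> A = B.
Proof. exact: val_inj. Qed.

Lemma gr_dim (A : grassmannian k W) : \dim (gr_space A) = k.
Proof. by case: A => A /= /eqP. Qed.

Lemma gr_atlas_continuous phi : gr_atlas k W phi -> continuous phi.
Proof. by move=> phiA; apply/continuousP => A oA; exact: oA. Qed.

Lemma gr_closedP (A : set (grassmannian k W)) :
  (forall phi, gr_atlas k W phi -> closed (phi @^-1` A)) -> closed A.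
Proof.
move=> cA; rewrite -openC; suff : gr_open (~` A) by [].
by move=> phi phiA; rewrite preimage_setC openC; exact: cA.
Qed.

Definition to_complex m n (z : 'M[R]_(m, n) * 'M[R]_(m, n)) : 'M[R[i]]_(m, n) :=
  \matrix_(i, j) (z.1 i j +i* z.2 i j).

Definition to_real m n (X : 'M[R[i]]_(m, n)) : 'M[R]_(m, n) * 'M[R]_(m, n) :=
  (map_mx (@complex.Re R) X, map_mx (@complex.Im R) X).

Lemma to_realK m n : cancel (@to_real m n) (@to_complex m n).
Proof. by move=> X; apply/matrixP => i j; rewrite !mxE; case: (X i j). Qed.

Lemma to_complexK m n : cancel (@to_complex m n) (@to_real m n).
Proof. by move=> [X Y]; congr pair; apply/matrixP => i j; rewrite !mxE. Qed.

Lemma to_complex_continuous m n : continuous (@to_complex m n).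
Proof.
move=> z; apply: cvg_mx_entries => i j; rewrite mxE.
under eq_fun do rewrite mxE.
apply: cvg_complex.
  by apply: (continuous_comp _ (@coord_continuous _ _ _ i j _)); exact: cvg_fst.
by apply: (continuous_comp _ (@coord_continuous _ _ _ i j _)); exact: cvg_snd.
Qed.

Definition gr_real_chart e (kd : (k <= d)%N) (eB : basis_of fullv e)
    (z : 'M[R]_(k, d - k) * 'M[R]_(k, d - k)) : grassmannian k W :=
  gr_chart kd eB (to_complex z).

Lemma gr_real_chart_atlas e (kd : (k <= d)%N) (eB : basis_of fullv e) :
  gr_real_atlas k W (gr_real_chart kd eB).
Proof. by exists (gr_chart kd eB) => //; exact: gr_chart_atlas. Qed.

Lemma gr_real_atlasP phi : gr_real_atlas k W phi -> exists2 e : d.-tuple W,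
  basis_of fullv e & forall z, phi z = graph_space e (to_complex z) :> {vspace W}.
Proof. by move=> [psi [e eB psiE] phiE]; exists e => // z; rewrite phiE psiE. Qed.

Lemma gr_real_atlas_continuous phi : gr_real_atlas k W phi -> continuous phi.
Proof.
move=> [psi psiA phiE]; rewrite (_ : phi = psi \o @to_complex _ _); last first.
  by apply/funext => z; rewrite phiE.
move=> z; apply: continuous_comp; first exact: to_complex_continuous.
exact: gr_atlas_continuous.
Qed.

End Charts.

(** * Lines of a Grassmannian *)

Section BasisChange.
Context (R : realType) (W : vectType R[i]) (k r : nat).
Local Notation d := (\dim {:W}).
Implicit Types (e : d.-tuple W) (a b c f s t : R[i]).

(** The first r of the k spanning vectors move together, each of them in the plane
    of e_i and e_(k + i), and the other ones are fixed. The resulting subspaces,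
    for [s : t] in the projective line, form a rational curve of degree r. *)
Definition line_vec e s t (i : nat) : W :=
  if (i < r)%N then s *: e`_i + t *: e`_(k + i) else e`_i.

Definition line_space e s t : {vspace W} :=
  <<[seq line_vec e s t (val i) | i : 'I_k]>>%VS.

(** The same 2 x 2 matrix acts on all the planes of e_i and e_(k + i). Such a change
    of basis only changes the homogeneous coordinates on the line. *)
Definition mix_vec a b c f e n : W :=
  if (n < r)%N then a *: e`_n + b *: e`_(k + n)
  else if (k <= n < k + r)%N then c *: e`_(n - k) + f *: e`_n else e`_n.

Definition mix a b c f e : d.-tuple W := [tuple mix_vec a b c f e i | i < d].

Lemma nth_mix a b c f e n : (n < d)%N -> (mix a b c f e)`_n = mix_vec a b c f e n.
Proof. by move=> nd; rewrite -[n]/(val (Ordinal nd)) -tnth_nth tnth_mktuple. Qed.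

Hypotheses (rk : (r <= k)%N) (krd : (k + r <= d)%N).

Lemma nth_mix_low a b c f e i : (i < r)%N ->
  (mix a b c f e)`_i = a *: e`_i + b *: e`_(k + i).
Proof.
move=> ir; rewrite nth_mix; last by lia.
by rewrite /mix_vec ir.
Qed.

Lemma nth_mix_high a b c f e i : (i < r)%N ->
  (mix a b c f e)`_(k + i) = c *: e`_i + f *: e`_(k + i).
Proof.
move=> ir; rewrite nth_mix; last by lia.
rewrite /mix_vec ifF; last by lia.
by rewrite leq_addr ltn_add2l ir addKn.
Qed.

Lemma nth_mix_other a b c f e n : (n < d)%N -> (r <= n)%N ->
  ~~ (k <= n < k + r)%N -> (mix a b c f e)`_n = e`_n.
Proof.
by move=> nd rn kn; rewrite nth_mix // /mix_vec ltnNge rn /= (negbTE kn).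
Qed.

Lemma solve2 (X Y : W) a b c f : f *: (a *: X + b *: Y) - b *: (c *: X + f *: Y) =
  (a * f - b * c) *: X.
Proof.
rewrite !scalerDr !scalerA opprD addrACA [f * b]mulrC subrr addr0.
by rewrite -scalerBl [f * a]mulrC.
Qed.

Lemma mix_basis a b c f e : basis_of fullv e -> a * f - b * c != 0 ->
  basis_of fullv (mix a b c f e).
Proof.
move=> eB D0; rewrite basisEdim size_tuple leqnn andbT.
apply: (@subv_trans _ _ <<e>>%VS); first by rewrite (span_basis eB).
apply/span_subvP => _ /(nthP 0)[n + <-].
rewrite size_tuple => nd; set e' := mix a b c f e.
have e'S p : (p < d)%N -> e'`_p \in <<e'>>%VS.
  by move=> pd; apply: memv_span; apply: mem_nth; rewrite size_tuple.
have [nr|rn] := ltnP n r.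
  suff -> : e`_n = (a * f - b * c)^-1 *: (f *: e'`_n - b *: e'`_(k + n)).
    by apply/memvZ/rpredB; apply/memvZ/e'S => //; lia.
  by rewrite nth_mix_low // nth_mix_high // solve2 scalerK.
have [/andP[kn nkr]|kn] := boolP (k <= n < k + r)%N; last first.
  by rewrite -(nth_mix_other a b c f e nd rn kn) e'S.
have nr : (n - k < r)%N by lia.
rewrite -(subnKC kn); set i := (n - k)%N in nr *.
suff -> : e`_(k + i) = (f * a - c * b)^-1 *: (a *: e'`_(k + i) - c *: e'`_i).
  by apply/memvZ/rpredB; apply/memvZ/e'S => //; lia.
rewrite nth_mix_high // nth_mix_low // ![_ *: e`_i + _]addrC solve2 scalerK //.
by rewrite [f * a]mulrC [c * b]mulrC.
Qed.

Lemma line_mix a b c f e s t :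
  line_space (mix a b c f e) s t = line_space e (s * a + t * c) (s * b + t * f).
Proof.
rewrite /line_space; congr (<<_>>%VS); apply: eq_image => // i.
move: (val i) (ltn_ord i : (val i < k)%N) => {}i ik.
rewrite /line_vec; case: ifP => [ir|/negbT].
  rewrite nth_mix_low // nth_mix_high // !scalerDr !scalerA addrACA.
  by rewrite -!scalerDl.
rewrite -leqNgt => ri.
by rewrite nth_mix_other //; lia.
Qed.

(** Exchanging the homogeneous coordinates gives a chart around [0 : 1]. *)
Definition swap e := mix 0 1 1 0 e.

Lemma swap_basis e : basis_of fullv e -> basis_of fullv (swap e).
Proof. by move=> eB; apply: mix_basis; rewrite // mul0r mul1r sub0r oppr_eq0 oner_eq0. Qed.

Lemma line_swap e s t : line_space (swap e) s t = line_space e t s.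
Proof. by rewrite line_mix !mulr0 !mulr1 addr0 add0r. Qed.

Lemma swapK e : swap (swap e) = e.
Proof.
apply: eq_from_tnth => i; rewrite !(tnth_nth 0).
have id_ := ltn_ord i; have [ir|ri] := ltnP i r.
  by rewrite nth_mix_low // nth_mix_low // nth_mix_high // !scale0r !scale1r add0r addr0.
have [/andP[ki ikr]|ki] := boolP (k <= i < k + r)%N; last by rewrite !nth_mix_other.
rewrite -(subnKC ki); have ir : (i - k < r)%N by lia.
by rewrite nth_mix_high // nth_mix_low // nth_mix_high // !scale0r !scale1r add0r addr0.
Qed.

Lemma crd_swap e n w : basis_of fullv e -> (n < d)%N ->
  crd (swap e) n w = if (n < r)%N then crd e (k + n) w
                     else if (k <= n < k + r)%N then crd e (n - k) w else crd e n w.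
Proof.
move=> eB nd.
have main p : (p < d)%N -> (if (n < r)%N then p = k + n
    else if (k <= n < k + r)%N then p = n - k else p = n)%N ->
    crd (swap e) n w = crd e p w.
  move=> pd np; apply: (@eq_on_basis _ _ (swap e)) w => [|q qd].
    exact: swap_basis.
  rewrite /= crd_basis ?swap_basis //.
  have [qr|rq] := ltnP q r.
    rewrite nth_mix_low // scale0r add0r scale1r crd_basis //; congr (nat_of_bool _)%:R.
    by move: np; case: ifP => ?; [|case: ifP => ?] => ->; lia.
  have [/andP[kq qkr]|kq] := boolP (k <= q < k + r)%N.
    have qr : (q - k < r)%N by lia.
    rewrite -(subnKC kq) nth_mix_high // scale0r addr0 scale1r crd_basis //.
    congr (nat_of_bool _)%:R.
    by move: np; case: ifP => ?; [|case: ifP => ?] => ->; lia.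
  rewrite nth_mix_other // crd_basis //; congr (nat_of_bool _)%:R.
  by move: np; case: ifP => ?; [|case: ifP => ?] => ->; lia.
by case: ifP => nr; [|case: ifP => nkr]; apply: main; rewrite ?nr ?nkr //; lia.
Qed.

End BasisChange.

Section Lines.
Context (R : realType) (W : vectType R[i]) (k r : nat).
Local Notation d := (\dim {:W}).
Local Notation M := 'M[R[i]]_(k, d - k).
Local Notation line_space := (@line_space R W k r).
Local Notation line_vec := (@line_vec R W k r).
Local Notation swap := (@swap R W k r).
Hypotheses (r0 : (0 < r)%N) (rk : (r <= k)%N) (krd : (k + r <= d)%N).
Implicit Types (e : d.-tuple W) (a b c f s t : R[i]).

Let kd : (k <= d)%N. Proof. exact: leq_trans (leq_addr _ _) krd. Qed.

Lemma frame_pid e c i : frame e (c *: pid_mx r : M) i = line_vec e 1 c i.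
Proof.
rewrite /frame /line_vec; case: ifP => ir; last first.
  by rewrite big1 ?addr0 // => j _; rewrite !mxE ir andbF mulr0 scale0r.
have id_ : (i < d - k)%N by lia.
rewrite (bigD1 (Ordinal id_)) //= !mxE eqxx ir mulr1 scale1r; congr (_ + _).
rewrite big1 ?addr0 // => j; rewrite -val_eqE /= => /negbTE ji.
by rewrite !mxE eq_sym ji mulr0 scale0r.
Qed.

Lemma line_affine e c : line_space e 1 c = graph_space e (c *: pid_mx r : M).
Proof.
by rewrite /line_space /graph_space; congr (<<_>>%VS);
  apply: eq_image => // i; rewrite -[RHS]/(frame e (c *: pid_mx r : M) i) frame_pid.
Qed.

Lemma line_scale e a s t : a != 0 -> line_space e (a * s) (a * t) = line_space e s t.
Proof.
have sub b x y : (line_space e (b * x) (b * y) <= line_space e x y)%VS.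
  apply/span_subvP => _ /mapP[i _ ->].
  have yi : line_vec e x y i \in line_space e x y.
    by apply: memv_span; apply/mapP; exists i; rewrite ?mem_enum.
  move: yi; rewrite /line_vec; case: ifP => // ir yi.
  by rewrite -!scalerA -scalerDr memvZ.
move=> a0; apply/eqP; rewrite eqEsubv sub /=.
by have := sub a^-1 (a * s) (a * t); rewrite !mulKf.
Qed.

Lemma line_div e s t : s != 0 -> line_space e s t = line_space e 1 (t / s).
Proof.
by move=> s0; rewrite -(line_scale e 1 (t / s) s0) mulr1 [s * _]mulrC divfK.
Qed.

Lemma mem_affine e c w : basis_of fullv e ->
  w \in line_space e 1 c <-> forall j, (j < d - k)%N ->
  crd e (k + j) w = if (j < r)%N then c * crd e j w else 0.
Proof.
move=> eB; rewrite line_affine; split=> [/(mem_graph _ _ kd eB) wc j jd|wc].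
  rewrite -[j]/(val (Ordinal jd)) wc; case: ifP => jr.
    rewrite (bigD1 (Ordinal (leq_trans jr rk))) //= !mxE eqxx jr mulr1 mulrC.
    rewrite big1 ?addr0 // => i; rewrite -val_eqE /= => /negbTE ij.
    by rewrite !mxE ij !mulr0.
  by rewrite big1 // => i _; rewrite !mxE; case: eqP => [->|]; rewrite /= ?jr !mulr0.
apply/(mem_graph _ _ kd eB) => j; rewrite wc //; case: ifP => jr.
  rewrite (bigD1 (Ordinal (leq_trans jr rk))) //= !mxE eqxx jr mulr1 mulrC.
  rewrite big1 ?addr0 // => i; rewrite -val_eqE /= => /negbTE ij.
  by rewrite !mxE ij !mulr0.
by rewrite big1 // => i _; rewrite !mxE; case: eqP => [->|]; rewrite /= ?jr !mulr0.
Qed.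

Lemma mem_line e s t w : basis_of fullv e -> (s != 0) || (t != 0) ->
  w \in line_space e s t <->
  (forall j, (j < r)%N -> s * crd e (k + j) w = t * crd e j w) /\
  (forall j, (r <= j < d - k)%N -> crd e (k + j) w = 0).
Proof.
move=> eB; have [-> /= t0|s0 _] := eqVneq s 0; last first.
  rewrite line_div // mem_affine //; split=> [we|[we wz] j jd].
    split=> j jr; last by rewrite we; [rewrite ifF //|]; lia.
    rewrite we; last by lia.
    by rewrite jr mulrA mulrCA divff ?mulr1 // mulrC.
  case: ifP => jr; last by apply: wz; lia.
  by apply: (mulfI s0); rewrite we // mulrCA !mulrA divfK // [s * t]mulrC -mulrA mulrC -mulrA mulKf.
have sB : basis_of fullv (swap e) by exact: swap_basis.
rewrite -line_swap // line_div // mul0r mem_affine //.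
have E j : (j < d - k)%N -> crd (swap e) (k + j) w =
    if (j < r)%N then crd e j w else crd e (k + j) w.
  move=> jd; rewrite crd_swap //; last by lia.
  rewrite ifF; last by lia.
  by rewrite leq_addr ltn_add2l addKn.
split=> [we|[we wz] j jd]; last first.
  rewrite E //; case: ifP => jr; last by apply: wz; lia.
  by rewrite mul0r; apply: (mulfI t0); rewrite -we // mul0r mulr0.
split=> j jr.
  have jd : (j < d - k)%N by lia.
  by have := we j jd; rewrite E // jr mul0r => ->; rewrite mul0r mulr0.
have jd : (j < d - k)%N by lia.
by have := we j jd; rewrite E // !ifF //; lia.
Qed.

Lemma dim_line e s t : basis_of fullv e -> (s != 0) || (t != 0) ->
  \dim (line_space e s t) = k.
Proof.
move=> eB; have [-> /= t0|s0 _] := eqVneq s 0.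
  have sB : basis_of fullv (swap e) by exact: swap_basis.
  by rewrite -line_swap // line_div // line_affine dim_graph.
by rewrite line_div // line_affine dim_graph.
Qed.

Definition line e : set (grassmannian k W) :=
  [set U | exists s t, (s != 0) || (t != 0) /\ gr_space U = line_space e s t].

Lemma line_mem e s t (U : grassmannian k W) : (s != 0) || (t != 0) ->
  gr_space U = line_space e s t -> line e U.
Proof. by move=> st UE; exists s, t. Qed.

Lemma line_mixE a b c f e : a * f - b * c != 0 -> line (mix k r a b c f e) = line e.
Proof.
move=> D0; apply/seteqP; split=> U [s [t [st UE]]]; last first.
  exists ((s * f - t * c) / (a * f - b * c)), ((t * a - s * b) / (a * f - b * c)).
  rewrite line_mix // UE; split; last first.
    by congr line_space; rewrite mulrAC -[X in _ + X]mulrAC -mulrDl;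
      apply: (mulIf D0); rewrite divfK //; ring.
  rewrite -negb_and; apply: contraL st => /andP[].
  rewrite !mulf_eq0 !invr_eq0 !(negbTE D0) !orbF !subr_eq0 => /eqP sf /eqP ta.
  rewrite -negb_and negbK; apply/andP; split; rewrite -(mulIr_eq0 _ (mulIf D0)).
    have -> : s * (a * f - b * c) = a * (s * f) - c * (s * b) by ring.
    by rewrite sf -ta; apply/eqP; ring.
  have -> : t * (a * f - b * c) = f * (t * a) - b * (t * c) by ring.
  by rewrite ta -sf; apply/eqP; ring.
exists (s * a + t * c), (s * b + t * f); rewrite UE line_mix //; split => //.
rewrite -negb_and; apply: contraL st => /andP[/eqP sa /eqP sb].
rewrite -negb_and negbK; apply/andP; split; rewrite -(mulIr_eq0 _ (mulIf D0)).
  have -> : s * (a * f - b * c) = (s * a + t * c) * f - (s * b + t * f) * c by ring.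
  by rewrite sa sb !mul0r subrr.
have -> : t * (a * f - b * c) = (s * b + t * f) * a - (s * a + t * c) * b by ring.
by rewrite sa sb !mul0r subrr.
Qed.

Lemma line_swapE e : line (swap e) = line e.
Proof. by apply: line_mixE; rewrite mul0r mul1r sub0r oppr_eq0 oner_eq0. Qed.

(** These equations make sense at every point of the Grassmannian: they show that
    the line is closed, and analytic also at the points where it is not affine. *)
Lemma lineP e (U : grassmannian k W) : basis_of fullv e ->
  line e U <-> forall w w', w \in gr_space U -> w' \in gr_space U ->
    (forall j, (r <= j < d - k)%N -> crd e (k + j) w = 0) /\
    (forall i j, (i < r)%N -> (j < r)%N ->
      crd e i w * crd e (k + j) w' = crd e j w' * crd e (k + i) w).
Proof.
move=> eB; split=> [[s [t [st UE]]] w w'|HU].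
  rewrite UE => /(mem_line _ eB st)[wr wz] /(mem_line _ eB st)[w'r _].
  split=> // i j ir jr; case/orP: st => [s0|t0].
    apply: (mulfI s0); rewrite mulrCA w'r // [s * (_ * _)]mulrCA wr //.
    by ring.
  by apply: (mulfI t0); rewrite mulrA -wr // mulrAC w'r //; ring.
have [[w [i [wU ir wi]]]|nw] := pselect (exists w i, [/\ w \in gr_space U,
    (i < r)%N & (crd e i w != 0) || (crd e (k + i) w != 0)]).
  exists (crd e i w), (crd e (k + i) w); split=> //; apply/eqP.
  rewrite eqEdim gr_dim dim_line // leqnn andbT; apply/subvP => w' w'U.
  apply/mem_line => //; split=> j jr; last by have [+ _] := HU w' w w'U wU; apply.
  by have [_ ->] := HU w w' wU w'U; rewrite // mulrC.
exists 1, 0; rewrite oner_eq0; split=> //; apply/eqP.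
rewrite eqEdim gr_dim dim_line ?oner_eq0 // leqnn andbT; apply/subvP => w wU.
apply/mem_line => //; first by rewrite oner_eq0.
split=> j jr; last by have [+ _] := HU w w wU wU; apply.
apply/eqP; rewrite mul1r mul0r; apply/negPn/negP => wj; apply: nw.
by exists w, j; rewrite wj orbT.
Qed.

Lemma line_eq e s t s' t' : basis_of fullv e ->
  (s != 0) || (t != 0) -> (s' != 0) || (t' != 0) ->
  line_space e s t = line_space e s' t' -> s * t' = s' * t.
Proof.
move=> eB st st' E.
have : line_vec e s t 0 \in line_space e s t.
  have k0 : (0 < k)%N by lia.
  by apply: memv_span; apply/mapP; exists (Ordinal k0); rewrite ?mem_enum.
rewrite E => /(mem_line _ eB st')[/(_ 0)+ _] => /(_ r0).
rewrite /line_vec r0 addn0 !linearD !linearZ /= !crd_basis //; [|by lia..].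
rewrite eqxx !mulr1 [k == 0]gtn_eqF ?[0 == k]ltn_eqF /= ?mulr0; [|by lia..].
by rewrite addr0 add0r => ->; rewrite mulrC.
Qed.

End Lines.

(** * Analytic equations of a line *)

Section AnalyticSets.
Context (R : realType) (W : vectType R[i]) (k : nat).
Local Notation d := (\dim {:W}).
Local Notation M := 'M[R[i]]_(k, d - k).
Local Notation Gr := (grassmannian k W).
Hypothesis kd : (k <= d)%N.
Implicit Types (e : d.-tuple W).

Lemma gr_chart_at (p : Gr) : exists e (eB : basis_of fullv e), gr_chart kd eB 0 = p.
Proof.
pose s := (vbasis (gr_space p) : seq W) ++ vbasis (gr_space p)^C%VS.
have ss : size s == d.
  by rewrite size_cat !size_tuple dimv_compl subnKC // dimvS // subvf.
have eB : basis_of fullv (Tuple ss).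
  rewrite basisEdim size_tuple leqnn andbT /= span_cat.
  by rewrite !(span_basis (vbasisP _)) addv_complf.
exists (Tuple ss), eB; apply/gr_eq/eqP => /=; rewrite eq_sym eqEdim dim_graph //.
rewrite gr_dim leqnn andbT -(span_basis (vbasisP (gr_space p))).
have sz : size (vbasis (gr_space p)) = k by rewrite size_tuple; exact: gr_dim.
apply/span_subvP => _ /(nthP 0)[n + <-]; rewrite sz => nk.
have := frame_in_graph (Tuple ss) (0 : M) (Ordinal nk).
rewrite /frame big1 ?addr0; last by move=> j _; rewrite mxE scale0r.
by rewrite /= nth_cat sz nk.
Qed.

(** The equations are required in all the charts, because an analytic subset has to
    be described near the points of its complement too. *)
Definition zero_set (Z : set Gr) := forall e, basis_of fullv e ->
  exists (I : finType) (f : I -> M -> R[i]), (forall i X, differentiable (f i) X) /\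
    forall X (U : Gr), gr_space U = graph_space e X -> Z U <-> forall i, f i X = 0.

Lemma zero_set_closed Z : zero_set Z -> closed Z.
Proof.
move=> zZ; apply: gr_closedP => phi [e eB phiE]; have [I [f [df fZ]]] := zZ e eB.
rewrite (_ : _ @^-1` _ = \bigcap_i (f i @^-1` [set 0])); last first.
  by apply/seteqP; split=> X; [move=> /(fZ _ _ (phiE X)) fX i _|
    move=> fX; apply/(fZ _ _ (phiE X)) => i; apply: fX].
apply: closed_bigI => i _; apply: closed_comp => [X _|].
  exact: differentiable_continuous.
exact/accessible_closed_set1/hausdorff_accessible/norm_hausdorff.
Qed.

Lemma zero_set_analytic Z : zero_set Z -> analytic_subset (gr_atlas k W) Z.
Proof.
move=> zZ p; have [e [eB ep]] := gr_chart_at p; have [I [f [df fZ]]] := zZ e eB.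
exists (gr_chart kd eB), 0, #|I|, (fun X => \row_i f (enum_val i) X).
split=> //; first exact: gr_chart_atlas.
  apply: (@filterE _ _ (nbhs_filter _)) => X.
  rewrite (_ : (fun X => _) = \sum_(i < #|I|) (fun X => f (enum_val i) X *: delta_mx 0 i)).
    by apply: differentiable_sum => i; apply: differentiableZl.
  by apply/funext => Y; rewrite fct_sumE [LHS]row_sum_delta; apply: eq_bigr => i _; rewrite mxE.
apply: (@filterE _ _ (nbhs_filter _)) => X; split=> [/(fZ X (gr_chart kd eB X) erefl) fX|].
  by apply/rowP => i; rewrite !mxE fX.
move=> /rowP fX; apply/(fZ X (gr_chart kd eB X) erefl) => i.
by have := fX (enum_rank i); rewrite !mxE enum_rankK.
Qed.

Lemma zero_setU Z Z' : zero_set Z -> zero_set Z' -> zero_set (Z `|` Z').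
Proof.
move=> zZ zZ' e eB; have [I [f [df fZ]]] := zZ e eB; have [J [g [dg gZ]]] := zZ' e eB.
exists (I * J)%type, (fun p => f p.1 * g p.2); split=> [[i j] X|X U UX].
  exact: differentiableM.
split=> [[/(fZ _ _ UX) fX|/(gZ _ _ UX) gX] [i j]|fg].
- by rewrite fctE fX mul0r.
- by rewrite fctE gX mulr0.
have [fX|nf] := pselect (forall i, f i X = 0); first by left; apply/(fZ _ _ UX).
right; apply/(gZ _ _ UX) => j; apply: contra_notP nf => /eqP gj i.
by have /eqP := fg (i, j); rewrite fctE mulf_eq0 (negbTE gj) orbF => /eqP.
Qed.

Lemma differentiable_crd_frame e e' n l X :
  differentiable (fun X : M => crd e n (frame e' X l)) X.
Proof.
rewrite (_ : (fun X => _) = cst (crd e n e'`_l) +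
    \sum_(j < d - k) (fun X : M => X l j *: crd e n e'`_(k + j))).
  apply: differentiableD => //; apply: differentiable_sum => j.
  apply: differentiableZl; exact: differentiable_coord.
apply/funext => Y; rewrite fctE linearD linear_sum fct_sumE /=; congr (_ + _).
by apply: eq_bigr => j _; rewrite linearZ.
Qed.

Lemma zero_set_line r e : (0 < r)%N -> (r <= k)%N -> (k + r <= d)%N ->
  basis_of fullv e -> zero_set (line r e).
Proof.
move=> r0 rk krd eB e' e'B.
pose x n (l : 'I_k) (X : M) := crd e n (frame e' X l).
pose f (q : ('I_k * 'I_k) * ('I_d * 'I_d) + ('I_k * 'I_d)) : M -> R[i] :=
  match q with
  | inl ((l, l'), (i, j)) => if (i < r)%N && (j < r)%N then
      (fun X => x i l X * x (k + j)%N l' X - x j l' X * x (k + i)%N l X) else cst 0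
  | inr (l, j) => if (r <= j < d - k)%N then x (k + j)%N l else cst 0
  end.
have dx n l X : differentiable (x n l) X by exact: differentiable_crd_frame.
exists _, f; split=> [[[[l l'] [i j]]|[l j]] X|X U UX].
- rewrite /f; case: ifP => _; last exact: differentiable_cst.
  have := differentiableB (differentiableM (dx i l X) (dx (k + j)%N l' X))
    (differentiableM (dx j l' X) (dx (k + i)%N l X)).
  by [].
- by rewrite /f; case: ifP => _; [exact: dx|exact: differentiable_cst].
split=> [/(lineP r0 rk krd _ eB) UL|fX].
  have frU m : frame e' X m \in gr_space U by rewrite UX frame_in_graph.
  case=> [[[l l'] [i j]]|[l j]]; rewrite /f; case: ifP => //.
    by move=> /andP[ir jr]; have [_ E] := UL _ _ (frU l) (frU l'); rewrite /x E // subrr.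
  by move=> jr; have [E _] := UL _ _ (frU l) (frU l); exact: E.
apply/(lineP r0 rk krd _ eB) => w w'; rewrite UX => /graph_span[a ->] /graph_span[b ->].
split=> [j jr|i j ir jr].
  rewrite linear_sum /= big1 // => l _; rewrite linearZ /=.
  have jd : (j < d)%N by lia.
  by have := fX (inr (l, Ordinal jd)); rewrite /f /= jr /x => ->; rewrite mulr0.
have [id_ jd] : (i < d)%N /\ (j < d)%N by lia.
rewrite [RHS]mulrC !linear_sum /= !mulr_suml; apply: eq_bigr => l _.
rewrite !mulr_sumr; apply: eq_bigr => l' _; rewrite !linearZ /=.
have := fX (inl ((l, l'), (Ordinal id_, Ordinal jd))).
rewrite /f /= ir jr /= => /subr0_eq; rewrite /x => E.
by rewrite mulrACA E; ring.
Qed.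

End AnalyticSets.

(** * The affine coordinate of a line *)

Lemma isomorphic_sym (K : numFieldType) (cls : regularity K) (T T' : Type)
    (E E' : normedModType K) (A : set (E -> T)) (A' : set (E' -> T')) X Y :
  isomorphic cls A A' X Y -> isomorphic cls A' A Y X.
Proof. by move=> [g [h [gX hY rg rh]]]; exists h, g. Qed.

Lemma holomorphic_coordZ (R : realType) m n m' n' (i : 'I_m) (j : 'I_n)
    (A : 'M[R[i]]_(m', n')) (X : 'M[R[i]]_(m, n)) :
  holomorphic (fun X : 'M[R[i]]_(m, n) => X i j *: A) X.
Proof.
apply: (@filterE _ _ (nbhs_filter _)) => Y; apply: differentiableZl.
exact: differentiable_coord.
Qed.

Section LineCoordinate.
Context (R : realType) (W : vectType R[i]) (k r : nat).
Local Notation d := (\dim {:W}).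
Local Notation M := 'M[R[i]]_(k, d - k).
Local Notation line_space := (@line_space R W k r).
Local Notation swap := (@swap R W k r).
Hypotheses (r0 : (0 < r)%N) (rk : (r <= k)%N) (krd : (k + r <= d)%N).
Implicit Types (e : d.-tuple W) (s t : R[i]).

Let kd : (k <= d)%N. Proof. exact: leq_trans (leq_addr _ _) krd. Qed.
Let k0 : (0 < k)%N. Proof. exact: leq_trans r0 rk. Qed.
Let m0 : (0 < d - k)%N. Proof. by rewrite subn_gt0 (leq_trans _ krd) // -ltn_subLR ?subnn. Qed.

Definition row0 : 'I_k := Ordinal k0.
Definition col0 : 'I_(d - k) := Ordinal m0.

(** The equations of the line, applied to the vectors of the frame, force the matrix
    to be a multiple of the partial identity; its first entry is the multiple. *)
Lemma line_corner e X (U : grassmannian k W) : basis_of fullv e ->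
  line r e U -> gr_space U = graph_space e X -> X = X row0 col0 *: pid_mx r.
Proof.
move=> eB /(lineP r0 rk krd _ eB) UL UX.
have frU m : frame e X m \in gr_space U by rewrite UX frame_in_graph.
apply/matrixP => i j; have [+ E] := UL _ _ (frU row0) (frU i).
rewrite !mxE; have [jr _|rj E'] := ltnP j r.
  have jk : (j < k)%N by exact: leq_trans jr rk.
  have := E 0 j r0 jr; rewrite crd_frame_low // crd_frame_high // crd_frame_low //.
  rewrite (crd_frame_high X row0 col0 eB : crd e (k + 0) _ = _) mul1r => ->.
  rewrite mulrC.
  by congr (_ * _%:R); case: eqP => //= ->; rewrite jr.
have := UL _ _ (frU i) (frU i) => -[/(_ j) + _]; rewrite rj ltn_ord => /(_ isT).
rewrite crd_frame_high // => ->; case: eqP => [->|]; last by rewrite mulr0.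
by rewrite ltnNge rj mulr0.
Qed.

Lemma line_space_eq e s t s' t' : (s != 0) || (t != 0) -> (s' != 0) || (t' != 0) ->
  s * t' = s' * t -> line_space e s t = line_space e s' t'.
Proof.
have [-> /= t0|s0 _] := eqVneq s 0.
  have [-> /= t'0 _|s'0 _] := eqVneq s' 0.
    have tt0 : t / t' != 0 by rewrite mulf_neq0 ?invr_eq0.
    by rewrite -(line_scale k r e 0 t' tt0) mulr0 divfK.
  by rewrite mul0r => /esym/eqP; rewrite mulf_eq0 (negbTE s'0) (negbTE t0).
have [-> /= t'0|s'0 _] := eqVneq s' 0.
  by rewrite mul0r => /eqP; rewrite mulf_eq0 (negbTE s0) (negbTE t'0).
move=> E; rewrite line_div // [RHS]line_div //; congr line_space.
by apply/eqP; rewrite eqr_div // mulrC -E mulrC.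
Qed.

Lemma line_affine_coord e X s t (U : grassmannian k W) : basis_of fullv e ->
  (s != 0) || (t != 0) -> gr_space U = line_space e s t ->
  gr_space U = graph_space e X -> s != 0 /\ X row0 col0 = t / s.
Proof.
move=> eB st UE UX.
have XE := line_corner eB (line_mem st UE) UX.
have : s * X row0 col0 = 1 * t.
  apply: (line_eq r0 rk krd eB) => //; first by rewrite oner_eq0.
  by rewrite -UE UX line_affine // -XE.
rewrite mul1r => E; have s0 : s != 0.
  by apply: contraTneq st => s0; rewrite -E s0 mul0r eqxx.
by split=> //; apply: (mulfI s0); rewrite E mulrC divfK.
Qed.

Lemma line_point e s t : basis_of fullv e -> (s != 0) || (t != 0) ->
  exists U : grassmannian k W, gr_space U = line_space e s t.
Proof.
move=> eB st; have dU : \dim (line_space e s t) == k by rewrite dim_line.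
by exists (Grassmannian dU).
Qed.

Definition piece e (T : set R[i]) : set (grassmannian k W) :=
  [set U | exists2 c, T c & gr_space U = line_space e 1 c].

Lemma piece_line e T : piece e T `<=` line r e.
Proof. by move=> U [c _ UE]; exists 1, c; rewrite oner_eq0. Qed.

Section Parametrisation.
Context (K : numFieldType) (cls : regularity K) (E F : normedModType K).
Context (A : set (E -> grassmannian k W)) (of_mx : E -> M) (to_mx : M -> E).
Context (Y : set F) (T : set R[i]) (a : R[i] -> F) (b : F -> R[i]).
Context (e : d.-tuple W) (eB : basis_of fullv e).

(** All the diffeomorphisms between a piece of a line and a piece of a
    coordinate space are read in the affine coordinate of the line. *)
Lemma piece_isomorphic : A (gr_chart kd eB \o of_mx) -> cancel to_mx of_mx ->
  (forall c, T c -> Y (a c) /\ b (a c) = c) ->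
  (forall y, Y y -> T (b y) /\ a (b y) = y) ->
  (forall c, T c -> cls (fun z => a (of_mx z row0 col0)) (to_mx (c *: pid_mx r))) ->
  (forall y, Y y -> cls (fun y => to_mx (b y *: pid_mx r)) y) ->
  isomorphic cls A (id_atlas F) (piece e T) Y.
Proof.
move=> chA toK aP bP acls bcls.
have pieceP U : piece e T U -> exists c, T c /\ gr_space U = line_space e 1 c.
  by case=> c; exists c.
pose coord0 (U : grassmannian k W) := xget 0 [set c | T c /\ gr_space U = line_space e 1 c].
have coord0P U : piece e T U -> T (coord0 U) /\ gr_space U = line_space e 1 (coord0 U).
  by move=> /pieceP[c Uc]; rewrite /coord0; case: xgetP => [c' _ //|/(_ c)].
pose pt c := gr_chart kd eB (c *: pid_mx r).
have ptE c : gr_space (pt c) = line_space e 1 c by rewrite line_affine.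
have chK z : gr_space ((gr_chart kd eB \o of_mx) z) = graph_space e (of_mx z) by [].
have nz1 (c : R[i]) : ((1 : R[i]) != 0) || (c != 0) by rewrite oner_eq0.
have coord_inj c c' : line_space e 1 c = line_space e 1 c' -> c = c'.
  by move/(line_eq r0 rk krd eB (nz1 _) (nz1 _)); rewrite !mul1r.
have coord_pt c : T c -> coord0 (pt c) = c.
  move=> Tc; have [|_] := coord0P (pt c); first by exists c.
  by rewrite ptE => /coord_inj.
exists (a \o coord0), (pt \o b); split.
- move=> U /coord0P[Tc UE]; have [? bac] := aP _ Tc; split => //=.
  by apply: gr_eq; rewrite ptE bac.
- move=> y /bP[Tb ab]; split; first by exists (b y) => //; exact: ptE.
  by rewrite /= coord_pt.
- move=> U pU; have [Tc UE] := coord0P U pU.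
  exists (gr_chart kd eB \o of_mx), idfun, (to_mx (coord0 U *: pid_mx r)),
    (fun z => a (of_mx z row0 col0)); split => //.
  + by apply: gr_eq; rewrite chK toK UE line_affine.
  + exact: acls.
  apply: (@filterE _ _ (nbhs_filter _)) => z pz /=; congr a.
  have [Tz zE] := coord0P _ pz.
  by have [_ ->] := line_affine_coord eB (nz1 _) zE (chK z); rewrite divr1.
- move=> y Yy; exists idfun, (gr_chart kd eB \o of_mx), y, (fun y => to_mx (b y *: pid_mx r)).
  split => //; first exact: bcls.
  by apply: (@filterE _ _ (nbhs_filter _)) => z _; rewrite /= toK.
Qed.

End Parametrisation.

Lemma piece_submanifold e T : basis_of fullv e -> open T ->
  isomorphic (@holomorphic R) (gr_atlas k W) (id_atlas 'rV[R[i]]_1)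
    (piece e T) [set y : 'rV[R[i]]_1 | T (y 0 0)].
Proof.
move=> eB oT.
apply: (@piece_isomorphic _ _ _ _ _ id id _ _ (fun c => c *: const_mx 1) (fun y => y 0 0) _ eB) => //.
- exact: gr_chart_atlas.
- by move=> c Tc; rewrite /= !mxE mulr1.
- by move=> y Ty; split => //; apply/rowP => i; rewrite !mxE mulr1 (ord1 i).
- by move=> c _; exact: holomorphic_coordZ.
- by move=> y _; exact: holomorphic_coordZ.
Qed.

End LineCoordinate.

(** * Lines as projective lines *)

Section LineIsomorphism.
Context (R : realType).

(** Two lines are identified by their homogeneous coordinates. *)
Definition corresponding (W W' : vectType R[i]) k k' r r'
    (e : (\dim {:W}).-tuple W) (e' : (\dim {:W'}).-tuple W')
    (U : grassmannian k W) (U' : grassmannian k' W') :=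
  exists s t, [/\ (s != 0) || (t != 0), gr_space U = line_space k r e s t
    & gr_space U' = line_space k' r' e' s t].

Section Regular.
Context (W W' : vectType R[i]) (k k' r r' : nat).
Hypotheses (r0 : (0 < r)%N) (rk : (r <= k)%N) (krd : (k + r <= \dim {:W})%N).
Hypotheses (r0' : (0 < r')%N) (rk' : (r' <= k')%N) (krd' : (k' + r' <= \dim {:W'})%N).
Local Notation corr := (@corresponding W W' k k' r r').

Let kd : (k <= \dim {:W})%N. Proof. exact: leq_trans (leq_addr _ _) krd. Qed.
Let kd' : (k' <= \dim {:W'})%N. Proof. exact: leq_trans (leq_addr _ _) krd'. Qed.

Lemma corresponding_ex (e : (\dim {:W}).-tuple W) (e' : (\dim {:W'}).-tuple W')
    (U : grassmannian k W) : basis_of fullv e' -> line r e U ->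
  exists U', corr e e' U U'.
Proof.
move=> eB' [s [t [st UE]]].
have [U' U'E] := line_point r0' rk' krd' eB' st.
by exists U', s, t.
Qed.

(** In the affine charts of both lines, around [1 : 0] or around [0 : 1], the
    identification is linear. *)
Lemma corresponding_regular (e : (\dim {:W}).-tuple W)
    (e' : (\dim {:W'}).-tuple W') (g : grassmannian k W -> grassmannian k' W') :
  basis_of fullv e -> basis_of fullv e' ->
  (forall U, line r e U -> corr e e' U (g U)) ->
  regular_on (@holomorphic R) (gr_atlas k W) (gr_atlas k' W') (line r e) g.
Proof.
suff main (f : (\dim {:W}).-tuple W) (f' : (\dim {:W'}).-tuple W') p s t :
    basis_of fullv f -> basis_of fullv f' ->
    (forall U, line r f U -> corr f f' U (g U)) ->
    s != 0 -> gr_space p = line_space k r f s t ->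
    exists phi psi x h, [/\ gr_atlas k W phi, gr_atlas k' W' psi, phi x = p,
      holomorphic h x & \forall z \near x, line r f (phi z) -> g (phi z) = psi (h z)].
  move=> eB eB' gP p [s [t [st pE]]]; have [s0|] := eqVneq s 0; last first.
    by move=> s0; exact: (main e e' p s t).
  have t0 : t != 0 by move: st; rewrite s0 eqxx.
  rewrite -(line_swapE rk krd); apply: (main (swap k r e) (swap k' r' e') p t s) => //.
  + exact: swap_basis.
  + exact: swap_basis.
  + move=> U; rewrite line_swapE // => /gP[x [y [xy UE gE]]].
    by exists y, x; rewrite orbC !line_swap.
  + by rewrite line_swap.
move=> eB eB' gP s0 pE.
exists (gr_chart kd eB), (gr_chart kd' eB'), (t / s *: pid_mx r),
  (fun X : 'M[R[i]]_(k, \dim {:W} - k) => X (row0 r0 rk) (col0 r0 krd) *: pid_mx r'); split.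
- exact: gr_chart_atlas.
- exact: gr_chart_atlas.
- by apply: gr_eq; rewrite /= -line_affine // -line_div.
- exact: holomorphic_coordZ.
apply: (@filterE _ _ (nbhs_filter _)) => X XL; apply: gr_eq.
have [x [y [xy XE ->]]] := gP _ XL.
have [x0 ->] := line_affine_coord r0 rk krd eB xy XE erefl.
by rewrite /= -line_affine // -line_div.
Qed.

End Regular.

Lemma line_isomorphic (W W' : vectType R[i]) (k k' r r' : nat)
    (e : (\dim {:W}).-tuple W) (e' : (\dim {:W'}).-tuple W') :
  (0 < r)%N -> (r <= k)%N -> (k + r <= \dim {:W})%N ->
  (0 < r')%N -> (r' <= k')%N -> (k' + r' <= \dim {:W'})%N ->
  basis_of fullv e -> basis_of fullv e' ->
  isomorphic (@holomorphic R) (gr_atlas k W) (gr_atlas k' W')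
    (line r e : set (grassmannian k W)) (line r' e' : set (grassmannian k' W')).
Proof.
move=> r0 rk krd r0' rk' krd' eB eB'.
pose kd := leq_trans (leq_addr _ _) krd; pose kd' := leq_trans (leq_addr _ _) krd'.
pose g (U : grassmannian k W) : grassmannian k' W' :=
  xget (gr_chart kd' eB' 0) [set U' | corresponding r r' e e' U U'].
pose h (U : grassmannian k' W') : grassmannian k W :=
  xget (gr_chart kd eB 0) [set U' | corresponding r' r e' e U U'].
have gP U : line r e U -> corresponding r r' e e' U (g U).
  move=> /(corresponding_ex r0' rk' krd'  eB')[U' UU'].
  by rewrite /g; case: xgetP => [? _ //|/(_ U')].
have hP U : line r' e' U -> corresponding r' r e' e U (h U).
  move=> /(corresponding_ex r0 rk krd  eB)[U' UU'].
  by rewrite /h; case: xgetP => [? _ //|/(_ U')].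
exists g, h; split.
- move=> p /gP[s [t [st pE gE]]]; have gL : line r' e' (g p) by exists s, t.
  split=> //; have [s' [t' [st' gE' hE]]] := hP _ gL.
  apply: gr_eq; rewrite hE pE; apply: line_space_eq => //.
  by apply: (line_eq r0' rk' krd' eB') => //; rewrite -gE -gE'.
- move=> p /hP[s [t [st pE gE]]]; have gL : line r e (h p) by exists s, t.
  split=> //; have [s' [t' [st' gE' hE]]] := gP _ gL.
  apply: gr_eq; rewrite hE pE; apply: line_space_eq => //.
  by apply: (line_eq r0 rk krd eB) => //; rewrite -gE -gE'.
- exact: (corresponding_regular r0 rk krd r0' rk' krd' eB eB' gP).
- exact: (corresponding_regular r0' rk' krd' r0 rk krd eB' eB hP).
Qed.

(** The projective line itself is a line of the Grassmannian of the lines of a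
    plane, with k = r = 1. *)
Lemma line_is_P1 (W : vectType R[i]) (k r : nat) (e : (\dim {:W}).-tuple W) :
  (0 < r)%N -> (r <= k)%N -> (k + r <= \dim {:W})%N -> basis_of fullv e ->
  is_P1 (line r e : set (grassmannian k W)).
Proof.
move=> r0 rk krd eB; pose W2 : vectType R[i] := 'rV[R[i]]_2.
have d2E : \dim {:W2} = 2 by rewrite dimvf.
have d2 : (1 + 1 <= \dim {:W2})%N by rewrite d2E.
have e2B := vbasisP ({: W2})%VS.
rewrite /is_P1 (_ : setT = line 1 (vbasis {:W2}%VS)).
  exact: line_isomorphic.
apply/seteqP; split=> // U _; apply/lineP => //.
have [f [fB <-]] := gr_chart_at (ltnW d2) U.
move=> w w' /graph_span[a ->] /graph_span[b ->]; rewrite !big_ord1.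
split=> [j|[|i] [|j] // _ _]; first by move: d2E; lia.
by rewrite !linearZ /=; ring.
Qed.

End LineIsomorphism.

(** * Real vectors and complex structures *)

Section RealLocus.
Context (R : realType) (V : vectType R).
Local Notation VC := (complexification V).
Import VectorInternalTheory.

Lemma fst_sum (I : Type) (s : seq I) (P : pred I) (F : I -> VC) :
  (\sum_(i <- s | P i) F i).1 = \sum_(i <- s | P i) (F i).1.
Proof. by elim/big_rec2: _ => //= i y x _ <-. Qed.

Lemma snd_sum (I : Type) (s : seq I) (P : pred I) (F : I -> VC) :
  (\sum_(i <- s | P i) F i).2 = \sum_(i <- s | P i) (F i).2.
Proof. by elim/big_rec2: _ => //= i y x _ <-. Qed.

Lemma snd_realZ (c : R) (w : VC) : (c%:C *: w).2 = c *: w.2.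
Proof. by rewrite /= scale0r addr0. Qed.

Lemma real_vecE (w : VC) : w.2 = 0 -> w = real_vec w.1.
Proof. by case: w => u v /= ->. Qed.

Lemma real_vecZ (c : R) (v : V) : real_vec (c *: v) = c%:C *: real_vec v.
Proof. by congr pair; rewrite /= ?scaler0 ?scale0r ?subr0 ?addr0. Qed.

Lemma real_vec_eq0 (v : V) : (real_vec v == 0) = (v == 0).
Proof. by apply/eqP/eqP => [[->]|->]. Qed.

Lemma period_no_real (J : compl_structure V) v : real_vec v \in period_space J -> v = 0.
Proof.
move=> /(mem_period_space J)[u /(congr1 (fun w => (w.1, w.2)))/=].
rewrite !(scaler0, scale0r, scale1r, subr0, addr0, sub0r, add0r) => -[-> /eqP].
rewrite eq_sym oppr_eq0 => /eqP Ju.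
have Ku := cs_opK J u; rewrite Ju linear0 in Ku.
by apply/eqP; rewrite opprK addr0 -oppr_eq0 -Ku.
Qed.

(** The projection to V, restricted to U, is injective, since the kernel consists of
    the vectors i v with v real; it is bijective by dimension, and J is the
    multiplication by i carried over to V. *)
Lemma no_real_period (U : {vspace VC}) : (\dim U * 2 = \dim {:V})%N ->
  (forall v, real_vec v \in U -> v = 0) ->
  exists J : compl_structure V, period_space J = U.
Proof.
move=> dU rU; pose k := \dim U; pose u (j : 'I_k) : VC := (vbasis U)`_j.
have uU j : u j \in U by apply: vbasis_mem; rewrite mem_nth // size_tuple.
have U1 w : w \in U -> w.1 = 0 -> w = 0.
  move=> wU w1; have wi : real_vec (- w.2) = 'i *: w.
    by congr pair; rewrite /= w1 !(scaler0, scale0r, scale1r, sub0r, addr0).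
  have /rU/eqP : real_vec (- w.2) \in U by rewrite wi memvZ.
  by rewrite oppr_eq0 => /eqP w2; case: w w1 w2 {wU wi} => x y /= -> ->.
pose F (i : 'I_(k + k)) : V :=
  match fintype.split i with inl j => (u j).1 | inr j => - (u j).2 end.
have sumF (c : 'I_(k + k) -> R) : \sum_i c i *: F i =
    (\sum_(j < k) (c (lshift k j) +i* c (rshift k j)) *: u j).1.
  rewrite big_split_ord fst_sum [RHS](eq_bigr (fun j =>
    c (lshift k j) *: F (lshift k j) + c (rshift k j) *: F (rshift k j))) ?big_split //.
  move=> j _; by rewrite /F (unsplitK (inl j)) (unsplitK (inr j)) scalerN.
have sumU (c : 'I_k -> R[i]) : \sum_j c j *: u j \in U.
  by apply: memv_suml => j _; rewrite memvZ.
have fr : free [tuple F i | i < k + k].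
  apply/freeP => c c0 i.
  have {}c0 : \sum_i c i *: F i = 0.
    by rewrite -[RHS]c0; apply: eq_bigr => j _; rewrite -tnth_nth tnth_mktuple.
  rewrite sumF in c0; have /U1/(_ c0) u0 := sumU (fun j => c (lshift k j) +i* c (rshift k j)).
  have /freeP/(_ _ u0) cc := basis_free (vbasisP U).
  by rewrite -(splitK i); case: (fintype.split i) => j; case: (cc j).
have sp v : exists2 w, w \in U & w.1 = v.
  have bF : basis_of {: V}%VS [tuple F i | i < k + k].
    by rewrite basisEfree fr subvf size_tuple -dU /k; lia.
  exists (\sum_(j < k) (coord [tuple F i | i < k + k] (lshift k j) v +i*
     coord [tuple F i | i < k + k] (rshift k j) v) *: u j); first exact: sumU.
  rewrite -(sumF (fun i => coord [tuple F i | i < k + k] i v)).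
  rewrite [RHS](coord_basis bF (memvf v)).
  by apply: eq_bigr => i _; rewrite -tnth_nth tnth_mktuple.
pose f v := sval (cid2 (sp v)).
have fU v : f v \in U by rewrite /f; case: cid2.
have f1 v : (f v).1 = v by rewrite /f; case: cid2.
have Ueq w w' : w \in U -> w' \in U -> w.1 = w'.1 -> w = w'.
  move=> wU w'U w1; apply/eqP; rewrite -subr_eq0; apply/eqP/U1; first exact: rpredB.
  by rewrite /= w1 subrr.
pose g v := - (f v).2.
have gl : linear g.
  move=> a x y; have fE : f (a *: x + y) = a%:C *: f x + f y.
    apply: Ueq => //; first by rewrite rpredD // memvZ.
    by rewrite f1 /= scale0r subr0 !f1.
  by rewrite /g fE /= scale0r addr0 opprD scalerN.
pose gL := GRing.isLinear.Build _ _ _ _ g gl.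
pose g' : {linear V -> V} := HB.pack g gL.
have gE v : linfun g' v = g v by rewrite lfunE.
have g2 : (linfun g' \o linfun g')%VF = - \1%VF.
  apply/lfunP => v; rewrite comp_lfunE opp_lfunE id_lfunE !gE /g.
  have -> : f (- (f v).2) = 'i *: f v.
    apply: Ueq => //; first by rewrite memvZ.
    by rewrite f1 /= !(scale0r, scale1r, sub0r).
  by rewrite /= scale0r scale1r add0r f1.
exists (ComplStructure g2); apply/eqP; rewrite eqEdim; apply/andP; split.
  apply/subvP => w /(mem_period_space (ComplStructure g2))[v ->].
  rewrite (_ : _ - _ = f v) //; rewrite [f v]surjective_pairing f1.
  congr pair; rewrite /= gE /g.
    by rewrite !scale0r scaler0 !subr0.
  by rewrite !(scaler0, scale1r, sub0r, add0r) opprK.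
by rewrite -(leq_pmul2r (isT : 0 < 2)%N) dU dim_period_space.
Qed.

Lemma real_locusP n (dimV : \dim {:V} = (4 * n)%N) (U : grassmannian (2 * n) VC) :
  real_locus dimV U <-> exists2 v, v != 0 & real_vec v \in gr_space U.
Proof.
split=> [UL|[v v0 vU] [J _ UJ]]; last first.
  by move: v0; rewrite (@period_no_real J v) ?eqxx // -[period_space J]/(gr_space (period dimV J)) UJ.
apply: contrapT => nv; apply: UL.
have [|v vU|J JU] := @no_real_period (gr_space U).
- by rewrite gr_dim dimV; lia.
- by apply/eqP/negPn/negP => v0; apply: nv; exists v.
by exists J => //; exact: gr_eq.
Qed.

End RealLocus.

(** * Velocities of curves in a Grassmannian *)

Lemma cvg_sum_ord (K : numFieldType) (V : normedModType K) (T : Type)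
    (F : set_system T) (FF : Filter F) n (f : 'I_n -> T -> V) (a : 'I_n -> V) :
  (forall i, f i @ F --> a i) -> (fun t => \sum_i f i t) @ F --> \sum_i a i.
Proof.
move=> fa; elim: n f a fa => [|n IH] f a fa.
  by rewrite big_ord0; under eq_fun do rewrite big_ord0; exact: cvg_cst.
rewrite big_ord_recl; under eq_fun do rewrite big_ord_recl.
by apply: cvgD; [exact: fa|apply: IH => i; exact: fa].
Qed.

Lemma ultra_fmap (T U : Type) (f : T -> U) (F : set_system T) :
  UltraFilter F -> UltraFilter (f @ F).
Proof.
move=> FU; split; first exact: fmap_proper_filter.
move=> G GP FG; apply/seteqP; split=> // A GA.
case: (in_ultra_setVsetC (f @^-1` A) FU) => // FA.
have GnA : G (~` A) by exact: FG.
exfalso; have : G (A `&` ~` A) by exact: filterI.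
by rewrite setICr; exact: filter_not_empty.
Qed.

Lemma cvg_eq (K : numFieldType) (V : normedModType K) (T : Type) (F : set_system T)
    (FF : ProperFilter F) (f g : T -> V) (a b : V) :
  f @ F --> a -> g @ F --> b -> F [set t | f t = g t] -> a = b.
Proof.
move=> fa gb fg; apply: (@cvg_unique V (@norm_hausdorff K V) (g @ F)) => //.
by apply: cvg_trans fa; exact: near_eq_cvg.
Qed.

Section Velocities.
Context (R : realType) (W : vectType R[i]) (k : nat).
Local Notation d := (\dim {:W}).
Local Notation M := 'M[R[i]]_(k, d - k).
Local Notation Er := ('M[R]_(k, d - k) * 'M[R]_(k, d - k))%type.
Hypothesis kd : (k <= d)%N.
Implicit Types (e : d.-tuple W) (X H : M).

Definition velocity e H (i : 'I_k) : W := \sum_j H i j *: e`_(k + j).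

Lemma frameE e X i : frame e X i = e`_i + velocity e X i.
Proof. by []. Qed.

Lemma frame_add e X H (c : R[i]) i :
  frame e (X + c *: H) i = frame e X i + c *: velocity e H i.
Proof.
rewrite !frameE -addrA; congr (_ + _); rewrite /velocity scaler_sumr -big_split /=.
by apply: eq_bigr => j _; rewrite !mxE scalerDl scalerA.
Qed.

Lemma to_complexD m n (x y : 'M[R]_(m, n) * 'M[R]_(m, n)) :
  to_complex (x + y) = to_complex x + to_complex y.
Proof. by apply/matrixP => i j; rewrite !mxE /=; simpc. Qed.

Lemma to_complexZ m n (a : R) (x : 'M[R]_(m, n) * 'M[R]_(m, n)) :
  to_complex (a *: x) = a%:C *: to_complex x.
Proof. by apply/matrixP => i j; rewrite !mxE /=; simpc. Qed.

Lemma cvg_velocity (T : Type) (F : set_system T) (FF : Filter F) e (phi : {scalar W})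
    (A : T -> 'I_k -> R[i]) (a : 'I_k -> R[i]) (Z : T -> Er) (z : Er) :
  (forall i, (fun t => A t i) @ F --> a i) -> Z @ F --> z ->
  (fun t => phi (\sum_i A t i *: velocity e (to_complex (Z t)) i)) @ F -->
    phi (\sum_i a i *: velocity e (to_complex z) i).
Proof.
move=> Aa Zz; rewrite linear_sum; under eq_fun do rewrite linear_sum.
apply: cvg_sum_ord => i; rewrite linearZ; under eq_fun do rewrite linearZ.
apply: cvgM; first exact: Aa.
rewrite linear_sum; under eq_fun do rewrite linear_sum.
apply: cvg_sum_ord => j; rewrite linearZ; under eq_fun do rewrite linearZ.
apply: cvgM; last exact: cvg_cst.
have : to_complex (Z t) @[t --> F] --> to_complex z.
  by apply: cvg_comp Zz _; exact: to_complex_continuous.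
by move=> Zc B /(@coord_continuous _ _ _ i j) nB; exact: Zc nB.
Qed.

Lemma cvg_frame (T : Type) (F : set_system T) (FF : Filter F) e (phi : {scalar W})
    (A : T -> 'I_k -> R[i]) (a : 'I_k -> R[i]) (Z : T -> Er) (z : Er) :
  (forall i, (fun t => A t i) @ F --> a i) -> Z @ F --> z ->
  (fun t => phi (\sum_i A t i *: frame e (to_complex (Z t)) i)) @ F -->
    phi (\sum_i a i *: frame e (to_complex z) i).
Proof.
move=> Aa Zz.
have E b x : phi (\sum_i b i *: frame e (to_complex x) i) =
    \sum_i b i * phi e`_i + phi (\sum_i b i *: velocity e (to_complex x) i).
  rewrite !linear_sum -big_split /=; apply: eq_bigr => i _.
  by rewrite !linearZ /= linearD mulrDr.
rewrite E; under eq_fun do rewrite E.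
apply: cvgD; last exact: cvg_velocity.
by apply: cvg_sum_ord => i; apply: cvgM; [exact: Aa|exact: cvg_cst].
Qed.

Lemma cvg_difference_quotient (F : set_system R) (FF : Filter F) (g : R -> Er) (h : Er) :
  0^' `<=` F -> (fun t => t^-1 *: (g t - g 0)) @ F --> h -> g @ F --> g 0.
Proof.
move=> F0 gh.
have t0 : (fun t : R => t) @ F --> (0 : R).
  by move=> A nA; apply: F0; exact: nbhs_dnbhs.
have : (fun t : R => t *: (t^-1 *: (g t - g 0)) + g 0) @ F --> 0 *: h + g 0.
  by apply: cvgD; [exact: cvgZ|exact: cvg_cst].
rewrite scale0r add0r; apply: cvg_trans; apply: near_eq_cvg.
have : F [set t : R | t != 0] by apply: F0; apply: (@filterE _ _ (nbhs_filter (0 : R))).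
by apply: filterS => t /= tn0; rewrite scalerA divff // scale1r subrK.
Qed.

(** A differentiable curve on the line, seen as a moving subspace, has for
    velocity at the point with affine coordinate 0 a multiple of the map
    e_j |-> e_(k + j) for j < r, e_j |-> 0 for j >= r, modulo that point: take
    the limit of the quadratic equations of the line, divided by t. *)
Lemma line_velocity e e' r (phi : Er -> grassmannian k W) (F : set_system R)
    (FF : ProperFilter F) (g : R -> Er) (h : Er) :
  (0 < r)%N -> (r <= k)%N -> (k + r <= d)%N -> basis_of fullv e -> basis_of fullv e' ->
  (forall z, gr_space (phi z) = graph_space e (to_complex z)) ->
  0^' `<=` F -> (fun t => t^-1 *: (g t - g 0)) @ F --> h ->
  gr_space (phi (g 0)) = line_space k r e' 1 0 ->
  F [set t | line r e' (phi (g t))] ->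
  exists c : R[i], forall (a : 'I_k -> R[i]) j, (j < d - k)%N ->
    crd e' (k + j) (\sum_i a i *: velocity e (to_complex h) i) =
    if (j < r)%N then c * crd e' j (\sum_i a i *: frame e (to_complex (g 0)) i) else 0.
Proof.
move=> r0 rk krd eB e'B phiE F0 gh pE Fline.
pose H t := t^-1 *: (g t - g 0).
pose w a t := \sum_i a i *: frame e (to_complex (g t)) i.
pose z a x := \sum_i a i *: velocity e (to_complex x) i.
have Fne0 : F [set t : R | t != 0].
  by apply: F0; apply: (@filterE _ _ (nbhs_filter (0 : R))).
have wE a t : t != 0 -> w a t = w a 0 + t%:C *: z a (H t).
  move=> t0; have gE : g t = g 0 + t *: H t.
    by rewrite scalerA divff // scale1r addrC subrK.
  rewrite /w /z gE scaler_sumr -big_split /=; apply: eq_bigr => i _.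
  by rewrite to_complexD to_complexZ frame_add scalerDr !scalerA [a i * _]mulrC.
have w0 a : w a 0 \in line_space k r e' 1 0.
  by rewrite -pE phiE; apply/graph_span; exists a.
have w0y a j : (j < d - k)%N -> crd e' (k + j) (w a 0) = 0.
  by move=> jd; have /(mem_affine r0 rk krd) -> // := w0 a; rewrite mul0r if_same.
have wU a t : w a t \in gr_space (phi (g t)).
  by rewrite phiE; apply/graph_span; exists a.
have [a0 a0E] : exists a0, w a0 0 = e'`_0.
  have : e'`_0 \in graph_space e (to_complex (g 0)).
    rewrite -phiE pE; apply/(mem_affine r0 rk krd) => // j jd.
    rewrite mul0r if_same crd_basis //; last by lia.
    by rewrite ltn_eqF // addn_gt0 (leq_trans r0 rk).
  by move/graph_span => [a0 a0E]; exists a0; rewrite a0E.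
have gc : g @ F --> g 0 by exact: cvg_difference_quotient gh.
have wc a n : (fun t => crd e' n (w a t)) @ F --> crd e' n (w a 0).
  by apply: cvg_frame => // i; exact: cvg_cst.
have zc a n : (fun t => crd e' n (z a (H t))) @ F --> crd e' n (z a h).
  by apply: cvg_velocity => // i; exact: cvg_cst.
have tC t : t != 0 -> t%:C != 0 :> R[i] by rewrite (inj_eq (@complexI R)).
exists (crd e' (k + 0) (z a0 h)) => a j jd; case: ifP => jr.
  have <- : crd e' 0 (w a0 0) * crd e' (k + j) (z a h) = crd e' (k + j) (z a h).
    rewrite a0E crd_basis // ?mul1r //; lia.
  apply: (@cvg_eq _ _ _ F FF (fun t => crd e' 0 (w a0 t) * crd e' (k + j) (z a (H t)))
    (fun t => crd e' (k + 0) (z a0 (H t)) * crd e' j (w a t)) _ _ _ _ _).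
  - by apply: cvgM; [exact: wc|exact: zc].
  - by apply: cvgM; [exact: zc|exact: wc].
  apply: filterS2 Fline Fne0 => t /(lineP r0 rk krd _ e'B)/(_ _ _ (wU a0 t) (wU a t))[_ E] t0.
  have m0 : (0 < d - k)%N by lia.
  apply: (mulfI (tC t t0)); have := E 0 j r0 jr.
  rewrite [in X in _ * X = _ -> _](wE a t t0) [in X in _ = _ * X -> _](wE a0 t t0).
  rewrite !linearD !linearZ /= !w0y // !add0r => E'.
  by rewrite mulrCA E'; ring.
apply: (cvg_eq _ (zc a (k + j)%N) (cvg_cst 0)).
apply: filterS2 Fline Fne0 => t /(lineP r0 rk krd _ e'B)/(_ _ _ (wU a t) (wU a t))[E _] t0.
apply: (mulfI (tC t t0)); have := E j; rewrite wE // linearD linearZ /= w0y // add0r mulr0.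
by move=> -> //; lia.
Qed.

(** The low coordinates of the frame are constant, so that a velocity which lies in
    the point itself vanishes. *)
Lemma velocity_inj e e' r (x h h' : Er) : (0 < r)%N -> (r <= k)%N -> (k + r <= d)%N ->
  basis_of fullv e -> basis_of fullv e' ->
  graph_space e (to_complex x) = line_space k r e' 1 0 ->
  (forall (a : 'I_k -> R[i]) j, (j < d - k)%N ->
    crd e' (k + j) (\sum_i a i *: velocity e (to_complex h) i) =
    crd e' (k + j) (\sum_i a i *: velocity e (to_complex h') i)) -> h = h'.
Proof.
move=> r0 rk krd eB e'B xE hh'; rewrite -[h]to_complexK -[h']to_complexK; congr to_real.
apply/matrixP => i j.
have sum1 H : \sum_l (l == i)%:R *: velocity e H l = velocity e H i.
  rewrite (bigD1 i) //= eqxx scale1r big1 ?addr0 // => l /negbTE ->.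
  by rewrite scale0r.
have hi : velocity e (to_complex h) i - velocity e (to_complex h') i
    \in graph_space e (to_complex x).
  rewrite xE; apply/(mem_affine r0 rk krd) => // l ld.
  by have := hh' (fun l => (l == i)%:R) l ld; rewrite !sum1 mul0r if_same linearB => /= ->; rewrite subrr.
have crdv H (l : 'I_(d - k)) : crd e (k + l) (velocity e H i) = H i l.
  have ld : (k + l < d)%N by rewrite -ltn_subRL.
  have := crd_frame_high H i l eB; rewrite frameE linearD /= crd_basis //.
  by rewrite ltn_eqF ?add0r // ltn_addr.
have crdl H (l : 'I_k) : crd e l (velocity e H i) = 0.
  rewrite linear_sum big1 // => m _; rewrite linearZ /= crd_basis //; last first.
    exact: leq_trans (ltn_ord l) kd.
  by rewrite gtn_eqF ?mulr0 // ltn_addr.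
have /(mem_graph _ _ kd eB)/(_ j) := hi; rewrite linearB /= !crdv => /eqP.
rewrite big1 => [|l _]; first by rewrite subr_eq0 => /eqP.
by rewrite linearB /= !crdl subrr mul0r.
Qed.

End Velocities.

(** * The tangent cone of a locus of real vectors *)

Lemma entry_le_norm (K : numDomainType) m n (A : 'M[K]_(m, n)) i j : `|A i j| <= `|A|.
Proof.
rewrite -[`|A|]/(mx_norm A) mx_normE -[leLHS]nngE num_le.
exact: (le_bigmax _ (fun p : 'I_m * 'I_n => `|A p.1 p.2|%:nng) (i, j)).
Qed.

Section TangentCone.
Context (R : realType) (V : vectType R) (k : nat).
Local Notation VC := (complexification V).
Local Notation d := (\dim {:VC}).
Local Notation Er := ('M[R]_(k, d - k) * 'M[R]_(k, d - k))%type.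
Hypothesis kd : (k <= d)%N.
Import VectorInternalTheory.

(** The complex-linear extension of a system of coordinates of V: a vector is real
    iff the imaginary parts of all its coordinates vanish. *)
Definition vcoord (q : 'I_(dim V)) (w : VC) : R[i] := v2r w.1 0 q +i* v2r w.2 0 q.

Fact vcoord_is_linear q : scalar (vcoord q).
Proof.
move=> [a b] [u v] [u' v']; rewrite /vcoord /=.
have vD (w1 w2 : V) : v2r (w1 + w2) = v2r w1 + v2r w2 by rewrite linearD.
have vN (w : V) : v2r (- w) = - v2r w by rewrite linearN.
have vZ c (w : V) : v2r (c *: w) = c *: v2r w by rewrite linearZ.
by rewrite !(vD, vN, vZ) !mxE; simpc.
Qed.

HB.instance Definition _ q :=
  GRing.isLinear.Build R[i] VC R[i] *%R (vcoord q) (vcoord_is_linear q).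

Lemma snd_eq0 (w : VC) : (forall q, complex.Im (vcoord q w) = 0) -> w.2 = 0.
Proof.
by move=> wq; apply: v2r_inj; apply/rowP => q; rewrite linear0 mxE; exact: wq.
Qed.

Lemma vcoord_snd0 (w : VC) q : w.2 = 0 -> complex.Im (vcoord q w) = 0.
Proof. by move=> w2; rewrite /vcoord /= w2 linear0 mxE. Qed.

Lemma unit_box_compact n : compact [set v : 'rV[R[i]]_n | forall i,
  [set z : R[i] | `|complex.Re z| <= 1 /\ `|complex.Im z| <= 1] (v ord0 i)].
Proof.
apply: (@rV_compact _ n (fun=> [set z : R[i] | `|complex.Re z| <= 1 /\ `|complex.Im z| <= 1])) => i.
rewrite (_ : [set z | _] = (fun p : R * R => p.1 +i* p.2) @`
    (`[-1, 1]%classic `*` `[-1, 1]%classic)).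
  apply: continuous_compact; last by apply: compact_setX; exact: segment_compact.
  apply: continuous_subspaceT => p; apply: cvg_complex; [exact: cvg_fst|exact: cvg_snd].
apply/seteqP; split=> [[a b] /= [a1 b1]|_ [[a b] /= [a1 b1] <-]].
  by exists (a, b) => //=; split; rewrite /= in_itv /= -ler_norml.
by move: a1 b1; rewrite /= !in_itv /= -!ler_norml.
Qed.

(** The moving subspace contains a real vector of norm 1 in the coordinates of
    the frame; along an ultrafilter it converges, and differentiating shows that
    the velocity of the limit vector lies in the sum of p and of the real
    vectors. *)
Lemma tangent_cone_real (e : d.-tuple VC) (phi : Er -> grassmannian k VC) (L : set (grassmannian k VC))
    (x h : Er) : basis_of fullv e ->
  (forall z, gr_space (phi z) = graph_space e (to_complex z)) ->
  (forall U, L U -> exists2 v, v != 0 & real_vec v \in gr_space U) ->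
  tangent_cone phi L x h ->
  exists a : 'I_k -> R[i], [/\ \sum_i a i *: frame e (to_complex x) i != 0,
    (\sum_i a i *: frame e (to_complex x) i).2 = 0
    & exists2 q, q \in gr_space (phi x)
      & (\sum_i a i *: velocity e (to_complex h) i).2 = q.2].
Proof.
move=> eB phiE Lreal [g [eps [eps0 gx gL _ gh]]].
pose fr (A : 'rV[R[i]]_k) z := \sum_i A 0 i *: frame e (to_complex z) i.
pose ve (A : 'rV[R[i]]_k) z := \sum_i A 0 i *: velocity e (to_complex z) i.
have frZ c A z : fr (c *: A) z = c *: fr A z.
  by rewrite /fr scaler_sumr; apply: eq_bigr => i _; rewrite mxE scalerA.
have ex_A t : exists A : 'rV[R[i]]_k, 0 < t < eps -> `|A| = 1 /\ (fr A (g t)).2 = 0.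
  have [/andP[t0 te]|] := boolP (0 < t < eps); last by exists 0.
  have [|v v0] := Lreal (phi (g t)); first by apply: gL; rewrite ltW.
  rewrite phiE => /graph_span[a aE].
  pose B : 'rV[R[i]]_k := \row_i a i.
  have BE : fr B (g t) = real_vec v.
    by rewrite aE; apply: eq_bigr => i _; rewrite mxE.
  have B0 : B != 0.
    apply: contraNneq v0 => B0; rewrite -real_vec_eq0 -BE B0 /fr big1 // => i _.
    by rewrite mxE scale0r.
  have nB : 0 < `|B| by rewrite normr_gt0.
  exists (`|B|^-1 *: B) => _; split.
    by rewrite normrZ normfV normr_id mulVf // gt_eqF.
  have [bE b0] := gt0c_real nB.
  rewrite frZ BE bE -fmorphV snd_realZ /=; exact: scaler0.
pose A t := sval (cid (ex_A t)).
have AP t : 0 < t < eps -> `|A t| = 1 /\ (fr (A t) (g t)).2 = 0.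
  by rewrite /A; case: cid.
have [G [GU FG]] := ultraFilterLemma (at_right_proper_filter (0 : R)).
have Gt : G [set t | 0 < t < eps].
  apply: FG; near=> t; apply/andP; split; near: t; first exact: nbhs_right_gt.
  exact: nbhs_right_lt.
have AG : UltraFilter (A @ G) by exact: ultra_fmap.
have AB : G [set t | forall i,
    [set z : R[i] | `|complex.Re z| <= 1 /\ `|complex.Im z| <= 1] (A t ord0 i)].
  apply: filterS Gt => t /AP[A1 _] i.
  have Ai : `|A t 0 i| <= 1 by rewrite -A1; exact: entry_le_norm.
  by split; rewrite -lecR; [apply: le_trans (normc_ge_Re _) _|apply: le_trans (normc_ge_Im _) _].
have := @unit_box_compact k; rewrite compact_ultra => /(_ _ AG AB)[A0 [_ A0c]].
have A0i i : (fun t => A t 0 i) @ G --> A0 0 i.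
  by move=> B /(@coord_continuous _ _ _ 0 i) nB; exact: A0c nB.
have A01 : `|A0| = 1.
  apply: (cvg_eq (f := fun t => `|A t|) _ (cvg_norm A0c) (cvg_cst (1 : R[i]))).
  by apply: filterS Gt => t /AP[].
have gh' : (fun t => t^-1 *: (g t - g 0)) @ G --> h by move=> B /gh; exact: FG.
have Gt0 : G [set t | t != 0] by apply: filterS Gt => t /= /andP[t0 _]; rewrite gt_eqF.
have G0 : 0^' `<=` G.
  move=> B nB; apply: FG; have {}nB : nbhs (0 : R) [set t | t != 0 -> B t] := nB.
  rewrite /at_right /within /=.
  by apply: filterS nB => t Bt t0; apply: Bt; rewrite gt_eqF.
have gc : g @ G --> x by rewrite -gx; exact: cvg_difference_quotient gh'.
have frc (f : {scalar VC}) : (fun t => f (fr (A t) (g t))) @ G --> f (fr A0 x).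
  exact: cvg_frame.
exists (A0 0); split.
- apply/negP => /eqP /(frame_free kd eB) A00.
  have /eqP := A01; rewrite (_ : A0 = 0) ?normr0 1?eq_sym ?oner_eq0 //.
  by apply/rowP => i; rewrite A00 mxE.
- apply: snd_eq0 => q.
  apply: (@cvg_eq _ _ _ G _ (fun t => complex.Im (vcoord q (fr (A t) (g t)))) (cst 0)).
  + by move=> B /continuous_Im nB; exact: (frc _ _ nB).
  + exact: cvg_cst.
  + by apply: filterS Gt => t /AP[_ f2]; exact: vcoord_snd0.
(* The imaginary parts of p form a real subspace P, hence a closed condition. *)
pose fs := [seq (frame e (to_complex x) i).1 | i : 'I_k] ++
          [seq (frame e (to_complex x) i).2 | i : 'I_k].
pose P := <<fs>>%VS; pose pr : 'End(V) := (\1 - projv P)%VF.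
have frP B : (fr B x).2 \in P.
  rewrite snd_sum; apply: memv_suml => i _ /=; rewrite memvD // memvZ //.
    by apply: memv_span; rewrite mem_cat orbC (map_f (fun i => (frame e (to_complex x) i).2)) // mem_enum.
  by apply: memv_span; rewrite mem_cat (map_f (fun i => (frame e (to_complex x) i).1)) // mem_enum.
have prP v : v \in P -> pr v = 0.
  by move=> vP; rewrite add_lfunE opp_lfunE id_lfunE projv_id // subrr.
have prE w : (complexify pr w).2 = pr w.2 by rewrite complexifyE.
have veP : (ve A0 h).2 \in P.
  suff : (complexify pr (ve A0 h)).2 = 0.
    rewrite prE add_lfunE opp_lfunE id_lfunE => /subr0_eq ->.
    exact: memv_proj.
  apply: snd_eq0 => q; pose f : {scalar VC} := vcoord q \o complexify pr.
  apply: (@cvg_eq _ _ _ G _ (fun t => complex.Im (f (ve (A t) (t^-1 *: (g t - g 0)))))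
    (cst 0)).
  + have fc : (fun t => f (ve (A t) (t^-1 *: (g t - g 0)))) @ G --> f (ve A0 h).
      exact: cvg_velocity.
    by move=> B /continuous_Im nB; exact: (fc _ nB).
  + exact: cvg_cst.
  apply: filterS2 Gt Gt0 => t /AP[_ f2] t0; apply: vcoord_snd0.
  apply: (etrans (prE _)); apply: prP.
  have E : fr (A t) (g t) = fr (A t) x + t%:C *: ve (A t) (t^-1 *: (g t - g 0)).
    have gE : g t = x + t *: (t^-1 *: (g t - g 0)).
      by rewrite scalerA divff // scale1r gx addrC subrK.
    rewrite /fr /ve [in LHS]gE scaler_sumr -big_split /=; apply: eq_bigr => i _.
    by rewrite to_complexD to_complexZ frame_add scalerDr !scalerA [A t 0 i * _]mulrC.
  have : t *: (ve (A t) (t^-1 *: (g t - g 0))).2 \in P.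
    rewrite -snd_realZ.
    have -> : t%:C *: ve (A t) (t^-1 *: (g t - g 0)) = fr (A t) (g t) - fr (A t) x.
      by rewrite E; apply/esym/eqP; rewrite subr_eq; apply/eqP/addrC.
    by rewrite /= f2 sub0r memvN.
  by move=> /(memvZ t^-1); rewrite scalerA mulVf // scale1r.
have [c ->] : exists c : 'I_k -> R[i], (ve A0 h).2 =
    (\sum_i c i *: frame e (to_complex x) i).2.
  move: veP; rewrite /P span_cat => /memv_addP[u + [v + ->]].
  move=> /mem_span_image[a ->] /mem_span_image[b ->].
  exists (fun i => b i +i* a i); rewrite snd_sum -big_split; apply: eq_bigr => i _.
  by rewrite /= addrC.
exists (\sum_i c i *: frame e (to_complex x) i) => //.
by rewrite phiE; apply/graph_span; exists c.
Unshelve. all: by end_near. Qed.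

End TangentCone.

(** * Spans of vectors moving affinely *)

Section AffineCurves.
Context (R : realType) (W : vectType R[i]) (k : nat).
Local Notation d := (\dim {:W}).
Local Notation Er := ('M[R]_(k, d - k) * 'M[R]_(k, d - k))%type.
Hypothesis kd : (k <= d)%N.
Implicit Types (e : d.-tuple W).

Lemma elementary_to_real (E : normedModType R) (U : set E) m n (f : E -> 'M[R[i]]_(m, n)) :
  (forall i j, elementary_complex U (fun x => f x i j)) ->
  elementary_map U (fun x => to_real (f x)).
Proof.
move=> ef; rewrite (_ : (fun x => _) = (fun x => \sum_(p : 'I_m * 'I_n)
    (complex.Re (f x p.1 p.2) *: (delta_mx p.1 p.2, 0) +
     complex.Im (f x p.1 p.2) *: (0, delta_mx p.1 p.2)))); last first.
  have fst_sum (I : finType) (F : I -> 'M[R]_(m, n) * 'M[R]_(m, n)) :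
    (\sum_i F i).1 = \sum_i (F i).1 by elim/big_rec2: _ => //= i y x _ <-.
  have snd_sum (I : finType) (F : I -> 'M[R]_(m, n) * 'M[R]_(m, n)) :
    (\sum_i F i).2 = \sum_i (F i).2 by elim/big_rec2: _ => //= i y x _ <-.
  apply/funext => x; rewrite [RHS]surjective_pairing fst_sum snd_sum; congr pair.
    rewrite [LHS]matrix_sum_delta pair_big /=; apply: eq_bigr => p _.
    by rewrite mxE scaler0 addr0.
  rewrite [LHS]matrix_sum_delta pair_big /=; apply: eq_bigr => p _.
  by rewrite mxE scaler0 add0r.
apply: elementary_map_sum => p; apply: elementary_mapD; apply: elementary_mapZ.
  by have [] := ef p.1 p.2.
by have [] := ef p.1 p.2.
Qed.

Lemma elementary_complex_affine (U : set R) (b c : R[i]) :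
  elementary_complex U (fun t => b + t%:C * c).
Proof.
apply: elementary_complexD; first exact: elementary_complex_cst.
apply: elementary_complexM; last exact: elementary_complex_cst.
split; last exact: elementary_cst.
by apply: (@elementary_scalar R R U id) => // x; exact: cvg_id.
Qed.

Lemma elementary_complex_continuous (f : R -> R[i]) :
  elementary_complex setT f -> continuous f.
Proof.
move=> [fr fi] t; rewrite (_ : f = fun t => complex.Re (f t) +i* complex.Im (f t)).
  apply: cvg_complex.
    exact: (differentiable_continuous (elementary_differentiable fr I)).
  exact: (differentiable_continuous (elementary_differentiable fi I)).
by apply/funext => s; case: (f s).
Qed.

Lemma graph_expand e X w : basis_of fullv e -> w \in graph_space e X ->
  w = \sum_(i < k) crd e i w *: frame e X i.
Proof.
move=> eB /graph_span[a ->]; apply: eq_bigr => i _; congr (_ *: _).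
rewrite linear_sum (bigD1 i) //= linearZ /= crd_frame_low // eqxx mulr1 big1 ?addr0 // => l li.
by rewrite linearZ /= crd_frame_low // (inj_eq val_inj) (negbTE li) mulr0.
Qed.

(** By Cramer's rule the coordinates, in any chart, of the span of k vectors
    moving affinely are rational functions of the time. *)
Lemma affine_curve e (phi : Er -> grassmannian k W) (x : Er) (b c : 'I_k -> W) :
  basis_of fullv e -> (forall z, gr_space (phi z) = graph_space e (to_complex z)) ->
  gr_space (phi x) = <<[seq b i | i : 'I_k]>>%VS ->
  exists g : R -> Er, [/\ smooth g 0, g 0 = x & \forall t \near 0,
    gr_space (phi (g t)) = <<[seq (b i + t%:C *: c i)%R | i : 'I_k]>>%VS].
Proof.
move=> eB phiE xE; pose v t i := b i + t%:C *: c i.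
pose A (t : R) : 'M[R[i]]_k := \matrix_(i, l) crd e l (v t i).
pose B (t : R) : 'M[R[i]]_(k, d - k) := \matrix_(i, j) crd e (k + j)%N (v t i).
pose U : set R := [set t | \det (A t) != 0].
have eA S i j : elementary_complex S (fun t => A t i j).
  rewrite (_ : (fun t => _) = fun t => crd e j (b i) + t%:C * crd e j (c i)).
    exact: elementary_complex_affine.
  by apply/funext => t; rewrite mxE linearD linearZ.
have eB' S i j : elementary_complex S (fun t => B t i j).
  rewrite (_ : (fun t => _) = fun t => crd e (k + j) (b i) + t%:C * crd e (k + j) (c i)).
    exact: elementary_complex_affine.
  by apply/funext => t; rewrite mxE linearD linearZ.
have oU : open U.
  rewrite (_ : U = (fun t => \det (A t)) @^-1` (~` [set 0])); last first.
    by apply/seteqP; split=> t /eqP.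
  apply: open_comp => [t _|].
    exact/elementary_complex_continuous/elementary_complex_det.
  rewrite openC; exact/accessible_closed_set1/hausdorff_accessible/norm_hausdorff.
have v0 i : v 0 i = b i by rewrite /v scale0r addr0.
have U0 : U 0.
  rewrite /U /= -unitfE -unitmxE.
  have fr i : exists a : 'I_k -> R[i], frame e (to_complex x) i = \sum_l a l *: b l.
    apply/mem_span_image; rewrite -xE phiE; exact: frame_in_graph.
  (* Q expresses the frame of the chart at time 0 in the vectors b. *)
  pose Q : 'M[R[i]]_k := \matrix_(i, l) sval (cid (fr i)) l.
  suff /mulmx1_unit[_ //] : Q *m A 0 = 1%:M.
  apply/matrixP => i j; rewrite !mxE.
  transitivity (crd e j (frame e (to_complex x) i)).
    have aE := svalP (cid (fr i)); rewrite [in RHS]aE linear_sum; apply: eq_bigr => l _.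
    by rewrite !mxE v0 linearZ.
  by rewrite crd_frame_low // -val_eqE.
pose Y t : 'M[R[i]]_(k, d - k) := (\det (A t))^-1 *: (\adj (A t) *m B t).
have YE t : U t -> A t *m Y t = B t.
  move=> Ut; rewrite /Y -scalemxAr mulmxA mul_mx_adj mul_scalar_mx scalerA mulVf //.
  by rewrite scale1r.
have spanY t : U t -> graph_space e (Y t) = <<[seq v t i | i : 'I_k]>>%VS.
  move=> Ut; have vY i : v t i \in graph_space e (Y t).
    apply/(mem_graph _ _ kd eB) => j.
    have := congr1 (fun M : 'M[R[i]]_(k, d - k) => M i j) (YE t Ut); rewrite !mxE => <-.
    by apply: eq_bigr => l _; rewrite !mxE.
  apply/eqP; rewrite eqEsubv; apply/andP; split; last first.
    by apply/span_subvP => _ /mapP[i _ ->]; exact: vY.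
  apply/span_subvP => _ /mapP[i _ ->]; apply/mem_span_image.
  exists (fun l => invmx (A t) i l).
  have uA : A t \in unitmx by rewrite unitmxE unitfE.
  rewrite -[LHS]/(frame e (Y t) i).
  transitivity (\sum_l (invmx (A t) *m A t) i l *: frame e (Y t) l).
    rewrite mulVmx // (bigD1 i) //= mxE eqxx scale1r big1 ?addr0 // => l li.
    by rewrite mxE eq_sym (negbTE li) scale0r.
  under [RHS]eq_bigr => l _ do rewrite (graph_expand eB (vY l)) scaler_sumr.
  rewrite exchange_big /=; apply: eq_bigr => l _; rewrite mxE scaler_suml.
  by apply: eq_bigr => m _; rewrite scalerA !mxE.
exists (fun t => to_real (Y t)); split.
- apply: (@elementary_map_smooth _ _ U) => //; apply: elementary_to_real => i j.
  rewrite (_ : (fun t => _) = fun t => (\det (A t))^-1 * \sum_l \adj (A t) i l * B t l j).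
    apply: elementary_complexM.
      by apply: elementary_complexV => //; exact: elementary_complex_det.
    apply: elementary_complex_sum => l; apply: elementary_complexM => //.
    rewrite (_ : (fun t => _) = fun t => (-1) ^+ (l + i) * \det (row' l (col' i (A t)))).
      apply: elementary_complexM; first exact: elementary_complex_cst.
      apply: elementary_complex_det => p q.
      by rewrite (_ : (fun t => _) = fun t => A t (lift l p) (lift i q)) //;
        apply/funext => t; rewrite !mxE.
    by apply/funext => t; rewrite mxE.
  by apply/funext => t; rewrite !mxE.
- suff -> : Y 0 = to_complex x by rewrite to_complexK.
  apply: (graph_inj kd eB); rewrite spanY // -phiE xE; congr (<<_>>%VS).
  exact: eq_image.
- have : \forall t \near 0, U t by exact: open_nbhs_nbhs.
  by apply: filterS => t Ut; rewrite phiE to_realK spanY.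
Qed.

End AffineCurves.

(** * Singular points of a locus of real vectors *)

Lemma smooth_differentiable (R : realType) (E F : normedModType R) (f : E -> F) x :
  smooth f x -> \forall y \near x, differentiable f y.
Proof.
move=> [U oU fU]; have [fd _] := fU 1; apply: filterS (open_nbhs_nbhs oU).
by move=> y Uy; exact: fd.
Qed.

Lemma smooth_cst (R : realType) (E F : normedModType R) (x : F) (y : E) :
  smooth (fun _ : E => x) y.
Proof.
exists setT; first by split; first exact: openT.
move=> m; elim: m x => [|m IH] x /=; first by move=> z _; exact: cvg_cst.
split=> [z _|v]; first exact: differentiable_cst.
rewrite (_ : 'D_v _ = fun=> 0); first exact: IH.
by apply/funext => z; exact: derive_cst.
Qed.

Lemma dnbhs_at_right (R : realType) (x : R) : x^' `<=` x^'+.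
Proof.
move=> B nB; have {}nB : nbhs x [set t | t != x -> B t] := nB.
by rewrite /at_right /within /=; apply: filterS nB => t Bt t0; apply: Bt; rewrite gt_eqF.
Qed.

Lemma near_image (T U : topologicalType) (f : T -> U) x (P : U -> Prop) :
  {for x, continuous f} -> (\forall z \near f x, P z) -> \forall t \near x, P (f t).
Proof. by move=> cf; exact: cf. Qed.

Lemma derive_affine (R : realType) (E : normedModType R) (x h : E) (t : R) :
  differentiable (fun t : R => x + t *: h) t /\ 'D_1 (fun t : R => x + t *: h) t = h.
Proof.
have did : differentiable (id : R -> R) t by exact: ex_diff.
have dl : differentiable (fun t : R => t *: h) t by exact: (differentiableZl h did).
have da : differentiable (cst x + (fun t : R => t *: h)) t by exact: differentiableD.
split=> //; rewrite -[LHS]/('D_1 (cst x + (fun t : R => t *: h)) t) deriveE //.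
rewrite diffD // /= diff_cst add0r (diffZl h did) /= -deriveE // derive_id.
by rewrite scale1r.
Qed.

(** The dual form of linear independence, which splits a matrix H into a part
    killing a and a part killing b. *)
Lemma separating_vector (R : realType) n (a b : 'rV[R[i]]_n) :
  (forall s t, s *: a + t *: b = 0 -> s = 0 /\ t = 0) ->
  exists u : 'cV[R[i]]_n, a *m u = 1%:M /\ b *m u = 0.
Proof.
move=> ab; have b0 : b != 0.
  apply/eqP => b0; have [|_ /eqP] := ab 0 1; first by rewrite b0 scale0r scaler0 addr0.
  by rewrite oner_eq0.
have [i bi] : exists i, b 0 i != 0.
  apply/existsP; apply: contraNT b0; rewrite negb_exists => /forallP nb.
  by apply/eqP/rowP => j; rewrite mxE; apply/eqP/negPn.
pose a' := a - (a 0 i / b 0 i) *: b.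
have a0 : a' != 0.
  apply/eqP => a0; have [|/eqP + _] := ab 1 (- (a 0 i / b 0 i)); last by rewrite oner_eq0.
  by rewrite scale1r scaleNr.
have [j aj] : exists j, a' 0 j != 0.
  apply/existsP; apply: contraNT a0; rewrite negb_exists => /forallP nb.
  by apply/eqP/rowP => j; move: (nb j); rewrite negbK => /eqP ->; rewrite mxE.
have mulE (c : 'rV[R[i]]_n) l : c *m delta_mx l 0 = (c 0 l)%:M.
  by apply/matrixP => x y; rewrite !ord1 -colE !mxE eqxx mulr1n.
exists ((a' 0 j)^-1 *: (delta_mx j 0 - (b 0 j / b 0 i) *: delta_mx i 0)).
rewrite -!scalemxAr !mulmxBr -!scalemxAr !mulE; split; apply/matrixP => x y;
  rewrite !ord1 !mxE !eqxx !mulr1n.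
  have -> : b 0 j / b 0 i * a 0 i = a 0 i / b 0 i * b 0 j.
    by rewrite mulrAC [b 0 j * _]mulrC mulrAC.
  by rewrite mulVf //; move: aj; rewrite !mxE.
by rewrite divfK // subrr mulr0.
Qed.

Section Singularities.
Context (R : realType) (W : vectType R[i]) (k : nat).
Local Notation d := (\dim {:W}).
Local Notation Er := ('M[R]_(k, d - k) * 'M[R]_(k, d - k))%type.
Hypothesis kd : (k <= d)%N.

(** At a point of a submanifold, the tangent vectors form a linear space, the
    image of the differential of a parametrisation; it contains the directions of
    the straight segments of the set and is contained in the tangent cone. *)
Lemma submanifold_tangent n (Z : set (grassmannian k W)) p :
  submanifold_at (@smooth R) (gr_real_atlas k W) n Z p ->
  exists (phi : Er -> grassmannian k W) x (S : set Er),
  [/\ gr_real_atlas k W phi, phi x = p,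
      forall h, (forall t : R, Z (phi (x + t *: h))) -> S h,
      forall h h', S h -> S h' -> S (h + h')
    & S `<=` tangent_cone phi Z x].
Proof.
move=> [Zp [N [D [[oN Np] oD [g [h [gX hY rg rh]]]]]]].
have [Dg hg] := gX p (conj Zp Np).
have [phi1 [psi1 [x1 [f1 [phi1A -> phi1x f1s nf1]]]]] := rg p (conj Zp Np).
have [chi [phi2 [q0 [f2 [-> phi2A /= q0E f2s nf2]]]]] := rh (g p) Dg.
have [e1 e1B phi1E] := gr_real_atlasP phi1A.
have [e2 e2B phi2E] := gr_real_atlasP phi2A.
have phi2inj z z' : phi2 z = phi2 z' -> z = z'.
  move=> /(congr1 (@gr_space _ _ _)); rewrite !phi2E => /(graph_inj kd e2B) zz.
  by rewrite -[z]to_complexK zz to_complexK.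
subst q0; set q0 := g p in f2s nf2.
have phi2x : phi2 (f2 q0) = p by rewrite -(nbhs_singleton nf2).
have df1 : differentiable f1 x1 by exact: nbhs_singleton (smooth_differentiable f1s).
have df2 : differentiable f2 q0 by exact: nbhs_singleton (smooth_differentiable f2s).
exists phi2, (f2 q0), [set v | exists xi, v = 'd f2 q0 xi]; split => //.
(* The curve q of the parameters of the segment c is differentiable: it is the
   image by f1 of the curve y, which is the segment in the chart of f1. *)
- move=> H ZH; pose c (t : R) := f2 q0 + t *: H.
  have cc : {for 0, continuous c}.
    by apply: differentiable_continuous; have [] := derive_affine (f2 q0) H 0.
  have c0 : c 0 = f2 q0 by rewrite /c scale0r addr0.
  have [y [ys y0 yE]] := @affine_curve R W k kd e1 phi1 x1
    (frame e2 (to_complex (f2 q0))) (velocity e2 (to_complex H)) e1B phi1E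
    (etrans (congr1 (@gr_space _ _ _) (etrans phi1x (esym phi2x))) (phi2E _)).
  have dy : differentiable y 0 by exact: nbhs_singleton (smooth_differentiable ys).
  have yc : \forall t \near 0, phi1 (y t) = phi2 (c t).
    apply: filterS yE => t yt; apply: gr_eq; rewrite yt phi2E /graph_space.
    congr (<<_>>%VS); apply: eq_image => // i.
    by rewrite -[RHS]/(frame e2 (to_complex (c t)) i) to_complexD to_complexZ frame_add.
  have Nc : \forall t \near 0, N (phi2 (c t)).
    have nN : nbhs (phi2 (c 0)) N by rewrite c0 phi2x; exact: open_nbhs_nbhs.
    exact: (cc _ (gr_real_atlas_continuous phi2A nN)).
  have cy : {for 0, continuous y} by exact: differentiable_continuous.
  have gy : \forall t \near 0, (Z `&` N) (phi1 (y t)) -> g (phi1 (y t)) = f1 (y t).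
    by apply: (near_image (P := fun z => (Z `&` N) (phi1 z) -> g (phi1 z) = f1 z) cy);
      rewrite y0.
  pose q t := f1 (y t).
  have dq : differentiable q 0.
    by apply: differentiable_comp => //; rewrite y0.
  have qE : \forall t \near 0, D (q t) /\ h (q t) = phi2 (c t).
    apply: filterS3 yc Nc gy => t yct Nct gyt.
    have ZNt : (Z `&` N) (phi2 (c t)) by split; [exact: ZH|].
    by rewrite yct in gyt; rewrite /q -(gyt ZNt); exact: gX.
  have q0E : q 0 = q0.
    have := nbhs_singleton gy; rewrite /= /q y0 phi1x => <- //.
  have f2q : \forall t \near 0, f2 (q t) = c t.
    have cq : {for 0, continuous q} by exact: differentiable_continuous.
    have nq : \forall t \near 0, D (q t) -> h (q t) = phi2 (f2 (q t)).
      by apply: (near_image (P := fun z => D z -> h z = phi2 (f2 z)) cq); rewrite q0E.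
    by apply: filterS2 qE nq => t [Dq hq] /(_ Dq) E; apply: phi2inj; rewrite -E.
  exists ('d q 0 1).
  have [dc Dc] := derive_affine (f2 q0) H 0.
  rewrite -Dc -(near_eq_derive _ f2q) deriveE; last first.
    by apply: differentiable_comp => //; rewrite q0E.
  by have := @diff_comp _ _ _ _ q f2 0 dq; rewrite q0E => /(_ df2) ->.
- by move=> _ _ [xi ->] [xi' ->]; exists (xi + xi'); rewrite linearD.
move=> _ [xi ->].
pose y (t : R) := f2 (q0 + t *: xi).
have cl : {for 0, continuous (fun t : R => q0 + t *: xi)}.
  by apply: differentiable_continuous; have [] := derive_affine q0 xi 0.
have near_l (P : set 'rV[R]_n) : nbhs q0 P -> \forall t \near 0, P (q0 + t *: xi).
  by move=> nP; apply: (near_image (P := P) cl); rewrite scale0r addr0.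
have /nbhs_ballP[eps eps0 yP] : \forall t \near 0,
    [/\ D (q0 + t *: xi), D (q0 + t *: xi) -> h (q0 + t *: xi) = phi2 (y t)
      & differentiable f2 (q0 + t *: xi)].
  have nD : nbhs q0 D by exact: open_nbhs_nbhs.
  apply: filterS3 (near_l _ nD) (near_l _ nf2) (near_l _ (smooth_differentiable f2s)).
  by move=> t.
have in_ball t : 0 <= t < eps -> ball 0 eps t.
  by move=> /andP[t0 te]; rewrite /ball /= sub0r normrN ger0_norm.
exists y, eps; split => //.
- by rewrite /y scale0r addr0.
- move=> t /in_ball/yP[Dt /(_ Dt) <- _].
  by have [[]] := hY _ Dt.
- move=> t /andP[t0 te]; have /yP[_ _ dt] : ball 0 eps t.
    by apply: in_ball; rewrite ltW.
  have [dl _] := derive_affine q0 xi t.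
  exact/diff_derivable/(differentiable_comp dl dt).
have : derivable f2 q0 xi by exact: diff_derivable.
rewrite /derivable => /cvg_ex[/= l Hl].
have lE : l = 'd f2 q0 xi by rewrite -deriveE //; apply/esym; exact: (cvg_lim (@norm_hausdorff _ _) Hl).
have yE : (fun t : R => t^-1 *: (y t - y 0)) =
    (fun t => t^-1 *: (f2 (t *: xi + q0) - f2 q0)).
  by apply/funext => t; rewrite /y scale0r addr0 [q0 + _]addrC.
rewrite yE -lE => B /Hl nB; exact: (dnbhs_at_right nB).
Qed.

End Singularities.

(** If the locus were a submanifold at p, then its tangent space would contain the
    matrices which kill v1 and those which kill v2, because a segment in such a
    direction keeps v1, or v2, in the subspace. These matrices span everything,
    although some direction is not in the tangent cone. *)
Lemma real_locus_singular (R : realType) (V : vectType R) k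
    (L : set (grassmannian k (complexification V))) p (v1 v2 : V) :
  (k <= \dim {:complexification V})%N ->
  (forall U, (exists2 v, v != 0 & real_vec v \in gr_space U) -> L U) ->
  real_vec v1 \in gr_space p -> real_vec v2 \in gr_space p ->
  (forall s t : R[i], s *: real_vec v1 + t *: real_vec v2 = 0 -> s = 0 /\ t = 0) ->
  (forall phi x, gr_real_atlas k (complexification V) phi -> phi x = p ->
     exists h, ~ tangent_cone phi L x h) ->
  singular_point L p.
Proof.
move=> kd realL v1p v2p v12 TC.
have v1_0 : v1 != 0.
  apply/eqP => v10; have [|/eqP] := v12 1 0; last by rewrite oner_eq0.
  by rewrite v10 scale0r addr0 scale1r.
have v2_0 : v2 != 0.
  apply/eqP => v20; have [|_ /eqP] := v12 0 1; last by rewrite oner_eq0.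
  by rewrite v20 scale0r add0r scale1r.
split=> [|n /(submanifold_tangent kd)[phi [x [S [phiA phix lineS SD ST]]]]].
  by apply: realL; exists v1.
have [h nh] := TC phi x phiA phix; apply: nh.
have [e eB phiE] := gr_real_atlasP phiA.
have [a aE] : exists a : 'I_k -> R[i], real_vec v1 = \sum_i a i *: frame e (to_complex x) i.
  by apply/graph_span; rewrite -phiE phix.
have [b bE] : exists a : 'I_k -> R[i], real_vec v2 = \sum_i a i *: frame e (to_complex x) i.
  by apply/graph_span; rewrite -phiE phix.
have [u [au bu]] : exists u : 'cV[R[i]]_k, (\row_i a i) *m u = 1%:M /\ (\row_i b i) *m u = 0.
  apply: separating_vector => s t st; apply: v12.
  rewrite aE bE !scaler_sumr -big_split big1 //= => i _.
  rewrite !scalerA -scalerDl; have /rowP/(_ i) := st; rewrite !mxE => ->.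
  by rewrite scale0r.
(* As a u = 1 and b u = 0, H2 is killed by b and H - H2 by a. *)
pose H := to_complex h; pose H2 := u *m ((\row_i a i) *m H).
have killed c v (H' : 'M[R[i]]_(k, \dim {:complexification V} - k)) : v != 0 ->
    real_vec v = \sum_i c i *: frame e (to_complex x) i ->
    (\row_i c i) *m H' = 0 -> S (to_real H').
  move=> v0 cE cH; apply: lineS => t; apply: realL; exists v => //.
  rewrite phiE; apply/graph_span; exists c; rewrite cE.
  under [RHS]eq_bigr do rewrite to_complexD to_complexZ to_realK frame_add scalerDr.
  rewrite big_split /= -[LHS]addr0; congr (_ + _); apply/esym.
  transitivity (\sum_j (t%:C * ((\row_i c i) *m H') 0 j) *: e`_(k + j)).
    under eq_bigr do rewrite /velocity scaler_sumr scaler_sumr.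
    rewrite exchange_big /=; apply: eq_bigr => j _; rewrite mxE mulr_sumr scaler_suml.
    by apply: eq_bigr => i _; rewrite !scalerA mxE; congr (_ *: _); ring.
  by rewrite cH big1 // => j _; rewrite mxE mulr0 scale0r.
apply: ST; rewrite -[h]to_complexK -[to_complex h](subrK H2).
have -> : to_real (H - H2 + H2) = to_real (H - H2) + to_real H2.
  by apply: (can_inj (@to_complexK _ _ _)); rewrite to_complexD !to_realK.
apply: SD.
  by apply: killed aE _ => //; rewrite mulmxBr mulmxA au mul1mx subrr.
by apply: killed bE _ => //; rewrite mulmxA bu mul0mx.
Qed.

(** * Closures, components and pieces of a line *)

Section GeneralTopology.
Context (T : topologicalType).
Implicit Types A B F G : set T.

Lemma closure_limit (I : Type) (H : set_system I) (HH : ProperFilter H) (f : I -> T)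
    A p : f @ H --> p -> H [set i | A (f i)] -> closure A p.
Proof.
move=> fp HA B /fp; rewrite /nbhs /= => nB; have [i [Ai Bi]] := filter_ex (filterI HA nB).
by exists (f i).
Qed.

(** Within the union, F and the complement of G both cut out A, which is thus closed
    and open. *)
Lemma component_of_separated A B F G x : closed F -> closed G ->
  A `<=` F -> B `<=` G -> A `&` G = set0 -> B `&` F = set0 ->
  connected A -> A x -> connected_component (A `|` B) x = A.
Proof.
move=> cF cG AF BG AG BF cA Ax; apply/seteqP; split; last first.
  by apply: connected_component_max => // y Ay; left.
set C := connected_component _ _; have CAB : C `<=` A `|` B.
  exact: connected_component_sub.
have Cx : C x by apply: connected_component_refl; left.
suff <- : C `&` A = C by move=> y [].
apply: (@component_connected _ (A `|` B) x); first by exists x.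
  exists (~` G); first by rewrite openC.
  apply/seteqP; split=> y [Cy]; last by case: (CAB y Cy) => // /BG.
  by move=> Ay; split=> // Gy; have : (A `&` G) y by []; rewrite AG.
exists F => //; apply/seteqP; split=> y [Cy]; first by move=> /AF.
move=> Fy; split=> //; case: (CAB y Cy) => // By.
by have : (B `&` F) y by []; rewrite BF.
Qed.

End GeneralTopology.

Section Squared.
Context (R : realType).

Definition sqn (z : R[i]) : R := complex.Re z ^+ 2 + complex.Im z ^+ 2.

Lemma sqnM (a b : R[i]) : sqn (a * b) = sqn a * sqn b.
Proof. by case: a b => [a b] [c e]; rewrite /sqn /=; ring. Qed.

Lemma sqn_ge0 z : 0 <= sqn z.
Proof. by rewrite addr_ge0 ?sqr_ge0. Qed.

Lemma sqn_eq0 z : (sqn z == 0) = (z == 0).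
Proof. by case: z => a b; rewrite paddr_eq0 ?sqr_ge0 // !sqrf_eq0 eq_complex. Qed.

Lemma sqn1 : sqn 1 = 1.
Proof. by rewrite /sqn /= expr1n expr0n addr0. Qed.

Lemma sqnV z : sqn z^-1 = (sqn z)^-1.
Proof.
have [->|z0] := eqVneq z 0; first by rewrite invr0 (eqP (_ : sqn 0 == 0)) ?sqn_eq0 // invr0.
have s0 : sqn z != 0 by rewrite sqn_eq0.
by apply: (mulfI s0); rewrite -sqnM !mulfV // sqn1.
Qed.

Lemma sqn_real (x : R) : sqn x%:C = x ^+ 2.
Proof. by rewrite /sqn /= expr0n addr0. Qed.

Lemma continuous_sqn : continuous sqn.
Proof.
have -> : sqn = (fun z => complex.Re z * complex.Re z + complex.Im z * complex.Im z).
  by apply/funext => z; rewrite /sqn !expr2.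
move=> z; have [zr zi] := (@continuous_Re R z, @continuous_Im R z).
by apply: (@cvgD _ _ _ _ (nbhs_filter z)); apply: (@cvgM _ _ _ (nbhs_filter z)).
Qed.

Definition unit_disk : set R[i] := [set c | sqn c < 1].

Lemma open_unit_disk : open unit_disk.
Proof.
apply: (@open_comp _ _ sqn [set x | x < 1]) => [z _|]; last exact: open_lt.
exact: continuous_sqn.
Qed.

Lemma closure_unit_disk c : sqn c = 1 -> exists2 H : set_system R, ProperFilter H &
  (fun s : R => s%:C * c) @ H --> c /\ H [set s | unit_disk (s%:C * c)].
Proof.
move=> c1; exists 1^'-; first exact: at_left_proper_filter.
split.
  rewrite -[X in _ --> X]mul1r; apply: cvgM; last exact: cvg_cst.
  by apply: cvg_real_complex; apply: cvg_at_left_filter; exact: cvg_id.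
near=> s; rewrite /unit_disk /= sqnM c1 mulr1 sqn_real.
have s1 : s < 1 by near: s; exact: nbhs_left_lt.
have s0 : 0 < s by near: s; exact: nbhs_left_gt.
by rewrite expr2 mulr_ilt1 // ltW.
Unshelve. all: by end_near. Qed.

End Squared.

Section PieceTopology.
Context (R : realType) (W : vectType R[i]) (k r : nat).
Local Notation d := (\dim {:W}).
Local Notation M := 'M[R[i]]_(k, d - k).
Local Notation line_space := (@line_space R W k r).
Local Notation swap := (@swap R W k r).
Local Notation Gr := (grassmannian k W).
Local Notation piece e T := (piece r e T : set Gr).
Hypotheses (r0 : (0 < r)%N) (rk : (r <= k)%N) (krd : (k + r <= d)%N).
Implicit Types (e : d.-tuple W) (T : set R[i]).

Let kd : (k <= d)%N. Proof. exact: leq_trans (leq_addr _ _) krd. Qed.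

Definition affine_pt e (eB : basis_of fullv e) (c : R[i]) : Gr :=
  gr_chart kd eB (c *: pid_mx r).

Lemma affine_ptE e (eB : basis_of fullv e) c :
  gr_space (affine_pt eB c) = line_space e 1 c.
Proof. by rewrite line_affine. Qed.

Lemma cvg_affine_pt e (eB : basis_of fullv e) (I : Type) (H : set_system I)
    (HH : Filter H) (f : I -> R[i]) c :
  f @ H --> c -> (fun i => affine_pt eB (f i)) @ H --> affine_pt eB c.
Proof.
move=> fc; have Xc : (fun i => f i *: pid_mx r : M) @ H --> c *: (pid_mx r : M).
  apply: cvg_mx_entries => i j; rewrite mxE; under eq_fun do rewrite mxE.
  by apply: cvgM; [exact: fc|exact: cvg_cst].
by move=> B /(gr_atlas_continuous (gr_chart_atlas kd eB)) nB; exact: (Xc _ nB).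
Qed.

Lemma piece_closure e T c (U : Gr) (I : Type) (H : set_system I) (f : I -> R[i]) :
  basis_of fullv e -> ProperFilter H -> f @ H --> c -> H [set i | T (f i)] ->
  gr_space U = line_space e 1 c -> closure (piece e T) U.
Proof.
move=> eB HH fc HT UE; have -> : U = affine_pt eB c by apply: gr_eq; rewrite affine_ptE.
apply: (@closure_limit _ _ H _ (fun i => affine_pt eB (f i))); first exact: cvg_affine_pt.
by apply: filterS HT => i Ti; exists (f i) => //; exact: affine_ptE.
Qed.

Lemma piece_connected e T : basis_of fullv e -> T 0 ->
  (forall c (s : R), T c -> 0 <= s <= 1 -> T (s%:C * c)) -> connected (piece e T).
Proof.
move=> eB T0 Tstar.
pose path c (s : R) := affine_pt eB (s%:C * c).
have -> : piece e T = \bigcup_(c in T) (path c @` `[0, 1]%classic).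
  apply/seteqP; split=> [U [c Tc UE]|U [c Tc [s]]].
    exists c => //; exists 1; first by rewrite /= in_itv /= ler01 lexx.
    by apply: gr_eq; rewrite affine_ptE mul1r.
  rewrite /= in_itv /= => s01 <-; exists (s%:C * c); first exact: Tstar.
  exact: affine_ptE.
apply: bigcup_connected.
  exists (affine_pt eB 0) => c Tc; exists 0; first by rewrite /= in_itv /= lexx ler01.
  by rewrite /path mul0r.
move=> c Tc; apply: connected_continuous_connected; first exact: segment_connected.
apply: continuous_subspaceT => s; apply: cvg_affine_pt.
by apply: cvgM; [apply: cvg_real_complex; exact: cvg_id|exact: cvg_cst].
Qed.

(** The vectors of a nearby subspace are the combinations, with fixed coefficients,
    of a frame which depends continuously on the subspace. *)
Lemma closed_coordinates e n m (a b : R) :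
  closed [set U : Gr | forall w, w \in gr_space U ->
    0 <= a * sqn (crd e n w) + b * sqn (crd e m w)].
Proof.
apply: gr_closedP => phi [e' eB' phiE].
pose w (x : 'I_k -> R[i]) X := \sum_i x i *: frame e' X i.
pose f x X := a * sqn (crd e n (w x X)) + b * sqn (crd e m (w x X)).
rewrite (_ : _ @^-1` _ = \bigcap_x (f x @^-1` [set y | 0 <= y])); last first.
  apply/seteqP; split=> X fX.
    by move=> x _; apply: fX; rewrite phiE; apply/graph_span; exists x.
  by move=> v; rewrite phiE => /graph_span[x ->]; exact: fX.
apply: closed_bigI => x _; apply: closed_comp; last exact: closed_ge.
suff main (I : Type) (H : set_system I) (HH : Filter H) (g : I -> M) X :
    g @ H --> X -> (fun i => f x (g i)) @ H --> f x X.
  by move=> X _; apply: (main _ _ (nbhs_filter X) id); exact: cvg_id.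
move=> gX; have wc p : (fun i => crd e p (w x (g i))) @ H --> crd e p (w x X).
  have E Y : crd e p (w x Y) = \sum_i x i * crd e p (frame e' Y i).
    by rewrite linear_sum; apply: eq_bigr => i _; rewrite linearZ.
  rewrite E; under eq_fun do rewrite E.
  apply: cvg_sum_ord => i; apply: cvgM; first exact: cvg_cst.
  have fc := differentiable_continuous (differentiable_crd_frame e e' p i X).
  by move=> B /fc nB; exact: (gX _ nB).
have sc p : (fun i => sqn (crd e p (w x (g i)))) @ H --> sqn (crd e p (w x X)).
  by move=> B /continuous_sqn nB; exact: (wc p _ nB).
by apply: cvgD; apply: cvgM; [exact: cvg_cst|exact: sc|exact: cvg_cst|exact: sc].
Qed.

Lemma line_vec_mem e s t i : (i < k)%N -> line_vec k r e s t i \in line_space e s t.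
Proof. by move=> ik; apply: memv_span; apply/mapP; exists (Ordinal ik); rewrite ?mem_enum. Qed.

Lemma line_vec0_mem e s t : line_vec k r e s t 0 \in line_space e s t.
Proof. by apply: line_vec_mem; exact: leq_trans r0 rk. Qed.

Lemma crd_line_vec0 e s t : basis_of fullv e ->
  crd e 0 (line_vec k r e s t 0) = s /\ crd e k (line_vec k r e s t 0) = t.
Proof.
move=> eB; rewrite /line_vec r0 addn0 !linearD !linearZ /= !crd_basis //; [|by lia..].
have k0 : (k == 0%N) = false by lia.
by rewrite eqxx k0 eq_sym k0 eqxx !mulr0 !mulr1 addr0 add0r.
Qed.

(** Near p, the closed set B can be removed from Z; only the open piece remains. *)
Lemma piece_submanifold_at e T (Z B : set Gr) p : basis_of fullv e -> open T ->
  closed B -> Z `&` ~` B = piece e T -> piece e T p ->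
  submanifold_at (@holomorphic R) (gr_atlas k W) 1 Z p.
Proof.
move=> eB oT cB ZB pT; have [Zp nBp] : (Z `&` ~` B) p by rewrite ZB.
split=> //; exists (~` B), [set y : 'rV[R[i]]_1 | T (y 0 0)]; split.
- by split=> //; rewrite openC.
- by apply: open_comp oT => y _; exact: coord_continuous.
- by rewrite ZB; exact: piece_submanifold.
Qed.

Lemma piece_disk e T (a : R[i] -> 'rV[R]_2) (b : 'rV[R]_2 -> R[i]) :
  basis_of fullv e -> open T ->
  (forall c, T c -> open_disk (a c) /\ b (a c) = c) ->
  (forall y, open_disk y -> T (b y) /\ a (b y) = y) ->
  (forall c, T c -> smooth (fun z : 'M[R]_(k, d - k) * 'M[R]_(k, d - k) =>
     a (to_complex z (row0 r0 rk) (col0 r0 krd))) (to_real (c *: pid_mx r))) ->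
  (forall y, open_disk y -> smooth (fun y => to_real (b y *: (pid_mx r : M))) y) ->
  complex_curve_disk (piece e T).
Proof.
move=> eB oT ab ba sa sb; split=> [p pT|].
  by apply: (piece_submanifold_at eB oT (@closed0 _)) => //; rewrite setC0 setIT.
apply: (@piece_isomorphic R W k r r0 rk krd R (@smooth R) _ _ _ (@to_complex R _ _)
  (@to_real R _ _) _ T a b e eB) => //; first exact: gr_real_chart_atlas.
exact: to_realK.
Qed.

End PieceTopology.

(** * Disks and circles on a line *)

Section DiskCoordinates.
Context (R : realType).

(** The Taylor series of f at x is f x + f h. *)
Lemma real_analytic_linear (E F : normedModType R) (f : E -> F) x :
  linear f -> continuous f -> real_analytic f x.
Proof.
move=> fl fc; pose fL := GRing.isLinear.Build _ _ _ _ f fl.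
pose f' : {linear E -> F} := HB.pack f fL.
have [C C0 fC] : exists2 C, C > 0 & forall x, `|f x| <= C * `|x|.
  by apply: (@linear_lipschitz _ _ _ f').
pose p k : ('I_k -> E) -> F := match k return ('I_k -> E) -> F with
  | 0 => fun=> f x | 1 => fun u => f (u ord0) | _ => fun=> 0 end.
exists p, 1, (`|f x| + C); split=> // [[|[|k]]|[|[|k]] u|h _].
- by move=> [].
- by move=> i u a v w; rewrite (ord1 i) /= !dfwithin fl.
- by move=> i u a v w; rewrite /= scaler0 addr0.
- by rewrite big_ord0 mulr1 expr0 divr1 lerDl ltW.
- rewrite big_ord1 expr1 divr1 mulrDl; apply: le_trans (fC _) _.
  by rewrite lerDr mulr_ge0.
- by rewrite normr0 mulr_ge0 ?prodr_ge0 // expr1n divr1 addr_ge0 // ltW.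
apply: cvg_near_cst; exists 2 => // m /= m2.
rewrite -(subnK m2) addn2 !big_ord_recl /= big1 ?addr0 //.
by have := fl 1 x h; rewrite !scale1r => ->.
Qed.

Definition to_row (c : R[i]) : 'rV[R]_2 :=
  complex.Re c *: delta_mx 0 0 + complex.Im c *: delta_mx 0 1.

Definition of_row (y : 'rV[R]_2) : R[i] := y 0 0 +i* y 0 1.

Lemma to_row0 c : to_row c 0 0 = complex.Re c.
Proof. by rewrite !mxE !eqxx mulr1 mulr0 addr0. Qed.

Lemma to_row1 c : to_row c 0 1 = complex.Im c.
Proof. by rewrite !mxE !eqxx mulr1 mulr0 add0r. Qed.

Lemma to_rowK : cancel to_row of_row.
Proof. by move=> [a b]; rewrite /of_row to_row0 to_row1. Qed.

Lemma of_rowK : cancel of_row to_row.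
Proof.
move=> y; apply/rowP => i; case: (eqVneq i 0) => [->|i0]; first by rewrite to_row0.
have -> : i = 1 by apply/val_inj; move: i i0 => [[|[|m]] lt_m] //.
by rewrite to_row1.
Qed.

Lemma sqn_of_row y : sqn (of_row y) = y 0 0 ^+ 2 + y 0 1 ^+ 2.
Proof. by []. Qed.

Lemma elementary_coord m n (U : set 'M[R]_(m, n)) i j :
  elementary U (fun y : 'M[R]_(m, n) => y i j).
Proof.
by apply: elementary_scalar => [a u v|]; [rewrite !mxE|exact: coord_continuous].
Qed.

Lemma elementary_complex_entry m n (U : set ('M[R]_(m, n) * 'M[R]_(m, n))) i j :
  elementary_complex U (fun z => to_complex z i j).
Proof.
split.
  under eq_fun do rewrite mxE /=.
  apply: elementary_scalar => [a u v|z]; first by rewrite /= !mxE.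
  by apply: (@continuous_comp _ _ _ fst (fun A : 'M[R]_(m, n) => A i j) z);
    [exact: cvg_fst|exact: coord_continuous].
under eq_fun do rewrite mxE /=.
apply: elementary_scalar => [a u v|z]; first by rewrite /= !mxE.
by apply: (@continuous_comp _ _ _ snd (fun A : 'M[R]_(m, n) => A i j) z);
  [exact: cvg_snd|exact: coord_continuous].
Qed.

Lemma elementary_to_row (E : normedModType R) (U : set E) (f : E -> R[i]) :
  elementary_complex U f -> elementary_map U (fun x => to_row (f x)).
Proof. by move=> [fr fi]; apply: elementary_mapD; exact: elementary_mapZ. Qed.

Lemma elementary_of_row (U : set 'rV[R]_2) : elementary_complex U of_row.
Proof. by split; exact: elementary_coord. Qed.

Lemma elementary_scaled (E : normedModType R) (U : set E) (f : E -> R[i]) m n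
    (A : 'M[R[i]]_(m, n)) :
  elementary_complex U f -> elementary_map U (fun x => to_real (f x *: A)).
Proof.
move=> ef; apply: elementary_to_real => i j; under eq_fun do rewrite mxE.
by apply: elementary_complexM => //; exact: elementary_complex_cst.
Qed.

Lemma elementary_sqn (E : normedModType R) (U : set E) (f : E -> R[i]) :
  elementary_complex U f -> elementary U (fun x => sqn (f x)).
Proof.
by move=> [fr fi]; apply: elementaryD; rewrite /=; under eq_fun do rewrite expr2;
  exact: elementaryM.
Qed.

Lemma elementary_complex_real (E : normedModType R) (U : set E) (f : E -> R) :
  elementary U f -> elementary_complex U (fun x => (f x)%:C).
Proof. by move=> ef; split => //; exact: elementary_cst. Qed.

Lemma open_open_disk : open (@open_disk R).
Proof.
have -> : @open_disk R = of_row @^-1` @unit_disk R by apply/seteqP; split=> y.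
apply: open_comp; last exact: open_unit_disk.
by move=> y _; apply: (@cvg_complex _ _ _ (nbhs_filter y)); exact: coord_continuous.
Qed.

Context (W : vectType R[i]) (k r : nat).
Local Notation d := (\dim {:W}).
Hypotheses (r0 : (0 < r)%N) (rk : (r <= k)%N) (krd : (k + r <= d)%N).
Context (e : d.-tuple W) (eB : basis_of fullv e).

Lemma unit_disk_piece : complex_curve_disk (piece r e (@unit_disk R) : set (grassmannian k W)).
Proof.
apply: (@piece_disk R W k r r0 rk krd e (@unit_disk R) to_row of_row eB) => //.
- exact: open_unit_disk.
- by move=> c c1; rewrite to_rowK /open_disk /= to_row0 to_row1.
- by move=> y y1; rewrite of_rowK.
- move=> c _; apply: (@elementary_map_smooth _ _ setT) => //; first exact: openT.
  exact/elementary_to_row/elementary_complex_entry.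
- move=> y _; apply: (@elementary_map_smooth _ _ setT) => //; first exact: openT.
  exact/elementary_scaled/elementary_of_row.
Qed.

(** The plane is mapped onto the disk by c / sqrt (1 + |c|^2), with inverse
    y / sqrt (1 - |y|^2). *)
Lemma plane_piece : complex_curve_disk (piece r e setT : set (grassmannian k W)).
Proof.
pose n (c : R[i]) := Num.sqrt (1 + sqn c); pose m (c : R[i]) := Num.sqrt (1 - sqn c).
have n0 c : 0 < n c by rewrite sqrtr_gt0 ltr_wpDr ?sqn_ge0.
have n2 c : n c ^+ 2 = 1 + sqn c by rewrite sqr_sqrtr // addr_ge0 ?sqn_ge0.
have m0 c : sqn c < 1 -> 0 < m c by move=> c1; rewrite sqrtr_gt0 subr_gt0.
have m2 c : sqn c < 1 -> m c ^+ 2 = 1 - sqn c.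
  by move=> c1; rewrite sqr_sqrtr // subr_ge0 ltW.
have Cn0 c : (n c)%:C != 0 :> R[i] by rewrite (inj_eq (@complexI R)) gt_eqF.
have mn c : sqn ((n c)^-1%:C * c) < 1 /\ m ((n c)^-1%:C * c) = (n c)^-1.
  have E : 1 - sqn ((n c)^-1%:C * c) = ((n c)^-1) ^+ 2.
    rewrite sqnM sqn_real exprVn n2; have q0 : 1 + sqn c != 0.
      by rewrite gt_eqF // ltr_wpDr ?sqn_ge0.
    by apply: (mulfI q0); rewrite mulrBr mulrA mulfV // mulr1 mul1r addrK.
  split; first by rewrite -subr_gt0 E exprn_gt0 // invr_gt0.
  by rewrite /m E sqrtr_sqr ger0_norm // invr_ge0 ltW.
have nm c : sqn c < 1 -> n ((m c)^-1%:C * c) = (m c)^-1.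
  move=> c1; have E : 1 + sqn ((m c)^-1%:C * c) = ((m c)^-1) ^+ 2.
    rewrite sqnM sqn_real exprVn m2 //.
    have q0 : 1 - sqn c != 0 by rewrite gt_eqF // subr_gt0.
    by apply: (mulfI q0); rewrite mulrDr mulrA mulfV // mulr1 mul1r subrK.
  by rewrite /n E sqrtr_sqr ger0_norm // invr_ge0 ltW // m0.
apply: (@piece_disk R W k r r0 rk krd e setT (fun c => to_row ((n c)^-1%:C * c))
  (fun y => (m (of_row y))^-1%:C * of_row y) eB) => //.
- exact: openT.
- move=> c _; have [c1 mc] := mn c; rewrite to_rowK mc invrK; split.
    by rewrite /open_disk /= -sqn_of_row to_rowK.
  by rewrite mulrA -rmorphM mulfV ?gt_eqF // mul1r.
- move=> y y1; split=> //; rewrite nm // invrK mulrA -rmorphM mulfV ?mul1r ?of_rowK //.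
  by rewrite gt_eqF // m0.
- move=> c _; apply: (@elementary_map_smooth _ _ setT) => //; first exact: openT.
  apply: elementary_to_row; apply: elementary_complexM; last exact: elementary_complex_entry.
  apply: elementary_complex_real; apply: elementaryV => [|x _]; last by rewrite gt_eqF.
  apply: elementary_sqrt => [|x _]; last by rewrite ltr_wpDr ?sqn_ge0.
  by apply: elementaryD; [exact: elementary_cst|exact/elementary_sqn/elementary_complex_entry].
move=> y y1; apply: (@elementary_map_smooth _ _ (@open_disk R)) => //; first exact: open_open_disk.
apply: elementary_scaled; apply: elementary_complexM; last exact: elementary_of_row.
apply: elementary_complex_real; apply: elementaryV => [|x x1]; last by rewrite gt_eqF ?m0.
apply: elementary_sqrt => [|x x1]; last by rewrite subr_gt0.
apply: elementaryD; first exact: elementary_cst.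
exact/elementaryN/elementary_sqn/elementary_of_row.
Qed.

(** Both the affine coordinate and the parametrisation by it are restrictions of
    real-linear maps. *)
Lemma circle_piece : is_analytic_circle
  (piece r e [set c : R[i] | sqn c = 1] : set (grassmannian k W)).
Proof.
apply: isomorphic_sym.
apply: (@piece_isomorphic R W k r r0 rk krd R (@real_analytic R) _ _ _ (@to_complex R _ _)
  (@to_real R _ _) _ _ to_row of_row e eB).
- exact: gr_real_chart_atlas.
- exact: to_realK.
- by move=> c c1; rewrite to_rowK /unit_circle /= to_row0 to_row1.
- by move=> y y1; rewrite of_rowK.
- move=> c _; apply: real_analytic_linear => [a u v|].
    rewrite /to_row to_complexD to_complexZ; apply/rowP => i; rewrite !mxE /=.
    by simpc => /=; ring.
  have := @elementary_map_Ck _ _ setT _ 0 _ openT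
    (elementary_to_row (elementary_complex_entry setT (row0 r0 rk) (col0 r0 krd))).
  by move=> fc z; exact: fc.
move=> y _; apply: real_analytic_linear => [a u v|].
  apply: (can_inj (@to_complexK _ _ _)); rewrite to_complexD to_complexZ !to_realK.
  by rewrite /of_row !mxE scalerA -scalerDl; congr (_ *: _); simpc.
have := @elementary_map_Ck _ _ setT _ 0 _ openT
  (elementary_scaled (pid_mx r : 'M[R[i]]_(k, d - k)) (elementary_of_row setT)).
by move=> fc z; exact: fc.
Qed.

End DiskCoordinates.

(** * Smooth curves on a line *)

Section LineCurves.
Context (R : realType) (W : vectType R[i]) (k r : nat).
Local Notation d := (\dim {:W}).
Local Notation Er := ('M[R]_(k, d - k) * 'M[R]_(k, d - k))%type.
Hypotheses (r0 : (0 < r)%N) (rk : (r <= k)%N) (krd : (k + r <= d)%N).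
Implicit Types (e : d.-tuple W).

Let kd : (k <= d)%N. Proof. exact: leq_trans (leq_addr _ _) krd. Qed.

Lemma smooth_quotient (E : normedModType R) (g : R -> E) : smooth g 0 ->
  (fun t => t^-1 *: (g t - g 0)) @ 0^' --> 'D_1 g 0.
Proof.
move=> /smooth_differentiable/nbhs_singleton gd.
have /cvg_ex[l gl] : derivable g 0 1 by apply: diff_derivable.
have E' : (fun t : R => t^-1 *: ((g \o shift 0) (t *: 1) - g 0)) =
    (fun t : R => t^-1 *: (g t - g 0)).
  by apply/funext => t; rewrite /= addr0 [t *: 1]mulr1.
have gl' := gl; rewrite E' in gl'.
suff -> : 'D_1 g 0 = l by [].
exact: (cvg_lim _ gl).
Qed.

Lemma tangent_space_smooth_cone (phi : Er -> grassmannian k W) (Z L : set (grassmannian k W)) x :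
  Z `<=` L -> tangent_space phi Z x `<=` tangent_cone phi L x.
Proof.
move=> ZL h [g [gs g0 gZ gh]].
have gd := smooth_differentiable gs.
have : \forall t \near (0 : R), differentiable g t /\ Z (phi (g t)).
  by apply: filterS2 gd gZ.
move=> [eps /= eps0 He]; exists g, eps; split=> //.
- move=> t /andP[t0 te]; apply: ZL; have [|//] := He t.
  by rewrite /= sub0r normrN ger0_norm.
- move=> t /andP[t0 te]; apply: diff_derivable; have [|//] := He t.
  by rewrite /= sub0r normrN gtr0_norm.
rewrite -gh; have gq := smooth_quotient gs.
by move=> B /gq nB; exact: dnbhs_at_right nB.
Qed.

(** On the curve of the points with affine coordinate t c, the constant of
    proportionality is identified by dividing by t the equations which define
    this coordinate. *)
Lemma affine_line_velocity e e' (phi : Er -> grassmannian k W)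
    (g : R -> Er) (h : Er) (c : R[i]) : basis_of fullv e -> basis_of fullv e' ->
  (forall z, gr_space (phi z) = graph_space e (to_complex z)) ->
  (fun t => t^-1 *: (g t - g 0)) @ 0^' --> h ->
  (\forall t \near 0, gr_space (phi (g t)) = line_space k r e' 1 (t%:C * c)) ->
  forall (a : 'I_k -> R[i]) j, (j < d - k)%N ->
    crd e' (k + j) (\sum_i a i *: velocity e (to_complex h) i) =
    if (j < r)%N then c * crd e' j (\sum_i a i *: frame e (to_complex (g 0)) i) else 0.
Proof.
move=> eB e'B phiE gh gE a j jd.
pose H t := t^-1 *: (g t - g 0).
pose w t := \sum_i a i *: frame e (to_complex (g t)) i.
pose z x := \sum_i a i *: velocity e (to_complex x) i.
have tn0 : (0 : R)^' [set t | t != 0].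
  by apply: (@filterE _ _ (nbhs_filter (0 : R))).
have wE t : t != 0 -> w t = w 0 + t%:C *: z (H t).
  move=> t0; have E : g t = g 0 + t *: H t.
    by rewrite scalerA divff // scale1r addrC subrK.
  rewrite /w /z E scaler_sumr -big_split /=; apply: eq_bigr => i _.
  by rewrite to_complexD to_complexZ frame_add scalerDr !scalerA [a i * _]mulrC.
have wU t : w t \in gr_space (phi (g t)) by rewrite phiE; apply/graph_span; exists a.
have wy0 : crd e' (k + j) (w 0) = 0.
  have := wU 0; rewrite (nbhs_singleton gE) mul0r => /(mem_affine r0 rk krd) -> //.
  by rewrite mul0r if_same.
have gc : g @ 0^' --> g 0 by apply: cvg_difference_quotient gh.
have wc n : (fun t => crd e' n (w t)) @ 0^' --> crd e' n (w 0).
  by apply: cvg_frame => // i; exact: cvg_cst.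
have zc n : (fun t => crd e' n (z (H t))) @ 0^' --> crd e' n (z h).
  by apply: cvg_velocity => // i; exact: cvg_cst.
have rc : (fun t => if (j < r)%N then c * crd e' j (w t) else 0) @ 0^' -->
    (if (j < r)%N then c * crd e' j (w 0) else 0 : R[i]).
  case: ifP => _; last exact: cvg_cst.
  by apply: cvgM; [exact: cvg_cst|exact: wc].
apply: (cvg_eq _ (zc (k + j)%N) rc).
have nE := nbhs_dnbhs gE.
apply: filterS2 nE tn0 => t tE t0.
apply: (mulfI (_ : t%:C != 0)); first by rewrite (inj_eq (@complexI R)).
have := wU t; rewrite tE => /(mem_affine r0 rk krd (t%:C * c) _ e'B)/(_ j jd).
rewrite [in X in X = _]wE // linearD linearZ /= wy0 add0r => ->.
by case: ifP; rewrite ?mulr0 // mulrA.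
Qed.

(** Every constant of proportionality is realised by a smooth curve of the line. *)
Lemma line_curve e e' (phi : Er -> grassmannian k W) (x : Er) (c : R[i]) :
  basis_of fullv e -> basis_of fullv e' ->
  (forall z, gr_space (phi z) = graph_space e (to_complex z)) ->
  gr_space (phi x) = line_space k r e' 1 0 ->
  exists g : R -> Er, [/\ smooth g 0, g 0 = x,
    \forall t \near 0, gr_space (phi (g t)) = line_space k r e' 1 (t%:C * c)
    & forall (a : 'I_k -> R[i]) j, (j < d - k)%N ->
    crd e' (k + j) (\sum_i a i *: velocity e (to_complex ('D_1 g 0)) i) =
    if (j < r)%N then c * crd e' j (\sum_i a i *: frame e (to_complex x) i) else 0].
Proof.
move=> eB e'B phiE xE.
pose b (i : 'I_k) := e'`_i; pose v (i : 'I_k) := if (i < r)%N then c *: e'`_(k + i) else 0.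
have lE t : line_space k r e' 1 (t%:C * c) = <<[seq (b i + t%:C *: v i)%R | i : 'I_k]>>%VS.
  rewrite /line_space; congr (<<_>>%VS); apply: eq_image => // i.
  by rewrite /line_vec /b /v; case: ifP; rewrite ?scaler0 ?addr0 // scale1r scalerA.
have [|g [gs g0 gE]] := @affine_curve _ _ _ kd e phi x b v eB phiE.
  rewrite xE -[0](mul0r c) lE; congr (<<_>>%VS); apply: eq_image => // i.
  by rewrite scale0r addr0.
have {}gE : \forall t \near 0, gr_space (phi (g t)) = line_space k r e' 1 (t%:C * c).
  by apply: filterS gE => t ->; rewrite lE.
exists g; split=> // a j jd; rewrite -g0.
by apply: affine_line_velocity => //; exact: smooth_quotient.
Qed.

End LineCurves.

(** * Complementary disks on a line *)

Section LineRegions.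
Context (R : realType) (W : vectType R[i]) (k r : nat).
Local Notation d := (\dim {:W}).
Local Notation line_space := (@line_space R W k r).
Local Notation swap := (@swap R W k r).
Local Notation Gr := (grassmannian k W).
Local Notation piece e T := (piece r e T : set Gr).
Local Notation D := (@unit_disk R).
Hypotheses (r0 : (0 < r)%N) (rk : (r <= k)%N) (krd : (k + r <= d)%N).
Implicit Types (e : d.-tuple W) (U : Gr) (s t : R[i]).

(** The pairs of coordinates of the vectors of a point are all proportional to
    (s, t), and (s, t) is one of them. *)
Lemma coordinates_line e s t U (a b : R) : basis_of fullv e ->
  (s != 0) || (t != 0) -> gr_space U = line_space e s t ->
  (forall w, w \in gr_space U -> 0 <= a * sqn (crd e 0 w) + b * sqn (crd e k w)) <->
  0 <= a * sqn s + b * sqn t.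
Proof.
move=> eB st UE; split=> [Uab|ab w].
  have := Uab (line_vec k r e s t 0); rewrite UE line_vec0_mem // => /(_ isT).
  by have [-> ->] := crd_line_vec0 r0 rk krd s t eB.
rewrite UE => /(mem_line r0 rk krd _ eB st)[/(_ 0 r0)+ _]; rewrite addn0.
move=> /(congr1 (@sqn R)); rewrite !sqnM; set x := crd e 0 w; set y := crd e k w => E.
case/orP: st => [s0|t0].
  have p : 0 < sqn s by rewrite lt_def sqn_ge0 sqn_eq0 s0.
  rewrite -(pmulr_rge0 _ p) mulrDr !(mulrCA (sqn s)) E.
  rewrite [X in _ + X]mulrA mulrA -mulrDl; apply: mulr_ge0; last exact: sqn_ge0.
  by [].
have p : 0 < sqn t by rewrite lt_def sqn_ge0 sqn_eq0 t0.
rewrite -(pmulr_rge0 _ p) mulrDr !(mulrCA (sqn t)) -E.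
rewrite [X in _ + X]mulrA mulrA -mulrDl; apply: mulr_ge0; last exact: sqn_ge0.
by [].
Qed.

Lemma piece_disk_line e U :
  piece e D U <-> exists s t, sqn t < sqn s /\ gr_space U = line_space e s t.
Proof.
split=> [[c c1 UE]|[s [t [ts UE]]]].
  by exists 1, c; rewrite sqn1.
have p : 0 < sqn s by apply: le_lt_trans ts; exact: sqn_ge0.
have s0 : s != 0 by rewrite -sqn_eq0 gt_eqF.
exists (t / s); last by rewrite UE line_div.
by rewrite /unit_disk /= sqnM sqnV ltr_pdivrMr // mul1r.
Qed.

Lemma swap_disk_line e U :
  piece (swap e) D U <-> exists s t, sqn s < sqn t /\ gr_space U = line_space e s t.
Proof.
split=> [/piece_disk_line|].
  by move=> [s [t [ts ->]]]; exists t, s; rewrite line_swap.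
by move=> [s [t [ts UE]]]; apply/piece_disk_line; exists t, s; rewrite line_swap.
Qed.

Lemma disks_disjoint e : basis_of fullv e -> piece e D `&` piece (swap e) D = set0.
Proof.
move=> eB; rewrite -subset0 => U [].
move=> /piece_disk_line[s [t [ts UE]]] /swap_disk_line[s' [t' [ts' UE']]].
have s0 : s != 0 by rewrite -sqn_eq0 gt_eqF // (le_lt_trans _ ts) ?sqn_ge0.
have t0 : t' != 0 by rewrite -sqn_eq0 gt_eqF // (le_lt_trans _ ts') ?sqn_ge0.
have st' : (s' != 0) || (t' != 0) by rewrite t0 orbT.
have := line_eq r0 rk krd eB (_ : (s != 0) || (t != 0)) st'.
rewrite s0 -UE -UE' => /(_ isT erefl)/(congr1 (@sqn R)); rewrite !sqnM => E.
have : sqn s' * sqn t < sqn t' * sqn s by apply: ltr_pM; rewrite ?sqn_ge0.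
by rewrite -E mulrC ltxx.
Qed.

Lemma disk_region e U : basis_of fullv e -> line r e U ->
  ~ (forall w, w \in gr_space U -> 0 <= -1 * sqn (crd e 0 w) + 1 * sqn (crd e k w)) ->
  piece e D U.
Proof.
move=> eB [s [t [st UE]]] nU; apply/piece_disk_line; exists s, t; split=> //.
rewrite ltNge; apply/negP => h; apply: nU; apply/(coordinates_line _ _ eB st UE).
by rewrite mulN1r mul1r addrC subr_ge0.
Qed.

(** The two disks are separated by the inequalities between |s| and |t|. *)
Lemma disk_component e x : basis_of fullv e -> piece e D x ->
  connected_component (piece e D `|` piece (swap e) D) x = piece e D.
Proof.
move=> eB ex.
have cl := @closed_coordinates R W k e 0%N k.
apply: (component_of_separated (cl 1 (-1)) (cl (-1) 1)) => //.
- move=> U [c c1 UE]; apply/(coordinates_line _ _ eB _ UE); first by rewrite oner_eq0.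
  by rewrite sqn1 mulr1 mulN1r subr_ge0 ltW.
- move=> U /swap_disk_line[s [t [ts UE]]].
  have t0 : t != 0 by rewrite -sqn_eq0 gt_eqF // (le_lt_trans _ ts) ?sqn_ge0.
  apply/(coordinates_line _ _ eB _ UE); first by rewrite t0 orbT.
  by rewrite mulN1r mul1r addrC subr_ge0 ltW.
- rewrite -subset0 => U [[c c1 UE]] /(coordinates_line _ _ eB _ UE).
  rewrite oner_eq0 => /(_ isT); rewrite sqn1 mulr1 mul1r addrC subr_ge0.
  by rewrite leNgt c1.
- rewrite -subset0 => U [] /swap_disk_line[s [t [ts UE]]].
  have t0 : t != 0 by rewrite -sqn_eq0 gt_eqF // (le_lt_trans _ ts) ?sqn_ge0.
  move/(coordinates_line _ _ eB _ UE); rewrite t0 orbT => /(_ isT).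
  by rewrite mulN1r mul1r subr_ge0 leNgt ts.
apply: piece_connected => // [|c s c1 /andP[s0 s1]].
  by rewrite /unit_disk /= /sqn /= expr0n addr0.
rewrite /unit_disk /= sqnM sqn_real; apply: le_lt_trans c1.
by rewrite ler_piMl ?sqn_ge0 // expr2 mulr_ile1.
Qed.

(** A point of the circle is the limit of a radius, and every other point of the
    line is in one of the two disks. *)
Lemma closure_disks e : basis_of fullv e ->
  closure (piece e D `|` piece (swap e) D) = line r e.
Proof.
move=> eB; apply/seteqP; split.
  have cl := zero_set_closed (zero_set_line (leq_trans (leq_addr r k) krd) r0 rk krd eB).
  rewrite [X in _ `<=` X](iffLR (closure_id _) cl); apply: closure_subset => U [].
    exact: piece_line.
  by move/piece_line; rewrite line_swapE.
move=> U [s [t [st UE]]].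
have [ts|st'|ts] := ltgtP (sqn t) (sqn s).
- by apply: subset_closure; left; apply/piece_disk_line; exists s, t.
- by apply: subset_closure; right; apply/swap_disk_line; exists s, t.
have s0 : s != 0.
  case/orP: st => // t0; rewrite -sqn_eq0 -ts sqn_eq0 //.
have c1 : sqn (t / s) = 1 by rewrite sqnM sqnV ts mulfV // sqn_eq0.
have [H HH [Hc HD]] := closure_unit_disk c1.
apply: closure_subset (_ : piece e D `<=` _) _ _; first by left.
by apply: (@piece_closure R W k r r0 rk krd e D _ U _ _ _ eB HH Hc HD); rewrite UE line_div.
Qed.

(** The points of the two open disks are regular points, dense in the closure. *)
Lemma analytic_curve_disks e : basis_of fullv e ->
  analytic_curve (gr_atlas k W) (closure (piece e D `|` piece (swap e) D)).
Proof.
move=> eB; have kd : (k <= d)%N := leq_trans (leq_addr _ _) krd.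
have main (f : d.-tuple W) : basis_of fullv f -> line r f = line r e :> set Gr -> piece f D `<=`
    [set p | submanifold_at (@holomorphic R) (gr_atlas k W) 1 (line r e) p].
  move=> fB fe p pD; apply: (piece_submanifold_at r0 rk krd fB (@open_unit_disk R)
    (@closed_coordinates R W k f 0%N k (-1) 1)) => //.
  apply/seteqP; split=> [U [UL nU]|U UD]; first by apply: (disk_region fB _ nU); rewrite fe.
  split; first by rewrite -fe; exact: piece_line UD.
  case: UD => c c1 UE /(coordinates_line _ _ fB _ UE).
  rewrite oner_eq0 => /(_ isT); rewrite sqn1 mulr1 mul1r addrC subr_ge0.
  by rewrite leNgt c1.
split; first by rewrite closure_disks //; exact: zero_set_analytic (zero_set_line kd r0 rk krd eB).
apply: closure_subset => U; rewrite closure_disks // => -[]; first exact: main.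
by apply: main; [exact: swap_basis|exact: line_swapE].
Qed.

End LineRegions.

(** * Lines of a real basis *)

Section RealBases.
Context (R : realType) (V : vectType R) (k : nat).
Local Notation VC := (complexification V).
Local Notation d := (\dim {:VC}).
Local Notation Er := ('M[R]_(k, d - k) * 'M[R]_(k, d - k))%type.
Local Notation Gr := (grassmannian k VC).
Hypotheses (k0 : (0 < k)%N) (kkd : (k + k <= d)%N).

Lemma real_vec_sum (J : Type) (s : seq J) (P : pred J) (F : J -> V) :
  real_vec (\sum_(i <- s | P i) F i) = \sum_(i <- s | P i) real_vec (F i).
Proof. by apply: (big_morph (@real_vec R V)) => // u v; congr pair; rewrite addr0. Qed.

Lemma complex_split (w : VC) : w = real_vec w.1 + 'i%C *: real_vec w.2.
Proof.
by case: w => u v; congr pair; rewrite /= !(scaler0, scale0r, scale1r, subr0, addr0, add0r).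
Qed.

Lemma span_real (X : seq V) v : v \in <<X>>%VS ->
  real_vec v \in <<[seq real_vec u | u <- X]>>%VS.
Proof.
rewrite -[X]/(val (in_tuple X)) => /coord_span ->; rewrite real_vec_sum.
apply: memv_suml => i _; rewrite real_vecZ memvZ // memv_span // map_f //.
by rewrite mem_nth // size_tuple.
Qed.

Variable e : d.-tuple VC.
Hypotheses (eB : basis_of fullv e) (eR : forall m, (e`_m).2 = 0).

(** The imaginary parts of the coordinates are the coefficients of a vanishing
    combination of the basis. *)
Lemma real_crd (w : VC) n : w.2 = 0 -> complex.Im (crd e n w) = 0.
Proof.
move=> w2; have [nd|dn] := ltnP n d; last by rewrite /crd insubN // -leqNgt.
suff : crd e n (\sum_(i < d) (complex.Im (crd e i w))%:C *: e`_i) = 0.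
  rewrite linear_sum (bigD1 (Ordinal nd)) //= linearZ /= crd_basis // eqxx mulr1.
  rewrite big1 ?addr0 => [[]//|i /negbTE ni].
  by rewrite linearZ /= crd_basis // -[n]/(val (Ordinal nd)) (inj_eq val_inj) ni mulr0.
suff -> : \sum_(i < d) (complex.Im (crd e i w))%:C *: e`_i = 0 by rewrite linear0.
rewrite -[RHS](_ : real_vec w.2 = 0); last by rewrite w2.
rewrite {2}(basis_sum (w : VC) eB) snd_sum real_vec_sum; apply: eq_bigr => i _.
by rewrite [e`_i]real_vecE // -real_vecZ; congr real_vec; rewrite /= scaler0 add0r.
Qed.

Lemma real_line_point (c : R) (U : Gr) : gr_space U = line_space k k e 1 c%:C ->
  exists2 v, v != 0 & real_vec v \in gr_space U.
Proof.
move=> UE; set w := line_vec k k e 1 c%:C 0.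
have w2 : w.2 = 0.
  by rewrite /w /line_vec k0 /= !eR !(scaler0, scale0r, addr0).
exists w.1; last by rewrite -real_vecE // UE line_vec0_mem.
rewrite -real_vec_eq0 -real_vecE //; apply/eqP => w0.
have [] := crd_line_vec0 k0 (leqnn k) kkd 1 c%:C eB; rewrite -/w w0 linear0.
by move/eqP; rewrite eq_sym oner_eq0.
Qed.

(** The real basis of the point that consists of the first k vectors of e also spans,
    over the real numbers, its real vectors. *)
Lemma real_line_dim (U : Gr) : gr_space U = line_space k k e 1 0 -> real_dim k U.
Proof.
move=> UE; pose o (i : 'I_k) := (e`_i).1.
have oE i : real_vec (o i) = line_vec k k e 1 0 i.
  by rewrite -real_vecE // /line_vec ltn_ord scale1r scale0r addr0.
have USo : gr_space U = <<[seq real_vec (o i) | i : 'I_k]>>%VS.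
  by rewrite UE /line_space; congr (<<_>>%VS); exact: eq_image.
exists <<[seq o i | i : 'I_k]>>%VS => [|v].
  have fr : free [tuple real_vec (o i) | i < k].
    by rewrite /free size_tuple -[X in \dim <<X>>]/([seq real_vec (o i) | i : 'I_k])
      -USo gr_dim.
  have -> : <<[seq o i | i : 'I_k]>>%VS = <<[tuple o i | i < k]>>%VS by [].
  suff /eqP -> : free [tuple o i | i < k] by rewrite size_tuple.
  apply/freeP => c c0 i.
  suff : (c i)%:C = 0 :> R[i] by case.
  have fr' := elimT freeP fr (fun i => (c i)%:C); apply: (fr' _ i).
  transitivity (real_vec (\sum_i c i *: o i)).
    rewrite real_vec_sum; apply: eq_bigr => j _.
    by rewrite -tnth_nth tnth_mktuple real_vecZ.
  rewrite -[RHS](_ : real_vec 0 = 0) //; congr real_vec; rewrite -[RHS]c0.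
  by apply: eq_bigr => j _; rewrite -tnth_nth tnth_mktuple.
rewrite USo; apply/mem_span_image/mem_span_image => [[a ->]|[a va]].
  exists (fun i => (a i)%:C); rewrite real_vec_sum.
  by apply: eq_bigr => i _; rewrite real_vecZ.
exists (fun i => complex.Re (a i)).
rewrite -[v]/((real_vec v).1) va fst_sum; apply: eq_bigr => i _.
by rewrite /= scaler0 subr0.
Qed.

(** A velocity in the tangent cone moves some nonzero real vector of the point
    within the real vectors, modulo the point; on the line it multiplies the
    coordinates by a constant c, which is then real. *)
Lemma real_line_tangent (L : set Gr) (phi : Er -> Gr) (x : Er) :
  (forall U, L U <-> exists2 v, v != 0 & real_vec v \in gr_space U) ->
  gr_real_atlas _ _ phi -> gr_space (phi x) = line_space k k e 1 0 ->
  tangent_space phi (line k e) x `&` tangent_cone phi L x =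
  tangent_space phi (line k e `&` L) x.
Proof.
move=> LP phiA xE; have [f fB phiE] := gr_real_atlasP phiA.
have kd : (k <= d)%N by exact: leq_trans (leq_addr _ _) kkd.
apply/seteqP; split; last first.
  move=> h hT; split; last by apply: tangent_space_smooth_cone hT => U [].
  by case: hT => g [gs g0 gZ gh]; exists g; split=> //; apply: filterS gZ => t [].
move=> h [[g [gs g0 gZ gh]] hC].
have [U /LP //|a [u0 u2 [q qx vq]]] := tangent_cone_real kd fB phiE _ hC.
have gq : (fun t => t^-1 *: (g t - g 0)) @ 0^' --> h by rewrite -gh; exact: smooth_quotient.
have g0E : gr_space (phi (g 0)) = line_space k k e 1 0 by rewrite g0.
have [c cE] := @line_velocity R VC k kd f e k phi (0 : R)^' _ g h k0 (leqnn k) kkd fB eB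
  phiE (fun _ => id) gq g0E (nbhs_dnbhs gZ).
rewrite g0 in cE; set u := \sum_i _ in u0 u2.
have mem0 w j : w \in gr_space (phi x) -> (j < d - k)%N -> crd e (k + j) w = 0.
  by rewrite xE => /(mem_affine k0 (leqnn k) kkd _ _ eB)/(_ j) + jd => -> //; rewrite mul0r if_same.
have ux : u \in gr_space (phi x) by rewrite phiE; apply/graph_span; exists a.
have [j jk uj] : exists2 j, (j < k)%N & crd e j u != 0.
  apply: contrapT => nj; move: u0; rewrite (@crd_inj _ _ e u 0) ?eqxx // => m md.
  rewrite linear0; have [mk|km] := ltnP m k; last by rewrite -(subnKC km) mem0 //; lia.
  by apply/eqP/negPn/negP => um; apply: nj; exists m.
have jd : (j < d - k)%N by lia.
have cR : complex.Im c = 0.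
  have ujR := real_crd j u2.
  pose v : VC := \sum_i a i *: velocity f (to_complex h) i.
  have vR : (v - q : VC).2 = 0 by rewrite /= vq subrr.
  have := real_crd (k + j) vR; rewrite linearB /= /v cE // jk (mem0 q) // subr0 -/u.
  case: (crd e j u) ujR uj => ur ui /= ->; case: (c) => cr ci /=.
  rewrite mulr0 add0r eq_complex /= eqxx andbT => ur0 /eqP.
  by rewrite mulf_eq0 (negbTE ur0) orbF => /eqP.
have cE' : c = (complex.Re c)%:C by case: (c) cR => cr ci /= ->.
have [g' [g's g'0 g'E vE]] := line_curve k0 (leqnn k) kkd c fB eB phiE xE.
exists g'; split; [exact: g's|exact: g'0| |]; last first.
  apply: (@velocity_inj _ _ k kd f e k x) => //; first by rewrite -phiE.
  by move=> b i id_; rewrite vE // cE.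
apply: filterS g'E => t tE; split.
  by exists 1, (t%:C * c); rewrite oner_eq0.
by apply/LP; apply: (@real_line_point (t * complex.Re c)); rewrite tE cE' -rmorphM.
Qed.

End RealBases.

(** * The curve S(I,Q) *)

Section IRCurve.
Context (R : realType) (n : nat) (V : vectType R).
Hypotheses (n_gt0 : (0 < n)%N) (dimV : \dim {:V} = (4 * n)%N).
Local Notation VC := (complexification V).
Local Notation d := (\dim {:VC}).
Local Notation k := (2 * n)%N.
Local Notation Gr := (grassmannian k VC).
Local Notation L := (real_locus dimV).

Let k0 : (0 < k)%N. Proof. by lia. Qed.
Let dE : d = (k + k)%N. Proof. by rewrite dim_complexification dimV; lia. Qed.
Let kkd : (k + k <= d)%N. Proof. by rewrite dE. Qed.

Variables (I : compl_structure V) (Q : 'End(V)).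
Hypothesis IQ : IR_pair I Q.

(** Q is diagonalisable with eigenvalues 1 and -1, and I exchanges the two
    eigenspaces. *)
Lemma IR_basis : exists (e : d.-tuple VC) (w : nat -> V), [/\ basis_of fullv e,
  forall i, (i < k)%N -> e`_i = real_vec (w i),
  forall i, (i < k)%N -> e`_(k + i) = real_vec (I (w i))
  & forall i, (i < k)%N -> Q (w i) = w i].
Proof.
case: IQ => QQ IQ0; have QK v : Q (Q v) = v by rewrite -comp_lfunE QQ id_lfunE.
have QI v : Q (I v) = - I (Q v).
  by apply/eqP; rewrite -addr_eq0 addrC -!comp_lfunE -add_lfunE IQ0 zero_lfunE.
pose A := lker (Q - \1)%VF.
have AP v : (v \in A) = (Q v == v).
  by rewrite memv_ker add_lfunE opp_lfunE id_lfunE subr_eq0.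
have IinjA v : I v = 0 -> v = 0.
  by move=> Iv; apply/eqP; rewrite -oppr_eq0 -(cs_opK I v) Iv linear0.
have AI : (A + cs_op I @: A)%VS = fullv.
  apply/eqP; rewrite eqEsubv subvf; apply/subvP => v _; pose h : R := 2^-1.
  have -> : v = h *: (v + Q v) + I (- (h *: I (v - Q v))).
    rewrite linearN /= linearZ /= cs_opK scalerN opprK -scalerDr addrACA subrr addr0.
    by rewrite -mulr2n -scaler_nat scalerA mulVf ?scale1r // pnatr_eq0.
  apply: memv_add; first by apply: memvZ; rewrite AP linearD /= QK addrC.
  apply: memv_img; rewrite rpredN memvZ // AP QI linearB /= QK.
  by rewrite -linearN /= opprB.
have AIcap : (A :&: cs_op I @: A = 0)%VS.
  apply/eqP; rewrite -subv0; apply/subvP => v; rewrite memv_cap memv0 => /andP[].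
  rewrite AP => /eqP Qv /memv_imgP[u]; rewrite AP => /eqP Qu vE.
  have : v = - v by rewrite -[LHS]Qv vE QI Qu.
  move/eqP; rewrite -addr_eq0 -mulr2n -scaler_nat scaler_eq0 pnatr_eq0 /=.
  by [].
have IA : \dim (cs_op I @: A) = \dim A.
  apply: limg_dim_eq; apply/eqP; rewrite -subv0; apply/subvP => v.
  by rewrite memv_cap memv_ker memv0 => /andP[_ /eqP/IinjA ->].
have dA : \dim A = k.
  by have := dimv_disjoint_sum AIcap; rewrite AI dimV IA; lia.
pose w i := (vbasis A)`_i.
pose X := (vbasis A : seq V) ++ [seq I u | u <- vbasis A].
have sX : size [seq real_vec u | u <- X] == d.
  by rewrite size_map size_cat size_map size_tuple dA dE.
have wA i : (i < k)%N -> w i \in A.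
  by move=> ik; apply: vbasis_mem; rewrite mem_nth // size_tuple dA.
exists (Tuple sX), w; split=> [|i ik|i ik|i ik].
- rewrite basisEdim size_tuple leqnn andbT; apply/subvP => z _.
  have spX v : v \in <<X>>%VS.
    have : v \in (A + cs_op I @: A)%VS by rewrite AI memvf.
    by rewrite span_cat -(limg_span (cs_op I)) !(span_basis (vbasisP _)).
  by rewrite [z]complex_split rpredD ?memvZ // span_real.
- rewrite (nth_map 0); last by rewrite size_cat size_map size_tuple dA; lia.
  by rewrite nth_cat size_tuple; have -> : (i < \dim A)%N by rewrite dA.
- rewrite (nth_map 0); last by rewrite size_cat size_map size_tuple dA; lia.
  rewrite nth_cat size_tuple; have -> : (k + i < \dim A)%N = false by rewrite dA; lia.
  have -> : (k + i - \dim A)%N = i by rewrite dA addKn.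
  by rewrite (nth_map 0) // size_tuple dA.
by apply/eqP; rewrite -AP wA.
Qed.

Section Basis.
Variables (e : d.-tuple VC) (w : nat -> V).
Hypotheses (eB : basis_of fullv e) (elow : forall i, (i < k)%N -> e`_i = real_vec (w i)).
Hypothesis ehigh : forall i, (i < k)%N -> e`_(k + i) = real_vec (I (w i)).
Hypothesis Qw : forall i, (i < k)%N -> Q (w i) = w i.

(** The change of basis is the Cayley transform: the real points of the line
    become the unit circle. *)
Definition disk_basis := mix k k 1 (0 -i* 1) 1 (0 +i* 1) e.

Lemma disk_basisB : basis_of fullv disk_basis.
Proof. by apply: mix_basis => //; rewrite mul1r mulr1 eq_complex /= opprK -[1 + 1]/(2%:R) pnatr_eq0 andbF. Qed.

Lemma disk_basis_line s t : line_space k k disk_basis s t =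
  line_space k k e (s + t) ('i%C * (t - s)).
Proof.
case: s t => [s s'] [t t']; rewrite line_mix //; congr line_space; rewrite ?mulr1 //.
by apply/eqP; rewrite eq_complex /=; apply/andP; split; apply/eqP; ring.
Qed.

(** For v = w_i, fixed by Q, the vector v - i J v is
    (1 - i y) w_i - i (x + z) I w_i. *)
Lemma period_IR_real (J : compl_structure V) (x y z : R) :
  J = x *: cs_op I + y *: Q + z *: (I \o Q)%VF :> 'End(V) ->
  gr_space (period dimV J) = line_space k k e (1 -i* y) (0 -i* (x + z)).
Proof.
move=> JE; have st : ((1 -i* y : R[i]) != 0) || ((0 -i* (x + z) : R[i]) != 0).
  by rewrite !eq_complex /= oner_eq0.
apply/esym/eqP; rewrite eqEdim gr_dim dim_line // leqnn andbT.
apply/span_subvP => _ /mapP[i _ ->]; rewrite /line_vec ltn_ord (elow (ltn_ord i)) (ehigh (ltn_ord i)).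
apply/mem_period_space; exists (w i).
rewrite JE !(add_lfunE, scale_lfunE, comp_lfunE) Qw //.
congr pair => /=; rewrite !(scaler0, scale0r, scale1r, subr0, addr0, add0r, sub0r, oppr0) //.
by rewrite scaleNr scaleNr scalerDl !opprD addrCA -addrA.
Qed.

Lemma period_IR_disk (J : compl_structure V) (x y z : R) :
  J = x *: cs_op I + y *: Q + z *: (I \o Q)%VF :> 'End(V) ->
  gr_space (period dimV J) =
  line_space k k disk_basis ((1 + x + z) -i* y) ((1 - x - z) -i* y).
Proof.
move=> JE; rewrite (period_IR_real JE) disk_basis_line.
have two0 : (2%:R : R[i]) != 0 by rewrite pnatr_eq0.
rewrite -(line_scale _ _ _ _ _ two0); congr line_space;
  by apply/eqP; rewrite eq_complex /=; apply/andP; split; apply/eqP; ring.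
Qed.

(** The coefficients x, y, z are rational in s and t, with denominator
    |s|^2 - |t|^2, which has the sign of x. *)
Lemma IR_range U : (period dimV @` S_IR I Q) U <->
  exists s t : R[i], sqn s != sqn t /\ gr_space U = line_space k k disk_basis s t.
Proof.
split=> [[J [x [y [z [xyz JE]]]] <-]|[s [t [st UE]]]].
  exists ((1 + x + z) -i* y), ((1 - x - z) -i* y); split; last exact: period_IR_disk.
  apply/eqP; rewrite /sqn /= => E.
  have xz : x + z = 0 by lra.
  have := xyz; have -> : x ^+ 2 - y ^+ 2 - z ^+ 2 = (x + z) * (x - z) - y ^+ 2 by ring.
  rewrite xz mul0r sub0r; have := sqr_ge0 y; lra.
case: s t st UE => [s1 s2] [t1 t2] st; rewrite disk_basis_line => UE.
set dl := sqn (s1 +i* s2) - sqn (t1 +i* t2).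
have dl0 : dl != 0 by rewrite subr_eq0.
(* In the basis e the point is [1 : (al - i dl) / P], and the period of the
   operator with coefficients x, y, z is [1 : (y - i) / (x - z)]. *)
pose al := 2 * (s2 * t1 - s1 * t2).
pose P := (s1 + t1) ^+ 2 + (s2 + t2) ^+ 2; pose P' := (s1 - t1) ^+ 2 + (s2 - t2) ^+ 2.
pose x := (P + P') / (2 * dl); pose z := (P' - P) / (2 * dl); pose y := al / dl.
have two0 : (2 : R) != 0 by rewrite pnatr_eq0.
have xyz : x ^+ 2 - y ^+ 2 - z ^+ 2 = 1.
  rewrite /x /y /z /al /P /P'; move: dl0; rewrite /dl /sqn /= => dl0; field.
  by rewrite dl0.
exists (ComplStructure (IR_pair_sqr IQ xyz)); first by exists x, y, z.
apply: gr_eq; rewrite (@period_IR_real _ x y z) // UE; apply: line_space_eq.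
- by rewrite !eq_complex /= oner_eq0.
- rewrite -negb_and; apply: contra_neqN dl0 => /andP[].
  rewrite !eq_complex /= !addr_eq0 => /andP[/eqP a1 /eqP a2] _.
  by rewrite /dl /sqn /= a1 a2 !sqrrN subrr.
apply/eqP; rewrite eq_complex /= /x /y /z /al /P /P'; move: dl0; rewrite /dl /sqn /= => dl0.
by apply/andP; split; apply/eqP; field; rewrite ?two0 ?dl0.
Qed.

Local Notation f := disk_basis.
Local Notation D := (@unit_disk R).
Local Notation S := (period dimV @` S_IR I Q).

Lemma IR_disks : S = piece k f D `|` piece k (swap k k f) D.
Proof.
apply/seteqP; split=> U.
  move=> /IR_range[s [t [st UE]]]; have [ts|st'|E] := ltgtP (sqn t) (sqn s).
  - by left; apply/piece_disk_line; exists s, t.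
  - by right; apply/(swap_disk_line (leqnn k) kkd); exists s, t.
  - by rewrite E eqxx in st.
case=> [/piece_disk_line|/(swap_disk_line (leqnn k) kkd)].
  by case=> s [t [ts UE]]; apply/IR_range; exists s, t; rewrite gt_eqF.
by case=> s [t [ts UE]]; apply/IR_range; exists s, t; rewrite lt_eqF.
Qed.

Lemma IR_center (J : compl_structure V) (x : R) : J = x *: cs_op I :> 'End(V) ->
  gr_space (period dimV J) = line_space k k f (1 + x)%:C (1 - x)%:C.
Proof.
move=> JE; rewrite (@period_IR_disk J x 0 0); last by rewrite !scale0r !addr0.
by rewrite !addr0 !subr0 oppr0.
Qed.

Lemma IR_two_disks : two_complex_disks dimV I S.
Proof.
have fB := disk_basisB; have sB := swap_basis (leqnn k) kkd fB.
have Ip : piece k f D (period dimV I).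
  apply/piece_disk_line; exists (1 + 1)%:C, (1 - 1)%:C.
  rewrite (@IR_center I 1) ?scale1r //; split=> //.
  by rewrite !sqn_real subrr expr0n /= exprn_gt0 //; lra.
have Im : piece k (swap k k f) D (period dimV (cs_opp I)).
  apply/(swap_disk_line (leqnn k) kkd); exists (1 - 1)%:C, (1 + 1)%:C.
  rewrite (@IR_center _ (-1)) ?scaleN1r // opprK; split=> //.
  by rewrite !sqn_real subrr expr0n /= exprn_gt0 //; lra.
have Cp := disk_component k0 (leqnn k) kkd fB Ip.
have Cm := disk_component k0 (leqnn k) kkd sB Im.
rewrite swapK // setUC in Cm.
rewrite /two_complex_disks IR_disks Cp Cm; split=> //.
- by rewrite -IR_disks => U [J _ <-]; exists J.
- exact: disks_disjoint.
- exact: unit_disk_piece.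
- exact: unit_disk_piece.
Qed.

Lemma IR_closure : closure S = line k f.
Proof. by rewrite IR_disks closure_disks //; exact: disk_basisB. Qed.

Lemma IR_analytic_curve : analytic_curve (gr_atlas k VC) (closure S).
Proof. by rewrite IR_disks; apply: analytic_curve_disks => //; exact: disk_basisB. Qed.

Lemma IR_basis_real m : (e`_m).2 = 0.
Proof.
have [mk|km] := ltnP m k; first by rewrite elow.
have [md|dm] := ltnP m d; last by rewrite nth_default ?size_tuple.
by rewrite -(subnKC km) ehigh //; lia.
Qed.

(** A point on the circle is the real span of the vectors (s + t I) w_i, and the
    line is the one of the rotated real basis. *)
Lemma IR_circle_basis (U : Gr) (c : R[i]) :
  sqn c = 1 -> gr_space U = line_space k k f 1 c ->
  exists g : d.-tuple VC, [/\ basis_of fullv g, forall m, (g`_m).2 = 0,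
    line k g = line k f :> set Gr & gr_space U = line_space k k g 1 0].
Proof.
case: c => c1 c2; rewrite /sqn disk_basis_line /= => c1E UE.
have [s0 [t0 [st stE]]] : exists s0 t0 : R, s0 ^+ 2 + t0 ^+ 2 != 0 /\
    gr_space U = line_space k k e s0%:C t0%:C.
  have [c10|c10] := eqVneq (1 + c1) 0.
    have c20 : c2 = 0 by apply/eqP; rewrite -sqrf_eq0; apply/eqP; nra.
    exists 0, 1; rewrite expr0n expr1n add0r oner_eq0; split=> //.
    rewrite UE; apply: line_space_eq.
    - rewrite !eq_complex /= c20; apply/orP; right; apply/nandP; right; lra.
    - by rewrite oner_eq0 orbT.
    - by apply/eqP; rewrite eq_complex /= c20; apply/andP; split; apply/eqP; lra.
  (* Multiplication by 1 + c^* makes the two homogeneous coordinates real. *)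
  exists (1 + c1), (- c2); split.
    by rewrite paddr_eq0 ?sqr_ge0 // sqrf_eq0 (negbTE c10).
  rewrite UE; apply: line_space_eq.
  - by rewrite eq_complex /= (negbTE c10).
  - by rewrite eq_complex /= (negbTE c10).
  - by apply/eqP; rewrite eq_complex /=; apply/andP; split; apply/eqP; nra.
have det : s0%:C * s0%:C - t0%:C * (- t0)%:C != 0 :> R[i].
  by rewrite -!rmorphM -rmorphB /= mulrN opprK -!expr2 (inj_eq (@complexI R)).
exists (mix k k s0%:C t0%:C (- t0)%:C s0%:C e); split.
- exact: mix_basis.
- move=> m; have [md|dm] := ltnP m d; last by rewrite nth_default ?size_tuple.
  rewrite nth_mix // /mix_vec; case: ifP => _; first by rewrite /= !IR_basis_real !scaler0 !scale0r !addr0.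
  by case: ifP => _; rewrite /= !IR_basis_real ?scaler0 ?scale0r ?addr0.
- rewrite line_mixE // /disk_basis line_mixE //.
  by rewrite mul1r mulr1 eq_complex /= opprK -[1 + 1]/(2%:R) pnatr_eq0 andbF.
- by rewrite line_mix // !mul1r !mul0r !addr0.
Qed.

Lemma IR_circle : closure S `&` L = piece k f [set c | sqn c = 1].
Proof.
apply/seteqP; split=> U; rewrite IR_closure.
  move=> [[s [t [st UE]]] UL]; have [E|ne] := eqVneq (sqn s) (sqn t).
    have s0 : s != 0 by case/orP: st => // t0; rewrite -sqn_eq0 E sqn_eq0.
    by exists (t / s); [rewrite /= sqnM sqnV -E mulfV ?sqn_eq0|rewrite UE line_div].
  by case: UL; have /IR_range[J _ <-] : exists s t : R[i],
    sqn s != sqn t /\ gr_space U = line_space k k f s t; [exists s, t|exists J].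
move=> Uc; split; first exact: piece_line Uc.
case: Uc => c c1 UE; have [g [gB gR _ Ug]] := IR_circle_basis c1 UE.
by apply/real_locusP; apply: (real_line_point k0 kkd gB gR (c := 0)).
Qed.

Lemma IR_circle_real_dim : closure S `&` L `<=` [set U | real_dim k U].
Proof.
rewrite IR_circle => U [c c1 UE]; have [g [gB gR _ Ug]] := IR_circle_basis c1 UE.
exact: real_line_dim gR _ Ug.
Qed.

Lemma IR_tangent phi x : gr_real_atlas k VC phi -> (closure S `&` L) (phi x) ->
  tangent_space phi (closure S) x `&` tangent_cone phi L x =
  tangent_space phi (closure S `&` L) x.
Proof.
move=> phiA; rewrite IR_circle => -[c c1 UE].
have [g [gB gR gf Ug]] := IR_circle_basis c1 UE.
rewrite -IR_circle IR_closure -gf; apply: (real_line_tangent k0 kkd gB gR) => // U.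
exact: real_locusP.
Qed.

End Basis.

Lemma IR_curve :
  let S := period dimV @` S_IR I Q in
  [/\ two_complex_disks dimV I S, analytic_curve (gr_atlas k VC) (closure S)
  & let S1 := closure S `&` L in
    [/\ is_P1 (closure S), is_analytic_circle S1, S1 `<=` [set U | real_dim k U]
    & forall phi x, gr_real_atlas k VC phi -> S1 (phi x) ->
        tangent_space phi (closure S) x `&` tangent_cone phi L x =
        tangent_space phi S1 x]].
Proof.
have [e [w [eB elow ehigh Qw]]] := IR_basis; rewrite /=; split.
- exact: (IR_two_disks eB elow ehigh Qw).
- exact: (IR_analytic_curve eB elow ehigh Qw).
split.
- rewrite (IR_closure eB elow ehigh Qw); apply: line_is_P1 => //; exact: disk_basisB.
- rewrite (IR_circle eB elow ehigh Qw); apply: circle_piece => //; exact: disk_basisB.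
- exact: (IR_circle_real_dim eB elow ehigh Qw).
- exact: (IR_tangent eB elow ehigh Qw).
Qed.

Lemma real_dim_real_locus : [set U : Gr | real_dim k U] `<=` L.
Proof.
move=> U [A dA AU]; apply/real_locusP.
have A0 : A != 0%VS by rewrite -dimv_eq0 dA; lia.
by exists (vpick A); rewrite ?vpick0 // -AU memv_pick.
Qed.

End IRCurve.

(** * Unions of two lines *)

Section AffinePieces.
Context (R : realType) (W : vectType R[i]) (k : nat).
Local Notation d := (\dim {:W}).
Local Notation Gr := (grassmannian k W).
Implicit Types (e : d.-tuple W) (U : Gr) (s t : R[i]).

(** The missing point is the limit of the affine line at infinity, as seen in the
    exchanged homogeneous coordinates. *)
Lemma closure_affine r e : (0 < r)%N -> (r <= k)%N -> (k + r <= d)%N -> basis_of fullv e ->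
  closure (piece r e setT : set Gr) = line r e.
Proof.
move=> r0 rk krd eB; have kd : (k <= d)%N := leq_trans (leq_addr _ _) krd.
apply/seteqP; split.
  have cl := zero_set_closed (zero_set_line kd r0 rk krd eB).
  by rewrite [X in _ `<=` X](iffLR (closure_id _) cl); apply: closure_subset; exact: piece_line.
move=> U [s [t [st UE]]]; have [s0|s0] := eqVneq s 0; last first.
  by apply: subset_closure; exists (t / s) => //; rewrite UE line_div.
have t0 : t != 0 by move: st; rewrite s0 eqxx.
have sub : (piece r (swap k r e) [set c | c != 0] : set Gr) `<=` piece r e setT.
  by move=> U' [c c0 U'E]; exists c^-1 => //; rewrite U'E line_swap // line_div // mul1r.
apply: closure_subset sub _ _; have sB := swap_basis rk krd eB.
have cc : (fun x : R => x%:C : R[i]) @ 0^' --> (0 : R)%:C.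
  by apply: cvg_real_complex; move=> A nA; exact: nbhs_dnbhs.
apply: (@piece_closure R W k r r0 rk krd _ _ _ U _ _ _ sB _ cc).
  by apply: (@filterE _ _ (nbhs_filter (0 : R))) => x x0; rewrite /= (inj_eq (@complexI R)).
by rewrite line_swap // UE s0 -(line_scale k r e 0 1 t0) mulr0 mulr1.
Qed.

Lemma affine_connected r e : (0 < r)%N -> (r <= k)%N -> (k + r <= d)%N ->
  basis_of fullv e -> connected (piece r e setT : set Gr).
Proof. by move=> r0 rk krd eB; exact: piece_connected. Qed.

(** Each affine line is open in the union: its complement there is the closed set
    made of the other line and of the subspaces whose coordinate x_0 vanishes. *)
Lemma analytic_curve_lines r r' e e' : (0 < r)%N -> (r <= k)%N -> (k + r <= d)%N ->
  (0 < r')%N -> (r' <= k)%N -> (k + r' <= d)%N -> basis_of fullv e -> basis_of fullv e' ->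
  (piece r e setT : set Gr) `&` line r' e' = set0 ->
  (piece r' e' setT : set Gr) `&` line r e = set0 ->
  analytic_curve (gr_atlas k W)
    (closure ((piece r e setT : set Gr) `|` piece r' e' setT)).
Proof.
move=> r0 rk krd r0' rk' krd' eB eB' ee' e'e.
have kd : (k <= d)%N := leq_trans (leq_addr _ _) krd.
have zl := zero_set_line kd r0 rk krd eB; have zl' := zero_set_line kd r0' rk' krd' eB'.
have main q q' (f f' : d.-tuple W) : (0 < q)%N -> (q <= k)%N -> (k + q <= d)%N ->
    basis_of fullv f -> closed (line q' f' : set Gr) ->
    (piece q f setT : set Gr) `&` line q' f' = set0 -> piece q f setT `<=`
    [set p | submanifold_at (@holomorphic R) (gr_atlas k W) 1
       ((line q f : set Gr) `|` line q' f') p].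
  move=> q0 qk kqd fB cl' ff' p pD.
  apply: (piece_submanifold_at q0 qk kqd fB (@openT _) (closedU cl'
    (@closed_coordinates R W k f 0%N k (-1) 0))) => //.
  apply/seteqP; split=> [U [[UL|UL'] nU]|U UD]; [|by case: nU; left|].
    case: UL => s [t [st UE]]; have [s0|s0] := eqVneq s 0.
      case: nU; right; apply/(coordinates_line q0 qk kqd _ _ fB st UE).
      by rewrite mul0r addr0 s0 /sqn /= expr0n addr0 mulr0.
    by exists (t / s) => //; rewrite UE line_div.
  split; first by left; exact: piece_line UD.
  case=> [UL'|]; first by have : (piece q f setT `&` line q' f') U by []; rewrite ff'.
  case: UD => c _ UE /(coordinates_line q0 qk kqd _ _ fB _ UE).
  by rewrite oner_eq0 => /(_ isT); rewrite sqn1 mul0r addr0 mulr1; lra.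
rewrite closureU !closure_affine //; split; first exact: zero_set_analytic (zero_setU zl zl').
rewrite -!closure_affine // -closureU; apply: closure_subset.
rewrite closureU !closure_affine // => U [].
  by apply: main => //; exact: zero_set_closed zl'.
by rewrite setUC; apply: main => //; exact: zero_set_closed zl.
Qed.

End AffinePieces.

(** * Eigenspaces of a complex structure *)

Section Eigenspaces.
Context (R : realType) (V : vectType R).
Local Notation VC := (complexification V).
Implicit Types (I J : compl_structure V).

(** As an eigenspace, the period space is easy to follow under the operators which
    anticommute with J. *)
Lemma mem_period_eigen J w : (w \in period_space J) = (complexify J w == 'i%C *: w).
Proof.
apply/idP/eqP => [/(mem_period_space J)[v ->]|].
  rewrite complexifyE; congr pair => /=;
  rewrite !(scaler0, scale0r, scale1r, subr0, addr0, add0r, sub0r, oppr0) //.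
    by rewrite opprK.
  by rewrite linearN /= cs_opK opprK.
case: w => u v; rewrite complexifyE => -[] /=; rewrite !(scale0r, scale1r, sub0r, add0r).
move=> Ju _; apply/(mem_period_space J); exists u; rewrite Ju.
by congr pair; rewrite /= !(scaler0, scale0r, scale1r, subr0, addr0, sub0r, opprK, oppr0, add0r).
Qed.

Lemma complexify_opp (f : 'End(V)) w : complexify (- f) w = - complexify f w.
Proof. by rewrite !complexifyE !opp_lfunE. Qed.

Lemma period_opp_opp I : period_space (cs_opp (cs_opp I)) = period_space I.
Proof. by rewrite /= opprK. Qed.

Lemma period_cap I w : w \in period_space I -> w \in period_space (cs_opp I) -> w = 0.
Proof.
rewrite !mem_period_eigen complexify_opp => /eqP -> /eqP/esym/eqP.
rewrite -addr_eq0 -scalerDl scaler_eq0 => /orP[|/eqP //].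
by rewrite eq_complex /= -[1 + 1]/(2%:R) pnatr_eq0 andbF.
Qed.

Lemma complexify_sqr I w : complexify I (complexify I w) = - w.
Proof. by rewrite !complexifyE /= !cs_opK. Qed.

Lemma period_split I w : exists w' w'', [/\ w' \in period_space I,
  w'' \in period_space (cs_opp I) & w = w' + w''].
Proof.
pose h : R[i] := 2^-1; pose z := 'i%C *: complexify I w.
exists (h *: (w - z)), (h *: (w + z)); split.
- apply: memvZ; rewrite mem_period_eigen linearB /= linearZ /= complexify_sqr.
  by rewrite scalerBr scalerA -expr2 sqr_i scaleN1r opprK scalerN opprK addrC.
- apply: memvZ; rewrite mem_period_eigen complexify_opp linearD /= linearZ /= complexify_sqr.
  by rewrite scalerDr scalerA -expr2 sqr_i scaleN1r scalerN opprB.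
rewrite -scalerDr addrACA [- z + z]addrC subrr addr0 -mulr2n -scaler_nat scalerA mulVf ?scale1r //.
Qed.

Section Nilpotent.
Variables (N : 'End(V)).
Local Notation NC := (complexify N).

Lemma IN_opp I : IN_pair I N -> IN_pair (cs_opp I) N.
Proof.
case=> NN N0 IN; split=> //; apply/lfunP => v.
rewrite add_lfunE !comp_lfunE zero_lfunE /= !opp_lfunE linearN /= -opprD -!comp_lfunE.
by rewrite -add_lfunE IN zero_lfunE oppr0.
Qed.

Lemma nil_sqr I w : IN_pair I N -> NC (NC w) = 0.
Proof.
by case=> NN _ _; rewrite !complexifyE /= -!comp_lfunE NN !zero_lfunE.
Qed.

Lemma nil_swap I w : IN_pair I N -> w \in period_space I -> NC w \in period_space (cs_opp I).
Proof.
move=> [_ _ IN]; rewrite !mem_period_eigen complexify_opp => /eqP wI.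
have -> : complexify I (NC w) = - NC (complexify I w).
  rewrite !complexifyE /=; congr pair; apply/eqP;
    by rewrite -addr_eq0 -!comp_lfunE -add_lfunE IN zero_lfunE.
by rewrite opprK wI linearZ.
Qed.

Lemma nil_swap_opp I w : IN_pair I N -> w \in period_space (cs_opp I) -> NC w \in period_space I.
Proof. by move=> /IN_opp/nil_swap + wI => /(_ _ wI); rewrite period_opp_opp. Qed.

End Nilpotent.
End Eigenspaces.

(** * The two lines of S(I,N) *)

Section NilpotentBasis.
Context (R : realType) (n : nat) (V : vectType R).
Hypothesis dimV : \dim {:V} = (4 * n)%N.
Local Notation VC := (complexification V).
Local Notation d := (\dim {:VC}).
Local Notation k := (2 * n)%N.
Implicit Types (I : compl_structure V) (N : 'End(V)).

(** Write V' for the i-eigenspace of I and V'' for the other one; N exchanges them.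
    The e_i for i < r span a complement of the kernel of N in V', the e_i for
    r <= i < k span that kernel, and V'' is spanned by the N e_i for i < r,
    followed by arbitrary vectors. The point [1 : c] of the line of this basis is
    then the image of V' under 1 + c N. *)
Record nil_basis I N r (e : d.-tuple VC) : Prop := NilBasis {
  nilr_gt0 : (0 < r)%N;
  nilr_le : (r <= k)%N;
  nil_basisB : basis_of fullv e;
  nil_low : forall i, (i < k)%N -> e`_i \in period_space I;
  nil_high : forall i, (k <= i < d)%N -> e`_i \in period_space (cs_opp I);
  nil_shift : forall i, (i < r)%N -> complexify N e`_i = e`_(k + i);
  nil_kill : forall i, (r <= i < k)%N -> complexify N e`_i = 0;
  nil_kernel : forall w, w \in period_space I -> complexify N w = 0 ->
    w \in line_space k r e 0 1 }.

Lemma nil_basis_ex I N : IN_pair I N -> exists r (e : d.-tuple VC), nil_basis I N r e.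
Proof.
move=> IN; have dE : d = (k + k)%N by rewrite dim_complexification dimV; lia.
have dp (J : compl_structure V) : \dim (period_space J) = k by have := gr_dim (period dimV J).
pose NC := complexify N; pose Vp := period_space I; pose Vm := period_space (cs_opp I).
pose A := (Vp :&: lker NC)%VS; pose B := (Vp :\: lker NC)%VS.
pose C := (NC @: B)%VS; pose E := (Vm :\: C)%VS; pose r := \dim B.
have BA : (B + A)%VS = Vp by exact: addv_diff_cap.
have BAk : (r + \dim A)%N = k by rewrite -(dp I) -(dimv_cap_compl Vp (lker NC)) addnC.
have BVp : (B <= Vp)%VS by exact: diffvSl.
have Binj : (B :&: lker NC = 0)%VS by exact: capv_diff.
have dC : \dim C = r by exact: limg_dim_eq.
have CVm : (C <= Vm)%VS.
  apply/subvP => _ /memv_imgP[w wB ->]; apply: nil_swap IN _; exact: (subvP BVp).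
have CE : (C + E)%VS = Vm by have := addv_diff_cap Vm C; rewrite (capv_idPr CVm) addvC.
have dCE : (r + \dim E)%N = k.
  by have := dimv_cap_compl Vm C; rewrite (capv_idPr CVm) dC (dp (cs_opp I)).
pose X := (vbasis B : seq VC) ++ vbasis A ++ [seq NC u | u <- vbasis B] ++ vbasis E.
have sX : size X == d by rewrite !size_cat size_map !size_tuple -/r; lia.
pose e := Tuple sX.
have low1 i : (i < r)%N -> e`_i = (vbasis B)`_i.
  by move=> ir; rewrite /= nth_cat size_tuple -/r ir.
have low2 i : (r <= i < k)%N -> e`_i = (vbasis A)`_(i - r).
  move=> ir; rewrite /= nth_cat size_tuple -/r ifF; last by lia.
  by rewrite nth_cat size_tuple ifT //; lia.
have high1 i : (i < r)%N -> e`_(k + i) = NC (vbasis B)`_i.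
  move=> ir; rewrite /= nth_cat size_tuple -/r ifF; last by lia.
  rewrite nth_cat size_tuple ifF; last by lia.
  have -> : (k + i - r - \dim A = i)%N by lia.
  by rewrite nth_cat size_map size_tuple -/r ir (nth_map 0) // size_tuple.
have high2 i : (k + r <= i < d)%N -> e`_i = (vbasis E)`_(i - k - r).
  move=> ir; rewrite /= nth_cat size_tuple -/r ifF; last by lia.
  rewrite nth_cat size_tuple ifF; last by lia.
  rewrite nth_cat size_map size_tuple -/r ifF; last by lia.
  by congr (_`_ _); lia.
have inB i : (i < r)%N -> (vbasis B)`_i \in B.
  by move=> ir; apply: vbasis_mem; rewrite mem_nth // size_tuple.
have inA i : (r <= i < k)%N -> (vbasis A)`_(i - r) \in A.
  by move=> ir; apply: vbasis_mem; rewrite mem_nth // size_tuple; lia.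
have inE i : (k + r <= i < d)%N -> (vbasis E)`_(i - k - r) \in E.
  by move=> ir; apply: vbasis_mem; rewrite mem_nth // size_tuple; lia.
exists r, e; split.
- rewrite lt0n; apply/eqP => r0; have [NN N0 _] := IN; case/eqP: N0.
  have B0 : B = 0%VS by apply/eqP; rewrite -dimv_eq0 -/r r0.
  have VpK w : w \in Vp -> NC w = 0.
    by rewrite -BA B0 add0v memv_cap memv_ker => /andP[_ /eqP].
  apply/lfunP => v; have vI : real_vec v - 'i%C *: real_vec (I v) \in Vp.
    by apply/(mem_period_space I); exists v.
  have := VpK _ vI; rewrite /NC complexifyE => -[] /=; rewrite zero_lfunE.
  by rewrite !(scaler0, scale0r, subr0, oppr0, addr0).
- by rewrite -BAk leq_addr.
- rewrite basisEdim size_tuple leqnn andbT; apply/subvP => w _.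
  rewrite /= !span_cat -limg_span !(span_basis (vbasisP _)) -/C CE addvA BA.
  by have [w' [w'' [w'I w''I ->]]] := period_split I w; apply: memv_add.
- move=> i ik; have [ir|ri] := ltnP i r; first by rewrite low1 // (subvP BVp) // inB.
  have rik : (r <= i < k)%N by rewrite ri.
  by rewrite low2 //; have := inA i rik; rewrite memv_cap => /andP[].
- move=> i ikd; have [ir|ri] := ltnP i (k + r).
    have -> : i = (k + (i - k))%N by lia.
    have ikr : (i - k < r)%N by lia.
    by rewrite high1 // (subvP CVm) // memv_img // inB.
  have rid : (k + r <= i < d)%N by lia.
  by rewrite high2 // (subvP (diffvSl Vm C)) // inE.
- by move=> i ir; rewrite high1 // low1.
- by move=> i ir; rewrite low2 //; have := inA i ir; rewrite memv_cap memv_ker => /andP[_ /eqP].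
move=> w wVp Nw; have : w \in A by rewrite memv_cap wVp memv_ker Nw eqxx.
apply: subvP; rewrite -(span_basis (vbasisP A)).
apply/span_subvP => _ /(nthP 0)[j + <-]; rewrite size_tuple => jA.
have jk : (r + j < k)%N by lia.
have -> : (vbasis A)`_j = line_vec k r e 0 1 (r + j).
  by rewrite /line_vec ltnNge leq_addr /= low2 ?leq_addr // addKn.
by apply: memv_span; apply/mapP; exists (Ordinal jk); rewrite ?mem_enum.
Qed.

End NilpotentBasis.

Section NilpotentLine.
Context (R : realType) (n : nat) (V : vectType R).
Hypothesis dimV : \dim {:V} = (4 * n)%N.
Local Notation VC := (complexification V).
Local Notation d := (\dim {:VC}).
Local Notation k := (2 * n)%N.
Local Notation Gr := (grassmannian k VC).
Local Notation L := (real_locus dimV).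
Local Notation Er := ('M[R]_(k, d - k) * 'M[R]_(k, d - k))%type.
Implicit Types (I J : compl_structure V) (N : 'End(V)).

(** One component of S(I,N); the other one is obtained by changing the sign of I. *)
Definition S_affine I N : set (compl_structure V) :=
  [set J | exists y z : R, J = cs_op I + y *: N + z *: (I \o N)%VF :> 'End(V)].

Lemma S_IN_affine I N : S_IN I N = S_affine I N `|` S_affine (cs_opp I) N.
Proof.
apply/seteqP; split=> [J [[] [y [z JE]]]|J [[y [z JE]]|[y [z JE]]]].
- by right; exists y, (- z); rewrite JE /= expr1 scaleN1r comp_lfunNl scalerN scaleNr opprK.
- by left; exists y, z; rewrite JE expr0 scale1r.
- by exists false, y, z; rewrite JE expr0 scale1r.
- by exists true, y, (- z); rewrite JE /= expr1 scaleN1r comp_lfunNl scalerN scaleNr.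
Qed.

Lemma affine_nil I N J v : IN_pair I N -> S_affine I N J -> N (J v) = N (I v).
Proof.
case=> NN _ IN [y [z ->]]; have NK u : N (N u) = 0 by rewrite -comp_lfunE NN zero_lfunE.
have NI u : N (I u) = - I (N u).
  by apply/eqP; rewrite -addr_eq0 addrC -!comp_lfunE -add_lfunE IN zero_lfunE.
rewrite !(add_lfunE, scale_lfunE, comp_lfunE) !linearD !linearZ /= NK [N (I (N v))]NI.
have I0 : I 0 = 0 by rewrite linear0.
by rewrite NK I0 oppr0 !scaler0 !addr0.
Qed.

(** N J = N I on the first family and N J = - N I on the second one. *)
Lemma affine_disjoint I N : IN_pair I N ->
  (period dimV @` S_affine I N) `&` (period dimV @` S_affine (cs_opp I) N) = set0.
Proof.
move=> IN; rewrite -subset0 => U [[J JI <-] [J' J'I JJ']].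
have E v : J v = J' v.
  have : real_vec v - 'i%C *: real_vec (J v) \in period_space J'.
    rewrite -[period_space J']/(gr_space (period dimV J')) JJ'.
    by apply/(mem_period_space J); exists v.
  move=> /(mem_period_space J')[v' /(congr1 (fun w => (w.1, w.2)))] /=.
  rewrite !(scaler0, scale0r, scale1r, subr0, addr0, sub0r, oppr0, add0r).
  by case=> -> /oppr_inj.
have [_ /eqP N0 _] := IN; apply: N0; apply/lfunP => u; rewrite zero_lfunE.
have NI0 v : N (I v) = 0.
  have := affine_nil v IN JI; rewrite E (affine_nil v (IN_opp IN) J'I) /= opp_lfunE linearN.
  move/eqP; rewrite eq_sym -addr_eq0 -mulr2n -scaler_nat scaler_eq0 pnatr_eq0.
  by move/eqP.
by rewrite -[u]opprK -(cs_opK I u) linearN /= NI0 oppr0.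
Qed.

Section Basis.
Variables (I : compl_structure V) (N : 'End(V)) (r : nat) (e : d.-tuple VC).
Hypotheses (IN : IN_pair I N) (eN : nil_basis n I N r e).
Local Notation NC := (complexify N).
Local Notation Vp := (period_space I).
Local Notation Vm := (period_space (cs_opp I)).
Local Notation P := (line_space k r e 0 1).

Let dE : d = (k + k)%N. Proof. by rewrite dim_complexification dimV; lia. Qed.
Let r0 : (0 < r)%N. Proof. exact: nilr_gt0 eN. Qed.
Let rk : (r <= k)%N. Proof. exact: nilr_le eN. Qed.
Let krd : (k + r <= d)%N. Proof. by rewrite dE leq_add2l. Qed.
Let eB : basis_of fullv e. Proof. exact: nil_basisB eN. Qed.

Lemma nil_point_kill w : w \in P -> NC w = 0.
Proof.
move=> wP; apply/eqP; rewrite -memv_ker; apply: subvP wP.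
apply/span_subvP => _ /mapP[i _ ->]; rewrite memv_ker /line_vec; case: ifP => ir.
  by rewrite scale0r add0r scale1r -(nil_shift eN ir) (nil_sqr _ IN).
by rewrite (nil_kill eN) // ltn_ord andbT leqNgt ir.
Qed.

(** The image of V' is spanned by the e_(k + i) for i < r, and the image of V'' lies
    in the kernel of N in V'. *)
Lemma nil_image w : NC w \in P.
Proof.
rewrite (basis_sum w eB) linear_sum; apply: memv_suml => i _; rewrite linearZ memvZ //=.
have [ik|ki] := ltnP i k; last first.
  apply: (nil_kernel eN); last exact: (nil_sqr _ IN).
  by apply: (nil_swap_opp IN); apply: (nil_high eN); rewrite ki ltn_ord.
have [ir|ri] := ltnP i r; last by rewrite (nil_kill eN) ?mem0v // ri.
rewrite (nil_shift eN ir); have := @line_vec_mem _ _ k r e 0 1 i ik.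
by rewrite /line_vec ir scale0r add0r scale1r.
Qed.

Lemma nil_point_high w : w \in P -> w \in Vm -> exists b, w = NC b.
Proof.
move=> /mem_span_image[a wE] wm; pose b := \sum_(i < k | (i < r)%N) a i *: e`_i.
have bE : NC b = \sum_(i < k | (i < r)%N) a i *: e`_(k + i).
  by rewrite linear_sum; apply: eq_bigr => i ir; rewrite linearZ /= (nil_shift eN ir).
exists b; apply/eqP; rewrite -subr_eq0; apply/eqP; apply: (@period_cap _ _ I).
  rewrite wE bE (bigID (fun i : 'I_k => (i < r)%N)) /= addrAC.
  rewrite -sumrB big1 => [|i ir]; last first.
    by rewrite /line_vec ir scale0r add0r scale1r subrr.
  rewrite add0r; apply: memv_suml => i ri; rewrite /line_vec (negbTE ri) memvZ //.
  exact: (nil_low eN).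
apply: rpredB => //; apply: (nil_swap IN); apply: memv_suml => i _; apply: memvZ.
exact: (nil_low eN).
Qed.

(** For a in the i-eigenspace of I, the vector a + c N a is an eigenvector of
    I + y N + z I N for the eigenvalue i as soon as 2 i c = y - i z. *)
Lemma nil_period J (y z : R) : J = cs_op I + y *: N + z *: (I \o N)%VF :> 'End(V) ->
  gr_space (period dimV J) = line_space k r e 1 ((- z / 2) -i* (y / 2)).
Proof.
move=> JE; set c := _ -i* _; apply/esym/eqP.
have JC w : complexify J w = complexify I w + y%:C *: NC w + z%:C *: complexify I (NC w).
  rewrite !complexifyE JE !(add_lfunE, scale_lfunE, comp_lfunE).
  by congr pair; rewrite /= !(scale0r, subr0, addr0).
rewrite eqEdim gr_dim dim_line ?oner_eq0 // leqnn andbT.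
apply/span_subvP => _ /mapP[i _ ->]; have ik := ltn_ord i.
have -> : line_vec k r e 1 c i = e`_i + c *: NC e`_i.
  rewrite /line_vec; case: ifP => ir; first by rewrite scale1r (nil_shift eN ir).
  by rewrite (nil_kill eN) ?scaler0 ?addr0 // ik andbT leqNgt ir.
have ei := nil_low eN ik; set b := NC e`_i.
have Ia : complexify I e`_i = 'i%C *: e`_i by apply/eqP; rewrite -mem_period_eigen.
have Ib : complexify I b = - ('i%C *: b).
  have := nil_swap IN ei; rewrite mem_period_eigen complexify_opp => /eqP <-.
  by rewrite opprK.
have Nb : NC b = 0 by exact: nil_sqr IN.
have I0 : complexify I 0 = 0 by rewrite linear0.
rewrite mem_period_eigen linearD linearZ /= !JC -/b Nb Ia Ib I0 !scaler0 !addr0.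
rewrite scalerDr -!addrA; apply/eqP; congr (_ + _).
rewrite !scalerN !scalerA -!scaleNr -!scalerDl; congr (_ *: _).
by apply/eqP; rewrite eq_complex /=; apply/andP; split; apply/eqP; field.
Qed.

Lemma affine_range : period dimV @` S_affine I N = piece r e setT.
Proof.
apply/seteqP; split=> [_ [J [y [z JE]] <-]|U [[c c'] _ UE]].
  by eexists; last exact: nil_period JE.
pose J := ComplStructure (IN_pair_sqr false (- (2 * c')) (- (2 * c)) IN).
have JE : J = cs_op I + (- (2 * c')) *: N + (- (2 * c)) *: (I \o N)%VF :> 'End(V).
  by rewrite /= expr0 scale1r.
exists J; first by exists (- (2 * c')), (- (2 * c)).
apply: gr_eq; rewrite (nil_period JE) UE; congr line_space.
by apply/eqP; rewrite eq_complex /=; apply/andP; split; apply/eqP; field.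
Qed.

Lemma nil_affine_disk : complex_curve_disk (piece r e setT : set Gr).
Proof. exact: plane_piece. Qed.

Lemma affine_center : piece r e setT (period dimV I).
Proof.
rewrite -affine_range; exists I => //; exists 0, 0.
by rewrite !scale0r !addr0.
Qed.

Variables (p : Gr).
Hypothesis pE : gr_space p = P.

Lemma nil_real : exists2 v : V, N v != 0 & forall u, real_vec (N u) \in gr_space p.
Proof.
have [_ N0 _] := IN; have [v v0] : exists v, N v != 0.
  apply: contrapT => nv; case/eqP: N0; apply/lfunP => v; rewrite zero_lfunE.
  by apply/eqP/negPn/negP => Nv; apply: nv; exists v.
exists v => // u; rewrite pE.
have -> : real_vec (N u) = NC (real_vec u) by rewrite complexifyE /= linear0.
exact: nil_image.
Qed.

Lemma nil_line : (line r e : set Gr) = piece r e setT `|` [set p].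
Proof.
apply/seteqP; split=> [U [s [t [st UE]]]|U [/piece_line //|->]]; last first.
  by exists 0, 1; rewrite oner_eq0 orbT.
have [s0|s0] := eqVneq s 0; last by left; exists (t / s); rewrite // UE line_div.
have t0 : t != 0 by move: st; rewrite s0 eqxx.
by right; apply: gr_eq; rewrite pE UE s0 -(line_scale k r e 0 1 t0) mulr0 mulr1.
Qed.

Lemma nil_line_real : (line r e : set Gr) `&` L = [set p].
Proof.
have [v v0 Np] := nil_real.
have pL : L p by apply/real_locusP; exists (N v).
rewrite nil_line; apply/seteqP; split=> [U [[UP|//] UL]|_ ->]; last by split=> //; right.
by case: UL; move: UP; rewrite -affine_range => -[J _ <-]; exists J.
Qed.

Section Tangent.
Variables (phi : Er -> Gr) (x : Er).
Hypotheses (phiA : gr_real_atlas k VC phi) (phix : phi x = p).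
Local Notation e' := (swap k r e).

Lemma nil_point_swap : gr_space (phi x) = line_space k r e' 1 0.
Proof. by rewrite phix pE line_swap. Qed.

(** Let u be a real vector of the point whose image under the velocity is, modulo
    the point, a real vector v. Then N v = c u'', where u'' is the component of u
    in the (-i)-eigenspace of I: it is both real and in that eigenspace, hence
    zero, while u'' = 0 would make u a real vector of the i-eigenspace. *)
Lemma nil_velocity (f : d.-tuple VC) (h : Er) (c : R[i]) : basis_of fullv f ->
  (forall z, gr_space (phi z) = graph_space f (to_complex z)) ->
  (forall (a : 'I_k -> R[i]) j, (j < d - k)%N ->
    crd e' (k + j) (\sum_i a i *: velocity f (to_complex h) i) =
    if (j < r)%N then c * crd e' j (\sum_i a i *: frame f (to_complex x) i) else 0) ->
  tangent_cone phi L x h -> c = 0.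
Proof.
move=> fB phiE cE hC; have kd : (k <= d)%N by exact: leq_trans (leq_addr _ _) krd.
have e'B := swap_basis rk krd eB.
have [U /real_locusP //|a [u0 u2 [q qx vq]]] := tangent_cone_real kd fB phiE _ hC.
have {}cE := cE a; set u := \sum_i _ in u0 u2 cE.
pose v : VC := \sum_i a i *: velocity f (to_complex h) i.
have memE w : w \in gr_space (phi x) <-> forall j, (j < d - k)%N -> crd e' (k + j) w = 0.
  rewrite nil_point_swap mem_affine //; split=> H j jd; rewrite H //.
    by rewrite mul0r if_same.
  by rewrite mul0r if_same.
have ux : u \in gr_space (phi x) by rewrite phiE; apply/graph_span; exists a.
(* Modulo p the velocity maps u to c al; be = N al is the component of u in the
   (-i)-eigenspace. *)
pose al := \sum_(j < r) crd e' j u *: e'`_(k + j).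
pose be := \sum_(j < r) crd e' j u *: e'`_j.
have lowE j : (j < r)%N -> e'`_j = e`_(k + j).
  by move=> jr; rewrite nth_mix_low // scale0r add0r scale1r.
have highE j : (j < r)%N -> e'`_(k + j) = e`_j.
  by move=> jr; rewrite nth_mix_high // scale0r addr0 scale1r.
have ab : NC al = be.
  rewrite linear_sum; apply: eq_bigr => j _.
  by rewrite linearZ /= (lowE _ (ltn_ord j)) (highE _ (ltn_ord j)) (nil_shift eN).
have alp : al \in Vp.
  apply: memv_suml => j _; rewrite memvZ // highE //; apply: (nil_low eN).
  exact: leq_trans (ltn_ord j) rk.
have crd_shift m i (b : nat -> R[i]) : (i < d)%N ->
    crd e' i (\sum_(j < r) b j *: e'`_(m + j)) = if (m <= i < m + r)%N then b (i - m)%N else 0.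
  move=> id_; rewrite linear_sum; case: ifP => [/andP[mi imr]|ni].
    have jr : (i - m < r)%N by lia.
    rewrite (bigD1 (Ordinal jr)) //= linearZ /= crd_basis // subnKC // eqxx mulr1.
    rewrite big1 ?addr0 // => j; rewrite -val_eqE /= => ji.
    by rewrite linearZ /= crd_basis // (_ : (_ == _) = false) ?mulr0 //; lia.
  rewrite big1 // => j _; rewrite linearZ /= crd_basis //.
  by rewrite (_ : (_ == _) = false) ?mulr0 //; have := ltn_ord j; lia.
have vN : NC v = c *: be.
  rewrite -ab -linearZ; apply/eqP; rewrite -subr_eq0 -linearB /=; apply/eqP.
  apply: nil_point_kill; rewrite -pE -phix; apply/memE => j jd.
  rewrite linearB linearZ /= /v cE // [crd e' _ al](crd_shift k _ (fun i => crd e' i u)); last by lia.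
  rewrite leq_addr ltn_add2l /= addKn.
  by case: ifP; rewrite ?mulr0 subrr.
have qN : NC q = 0 by apply: nil_point_kill; rewrite -pE -phix.
have cb : c *: be = 0.
  have E : c *: be = NC (v - q) by rewrite linearB /= qN subr0 vN.
  have E2 : (c *: be).2 = 0.
    by rewrite E complexifyE /= vq subrr linear0.
  rewrite (real_vecE E2) (@period_no_real _ _ (cs_opp I) (c *: be).1) //.
  by rewrite -real_vecE // memvZ // -ab nil_swap.
move/eqP: cb; rewrite scaler_eq0 => /orP[/eqP //|/eqP be0].
case/eqP: u0; rewrite (real_vecE u2) (@period_no_real _ _ I u.1) // -real_vecE //.
rewrite -[u]subr0 -be0 (basis_sum (u - be) e'B); apply: memv_suml => i _.
have -> : crd e' i (u - be) = if (r <= i < k)%N then crd e' i u else 0.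
  rewrite linearB /= [crd e' i be](crd_shift 0%N i (fun j => crd e' j u)) // add0n subn0 /=.
  case: ifP => ir; first by rewrite subrr ifF //; lia.
  rewrite subr0; case: ifP => // ik; have ki : (k <= i)%N by lia.
  by rewrite -(subnKC ki) (memE u).1 //; have := ltn_ord i; lia.
case: ifP => [/andP[ri ik]|_]; last by rewrite scale0r mem0v.
rewrite memvZ // nth_mix_other //; first exact: (nil_low eN).
by apply/negP => /andP[]; lia.
Qed.

Lemma nil_tangent (F : set_system R) (FF : ProperFilter F) (g : R -> Er) (h : Er) :
  0^' `<=` F -> g 0 = x -> (fun t => t^-1 *: (g t - g 0)) @ F --> h ->
  F [set t | line r e (phi (g t))] -> tangent_cone phi L x h -> h = 0.
Proof.
move=> F0 g0 gh Fl hC; have [f fB phiE] := gr_real_atlasP phiA.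
have kd : (k <= d)%N by exact: leq_trans (leq_addr _ _) krd.
have e'B := swap_basis rk krd eB.
have g0E : gr_space (phi (g 0)) = line_space k r e' 1 0 by rewrite g0 nil_point_swap.
have Fl' : F [set t | line r e' (phi (g t))] by apply: filterS Fl => t; rewrite /= line_swapE.
have [c cE] := @line_velocity R VC k kd f e' r phi F _ g h r0 rk krd fB e'B
  phiE F0 gh g0E Fl'.
rewrite g0 in cE; have c0 := nil_velocity fB phiE cE hC.
apply: (@velocity_inj _ _ k kd f e' r x) => //; first by rewrite -phiE nil_point_swap.
move=> a j jd; rewrite cE // c0 mul0r if_same linear_sum big1 //= => i _.
rewrite linearZ /= /velocity big1 ?linear0 ?mulr0 // => l _.
by rewrite !mxE /= scale0r.
Qed.

Lemma nil_transverse : exists h, ~ tangent_cone phi L x h.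
Proof.
have [f fB phiE] := gr_real_atlasP phiA; have e'B := swap_basis rk krd eB.
have [g [gs g0 gE vE]] := line_curve r0 rk krd 1 fB e'B phiE nil_point_swap.
exists ('D_1 g 0) => hC.
by have /eqP := nil_velocity fB phiE vE hC; rewrite oner_eq0.
Qed.

End Tangent.

(** The vectors N v and I N v are real vectors of the point, independent over the
    complex numbers because I has no real eigenvalue. *)
Lemma nil_singular : singular_point L p.
Proof.
have kd : (k <= d)%N by exact: leq_trans (leq_addr _ _) krd.
have [v v0 Np] := nil_real.
apply: (@real_locus_singular R V k L p (N v) (N (I v))) => //.
- by move=> U; move/real_locusP.
- move=> s t; have NI : N (I v) = - I (N v).
    have [_ _ IN0] := IN.
    by apply/eqP; rewrite -addr_eq0 addrC -!comp_lfunE -add_lfunE IN0 zero_lfunE.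
  have indep (a b : R) : a *: N v - b *: I (N v) = 0 -> a = 0 /\ b = 0.
    move=> E; have := congr1 (fun u => b *: I u) E; rewrite linearB !linearZ /= cs_opK.
    have -> : I 0 = 0 by rewrite linear0.
    rewrite scaler0 scalerDr opprK !scalerA => E'.
    have : (a ^+ 2 + b ^+ 2) *: N v = 0.
      have := congr1 (fun u => a *: u) E; rewrite scalerBr !scalerA scaler0 => E1.
      by have := congr2 +%R E1 E'; rewrite addr0 [b * a]mulrC addrA subrK scalerDl !expr2.
    move/eqP; rewrite scaler_eq0 (negbTE v0) orbF paddr_eq0 ?sqr_ge0 // !sqrf_eq0.
    by case/andP => /eqP -> /eqP ->.
  rewrite NI; case: s t => [s s'] [t t'] => -[] /=.
  rewrite !(scaler0, subr0, addr0, add0r) !scalerN => /indep[-> ->] /indep[-> ->].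
  by [].
- exact: nil_transverse.
Qed.

End Basis.
End NilpotentLine.

(** * The union of the two lines of S(I,N) *)

Section NilpotentPair.
Context (R : realType) (n : nat) (V : vectType R).
Hypothesis dimV : \dim {:V} = (4 * n)%N.
Local Notation VC := (complexification V).
Local Notation d := (\dim {:VC}).
Local Notation k := (2 * n)%N.
Local Notation Gr := (grassmannian k VC).
Local Notation L := (real_locus dimV).
Variables (I : compl_structure V) (N : 'End(V)).
Hypothesis IN : IN_pair I N.
Variables (r r' : nat) (e e' : d.-tuple VC) (p p' : Gr).
Hypotheses (eN : nil_basis n I N r e) (e'N : nil_basis n (cs_opp I) N r' e').
Hypotheses (pE : gr_space p = line_space k r e 0 1) (p'E : gr_space p' = line_space k r' e' 0 1).
Local Notation S := (period dimV @` S_IN I N).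
Local Notation P := (piece r e setT : set Gr).
Local Notation P' := (piece r' e' setT : set Gr).

Let dE : d = (k + k)%N. Proof. by rewrite dim_complexification dimV; lia. Qed.
Let r0 : (0 < r)%N. Proof. exact: nilr_gt0 eN. Qed.
Let rk : (r <= k)%N. Proof. exact: nilr_le eN. Qed.
Let krd : (k + r <= d)%N. Proof. by rewrite dE leq_add2l. Qed.
Let eB : basis_of fullv e. Proof. exact: nil_basisB eN. Qed.
Let r0' : (0 < r')%N. Proof. exact: nilr_gt0 e'N. Qed.
Let rk' : (r' <= k)%N. Proof. exact: nilr_le e'N. Qed.
Let krd' : (k + r' <= d)%N. Proof. by rewrite dE leq_add2l. Qed.
Let eB' : basis_of fullv e'. Proof. exact: nil_basisB e'N. Qed.
Let IN' : IN_pair (cs_opp I) N. Proof. exact: IN_opp. Qed.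

Lemma IN_pieces : S = P `|` P'.
Proof. by rewrite -(affine_range dimV IN eN) -(affine_range dimV IN' e'N) S_IN_affine image_setU. Qed.

Lemma IN_Compl : S `<=` Compl dimV.
Proof. by move=> U [J _ <-]; exists J. Qed.

(** The affine parts of the two lines are disjoint and consist of complex
    structures, which the points at infinity are not. *)
Lemma lines_meet : (line r e : set Gr) `&` line r' e' = [set p] `&` [set p'].
Proof.
have pl : line r e p by rewrite (nil_line pE); right.
have pl' : line r' e' p' by rewrite (nil_line p'E); right.
have pL : L p by have : [set p] p by []; rewrite -(nil_line_real dimV IN eN pE) => -[].
have p'L : L p' by have : [set p'] p' by []; rewrite -(nil_line_real dimV IN' e'N p'E) => -[].
apply/seteqP; split=> U []; last by move=> -> /= pp'; split; rewrite // pp'.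
rewrite (nil_line pE) (nil_line p'E).
rewrite -(affine_range dimV IN eN) -(affine_range dimV IN' e'N).
case=> [UP|->] [UP'|] //.
- by have : (period dimV @` S_affine I N `&` (period dimV @` S_affine (cs_opp I) N)) U by [];
    rewrite affine_disjoint.
- by move=> Up'; rewrite Up' in UP; case: UP => J _ Jp; case: p'L; exists J.
- by case: UP' => J _ Jp; case: pL; exists J.
Qed.

Lemma pieces_line : P `&` line r' e' = set0.
Proof.
rewrite -subset0 => U [UP Ul'].
have : (line r e `&` line r' e' : set Gr) U by split=> //; exact: piece_line UP.
rewrite lines_meet => -[Up _]; move: UP; rewrite Up -(affine_range dimV IN eN) => -[J _ Jp].
have : L p by have : [set p] p by []; rewrite -(nil_line_real dimV IN eN pE) => -[].
by case; exists J.
Qed.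

(** A curve in the union of the two lines could jump from one to the other. It is
    frequently in the first one, and nil_tangent applies along these times, or
    eventually in the second one; then the two points coincide, since a line is
    closed, and nil_tangent applies to the second line. *)
Lemma IN_tangent phi x : gr_real_atlas k VC phi -> phi x = p ->
  tangent_space phi ((line r e : set Gr) `|` line r' e') x `&` tangent_cone phi L x = [set 0].
Proof.
move=> phiA phix; have kd : (k <= d)%N by exact: leq_trans (leq_addr _ _) krd.
have [pl pL] : (line r e `&` L) p by rewrite (nil_line_real dimV IN eN pE).
apply/seteqP; split; last first.
  move=> _ ->.
  have T0 Z : Z p -> tangent_space phi Z x 0.
    move=> Zp; exists (fun=> x); split=> //; first exact: smooth_cst.
      by apply: (@filterE _ _ (nbhs_filter (0 : R))) => t; rewrite phix.
    exact: derive_cst.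
  split; first by apply: T0; left.
  by apply: (@tangent_space_smooth_cone _ _ _ _ [set p]) (T0 _ _) => // U ->.
move=> h [[g [gs g0 gZ gh]] hC] /=.
have gq : (fun t => t^-1 *: (g t - g 0)) @ 0^' --> h by rewrite -gh; exact: smooth_quotient.
pose A : set R := [set t | line r e (phi (g t))].
have [nA|pA] := pselect ((0 : R)^' (~` A)); last first.
  have FF : ProperFilter (within A (0 : R)^').
    apply: Build_ProperFilter_ex => B wB; apply: contrapT => nB; apply: pA.
    have wB' : (0 : R)^' [set t | A t -> B t] := wB.
    by apply: (@filterS _ (0 : R)^' _ _ _ _ wB') => t Bt At; apply: nB; exists t; exact: Bt.
  have F0 : (0 : R)^' `<=` within A (0 : R)^'.
    by move=> B nB; apply: (@filterS _ (0 : R)^' _ _ _ _ nB) => t Bt _.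
  have Fq : (fun t => t^-1 *: (g t - g 0)) @ within A (0 : R)^' --> h.
    by move=> B nB; apply: F0; exact: gq.
  have FA : within A (0 : R)^' A by apply: (@filterE _ _ (dnbhs_filter (0 : R))).
  exact: (nil_tangent IN eN pE phiA phix FF F0 g0 Fq FA hC).
have gl' : (0 : R)^' [set t | line r' e' (phi (g t))].
  by apply: filterS2 nA (nbhs_dnbhs gZ) => t nt [].
have p'l : line r' e' p.
  have cl := zero_set_closed (zero_set_line kd r0' rk' krd' eB').
  rewrite (iffLR (closure_id _) cl) -phix -g0.
  apply: (@closure_limit _ _ (0 : R)^' _ (fun t => phi (g t)) _ _ _ gl').
  have gc : g @ (0 : R)^' --> g 0 by apply: cvg_difference_quotient gq.
  by move=> B /(gr_real_atlas_continuous phiA) nB; exact: gc _ nB.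
have pp' : p = p'.
  have : ([set p] `&` [set p']) p by rewrite -lines_meet; split.
  by case.
have phix' : phi x = p' by rewrite phix.
exact: (nil_tangent IN' e'N p'E phiA phix' _ (fun _ => id) g0 gq gl' hC).
Qed.

Lemma IN_touches : touches_real_locus dimV ((line r e : set Gr) `|` line r' e') (line r e) p.
Proof.
split.
- exact: line_is_P1.
- exact: (nil_line_real dimV IN eN pE).
- exact: (nil_singular dimV IN eN pE).
- exact: IN_tangent.
Qed.

(** If the two points coincide, then both components of a real vector killed by N
    are of the form N b. Hence the kernel of N is contained in its image, whose
    dimension is then at least one half of that of V. *)
Lemma nil_points_distinct : (\dim (limg N) < k)%N -> p <> p'.
Proof.
move=> dN pp'; suff kl : (lker N <= limg N)%VS.
  have := limg_ker_dim N fullv; rewrite capfv dimV => E.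
  by have := dimvS kl; lia.
apply/subvP => v; rewrite memv_ker => /eqP Nv.
have [w' [w'' [w'I w''I vE]]] := period_split I (real_vec v).
have Nvw : complexify N w' + complexify N w'' = 0.
  by rewrite -linearD -vE /= complexifyE /= Nv linear0.
have Nw' : complexify N w' = 0.
  apply: (period_cap (I := I)); last exact: nil_swap IN w'I.
  by move/eqP: Nvw; rewrite addr_eq0 => /eqP ->; rewrite rpredN; exact: nil_swap_opp IN w''I.
have Nw'' : complexify N w'' = 0 by rewrite Nw' add0r in Nvw.
have [b' w'E] : exists b, w' = complexify N b.
  apply: (nil_point_high IN' e'N); last by rewrite period_opp_opp.
  by rewrite -p'E -pp' pE; exact: (nil_kernel eN).
have [b'' w''E] : exists b, w'' = complexify N b.
  apply: (nil_point_high IN eN) => //.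
  by rewrite -pE pp' p'E; exact: (nil_kernel e'N).
have : real_vec v = complexify N (b' + b'') by rewrite linearD /= -w'E -w''E vE.
by rewrite complexifyE => -[-> _]; apply: memv_img; exact: memvf.
Qed.

End NilpotentPair.

Lemma nil_basis_opp (R : realType) (n : nat) (V : vectType R) (I : compl_structure V)
    (N : 'End(V)) r (e : (\dim {:complexification V}).-tuple (complexification V)) :
  nil_basis n I N r e -> nil_basis n (cs_opp (cs_opp I)) N r e.
Proof. by case=> *; split; rewrite // !period_opp_opp. Qed.

Lemma IN_curve (R : realType) (n : nat) (V : vectType R) (dimV : \dim {:V} = (4 * n)%N)
    (I : compl_structure V) (N : 'End(V)) : IN_pair I N ->
  let S := period dimV @` S_IN I N in
  let Z := closure S in
  let Zp := closure (connected_component S (period dimV I)) in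
  let Zm := closure (connected_component S (period dimV (cs_opp I))) in
  [/\ two_complex_disks dimV I S, analytic_curve (gr_atlas _ _) Z
   & exists pp pm : grassmannian (2 * n) (complexification V),
     [/\ Z = Zp `|` Zm,
         Zp `&` Zm = [set pp] `&` [set pm],
         (\dim (limg N) < 2 * n)%N ->
           Zp = connected_component Z (period dimV I) /\
           Zm = connected_component Z (period dimV (cs_opp I)),
         touches_real_locus dimV Z Zp pp
       & touches_real_locus dimV Z Zm pm]].
Proof.
move=> IN; have IN' := IN_opp IN.
have [r [e eN]] := nil_basis_ex dimV IN; have [r' [e' e'N]] := nil_basis_ex dimV IN'.
have eN' := nil_basis_opp eN.
have [[r0 rk] eB] := (nilr_gt0 eN, nilr_le eN, nil_basisB eN).
have [[r0' rk'] eB'] := (nilr_gt0 e'N, nilr_le e'N, nil_basisB e'N).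
have dE : \dim {:complexification V} = (2 * n + 2 * n)%N.
  by rewrite dim_complexification dimV; lia.
have krd : (2 * n + r <= \dim {:complexification V})%N by rewrite dE leq_add2l.
have krd' : (2 * n + r' <= \dim {:complexification V})%N by rewrite dE leq_add2l.
have kd : (2 * n <= \dim {:complexification V})%N by rewrite dE leq_addr.
have nz : ((0 : R[i]) != 0) || ((1 : R[i]) != 0) by rewrite oner_eq0 orbT.
have [p pE] := line_point r0 rk krd eB nz; have [p' p'E] := line_point r0' rk' krd' eB' nz.
have meet := lines_meet dimV IN eN e'N pE p'E.
have PP' := pieces_line dimV IN eN e'N pE p'E; have P'P := pieces_line dimV IN' e'N eN' p'E pE.
have cl := zero_set_closed (zero_set_line kd r0 rk krd eB).
have cl' := zero_set_closed (zero_set_line kd r0' rk' krd' eB').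
have Ip := affine_center dimV IN eN; have Im := affine_center dimV IN' e'N.
have Cp := component_of_separated cl cl' (@piece_line _ _ _ _ _ _) (@piece_line _ _ _ _ _ _)
  PP' P'P (affine_connected r0 rk krd eB) Ip.
have Cm := component_of_separated cl' cl (@piece_line _ _ _ _ _ _) (@piece_line _ _ _ _ _ _)
  P'P PP' (affine_connected r0' rk' krd' eB') Im.
rewrite setUC in Cm => S Z; rewrite /Z /S /two_complex_disks.
rewrite (IN_pieces dimV IN eN e'N) Cp Cm closureU !closure_affine //; split.
- split=> //.
  + by rewrite -(IN_pieces dimV IN eN e'N); exact: IN_Compl.
  + rewrite -subset0 => U [UP UP'].
    by rewrite -PP'; split=> //; exact: piece_line UP'.
  + exact: (nil_affine_disk dimV eN).
  + exact: (nil_affine_disk dimV e'N).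
- by have := analytic_curve_lines r0 rk krd r0' rk' krd' eB eB' PP' P'P;
    rewrite closureU !closure_affine.
exists p, p'; split=> //.
- move=> /(nil_points_distinct dimV IN eN e'N pE p'E) pp'.
  have disj : (line r e : set (grassmannian (2 * n) (complexification V))) `&` line r' e' = set0.
    by rewrite meet; apply/seteqP; split=> // U [-> /pp'].
  have con : connected (line r e : set (grassmannian (2 * n) (complexification V))).
    by rewrite -closure_affine //; apply: connected_closure; exact: affine_connected.
  have con' : connected (line r' e' : set (grassmannian (2 * n) (complexification V))).
    by rewrite -closure_affine //; apply: connected_closure; exact: affine_connected.
  have disj' := disj; rewrite setIC in disj'.
  split; apply/esym.
    by apply: (component_of_separated cl cl'); rewrite ?disj //; exact: piece_line Ip.
  by rewrite setUC; apply: (component_of_separated cl' cl); rewrite ?disj //; exact: piece_line Im.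
- exact: (IN_touches dimV IN eN e'N pE p'E).
- by rewrite setUC; exact: (IN_touches dimV IN' e'N eN' p'E pE).
Qed.
Theorem theorem1p1 (R : realType) (n : nat) (V : vectType R)
    (n_gt0 : (0 < n)%N) (dimV : \dim {:V} = (4 * n)%N) :
  [/\ (* (1) *)
      (forall (I : compl_structure V) (Q : 'End(V)), IR_pair I Q ->
         let S := period dimV @` S_IR I Q in
         two_complex_disks dimV I S /\ analytic_curve (gr_atlas _ _) (closure S))
      /\
      (forall (I : compl_structure V) (N : 'End(V)), IN_pair I N ->
         let S := period dimV @` S_IN I N in
         two_complex_disks dimV I S /\ analytic_curve (gr_atlas _ _) (closure S)),
      (* (2) *)
      (forall (I : compl_structure V) (Q : 'End(V)), IR_pair I Q ->
         let L := real_locus dimV in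
         let Z := closure (period dimV @` S_IR I Q) in
         let S1 := Z `&` L in
         [/\ is_P1 Z, is_analytic_circle S1,
             S1 `<=` [set U | real_dim (2 * n) U],
             [set U | real_dim (2 * n) U] `<=` L
           & forall phi x, gr_real_atlas _ _ phi -> S1 (phi x) ->
               tangent_space phi Z x `&` tangent_cone phi L x =
               tangent_space phi S1 x])
    & (* (3) *)
      (forall (I : compl_structure V) (N : 'End(V)), IN_pair I N ->
         let S := period dimV @` S_IN I N in
         let Z := closure S in
         let Zp := closure (connected_component S (period dimV I)) in
         let Zm := closure (connected_component S (period dimV (cs_opp I))) in
         exists pp pm : grassmannian (2 * n) (complexification V),
         [/\ Z = Zp `|` Zm,
             Zp `&` Zm = [set pp] `&` [set pm],
             (\dim (limg N) < 2 * n)%N ->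
               Zp = connected_component Z (period dimV I) /\
               Zm = connected_component Z (period dimV (cs_opp I)),
             touches_real_locus dimV Z Zp pp
           & touches_real_locus dimV Z Zm pm])].
Proof.
split.
- split=> I Q IQ; first by have [] := IR_curve n_gt0 dimV IQ.
  by have [] := IN_curve dimV IQ.
- move=> I Q IQ L Z S1; have [_ _ [? ? ? ?]] := IR_curve n_gt0 dimV IQ.
  by split=> //; exact: real_dim_real_locus.
by move=> I N IN; have [] := IN_curve dimV IN.
Qed.
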